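(* Let $M$ be a matroid and $k$ a field of characteristic $\ell$. Let $F$ be a flat of $M$. The standard module $\Delta_{F,k}$ is a simple $S_k(M)$-module if and only if $\ell$ does not divide $|K\setminus F|$ for any flat $K\supsetneq F$ such that $M^K_F$ is connected. In particular, $S_k(M)$ is semisimple if and only if $\ell\nmid|K\setminus F|$ for any pair of flats $K\supsetneq F$ of $M$ such that $M^K_F$ is connected.
   Context: $M$ is a matroid on a finite ground set $E$ with lattice of flats $\mathcal L$ ordered by inclusion and rank function $\rho$. For flats write $K\lessdot L$ (or $L\gtrdot K$) if $L$ covers $K$. A flag path is a finite nonempty sequence $(K_1,\dots,K_l)$ of flats with $K_i\lessdot K_{i+1}$ or $K_i\gtrdot K_{i+1}$ for each $i<l$ (commas may be replaced by these symbols). The free $\mathbb Z$-module on flag paths is an algebra under concatenation: $(K_1,\dots,K_l)\cdot(L_1,\dots,L_{l'})=(K_1,\dots,K_l=L_1,L_2,\dots,L_{l'})$ if $K_l=L_1$ and $0$ otherwise. $S(M)$ is its quotient by the two-sided ideal generated by: (FS) for flats $L<K$ with $\rho(K)=\rho(L)+2$: $\sum_X(L\lessdot X\lessdot K)=0=\sum_X(K\gtrdot X\gtrdot L)$, sums over flats $X$ with $K\gtrdot X\gtrdot L$; ($\bigwedge$) for $K\lessdot L$ and $K'\lessdot L$: $(K\lessdot L\gtrdot K')$ equals $|L\setminus K|\,(K)$ if $K=K'$; $-(K\gtrdot K\cap K'\lessdot K')$ if $K\ne K'$ and $K\cap K'\lessdot K$; and $0$ otherwise. $S_k(M)=S(M)\otimes_{\mathbb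 Z}k$. Standard module: $\Delta_F$ is the left module $S(M)\cdot(F)$ modulo the $\mathbb Z$-span of the images of all flag paths that end at $F$ and pass through some flat not containing $F$; $\Delta_{F,k}=\Delta_F\otimes_{\mathbb Z}k$. $M^K_F$ denotes the restriction of $M$ to $K$ contracted by $F$: a matroid on $K\setminus F$ whose flats are $G\setminus F$ for flats $F\subseteq G\subseteq K$. A matroid is connected if it is not a direct sum of two matroids on nonempty ground sets. The integer $0$ divides only $0$. *)

(* Defs.v *)
From HB Require Import structures.
From mathcomp Require Import all_boot all_order all_algebra.
From mathcomp Require Import finmap.
From mathcomp.multinomials Require Import monalg.
From mathcomp Require Import boolp.

Set Implicit Arguments.
Unset Strict Implicit.
Unset Printing Implicit Defensive.

Import GRing.Theory.

(* A matroid on the finite set [ground] of elements of [T], given by its rank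
   function; values of [rank] outside the subsets of [ground] are irrelevant. *)
Record matroid (T : finType) := Matroid {
  ground : {set T};
  rank : {set T} -> nat;
  rank_card : forall A : {set T}, A \subset ground -> rank A <= #|A|;
  rank_mono : forall A B : {set T}, A \subset B -> B \subset ground -> rank A <= rank B;
  rank_submod : forall A B : {set T}, A \subset ground -> B \subset ground ->
    rank (A :|: B) + rank (A :&: B) <= rank A + rank B
}.

Section Matroid.
Variable T : finType.
Implicit Types (M : matroid T) (A B F K L X : {set T}).

Definition flats M : {set {set T}} :=
  [set K : {set T} | (K \subset ground M) &&
     [forall x in ground M :\: K, rank M K < rank M (x |: K)]].

(* [covers M K L] : L covers K in the lattice of flats. *)
Definition covers M K L : bool :=
  [&& K \in flats M, L \in flats M, K \proper L &
      [forall X in flats M, ~~ ((K \proper X) && (X \proper L))]].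

Fact restrict_card M K A :
  A \subset K :&: ground M -> rank M A <= #|A|.
Proof. by rewrite subsetI => /andP[_]; apply: rank_card. Qed.

Fact restrict_mono M K A B :
  A \subset B -> B \subset K :&: ground M -> rank M A <= rank M B.
Proof. by move=> AB; rewrite subsetI => /andP[_]; apply: rank_mono. Qed.

Fact restrict_submod M K A B :
    A \subset K :&: ground M -> B \subset K :&: ground M ->
  rank M (A :|: B) + rank M (A :&: B) <= rank M A + rank M B.
Proof. by rewrite !subsetI => /andP[_ ?] /andP[_ ?]; apply: rank_submod. Qed.

Definition restrict M K : matroid T :=
  Matroid (@restrict_card M K) (@restrict_mono M K) (@restrict_submod M K).

Definition contract_rank M F A : nat :=
  rank M (A :|: (F :&: ground M)) - rank M (F :&: ground M).

Fact contract_sub M F A :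
  A \subset ground M :\: F -> A :|: (F :&: ground M) \subset ground M.
Proof.
by rewrite subsetD => /andP[Ag _]; rewrite subUset Ag subsetIr.
Qed.

Fact contract_card M F A :
  A \subset ground M :\: F -> contract_rank M F A <= #|A|.
Proof.
move=> Ag; rewrite leq_subLR.
have Ag' : A \subset ground M by move: Ag; rewrite subsetD => /andP[].
apply: leq_trans (leq_addr (rank M (A :&: (F :&: ground M))) _) _.
apply: leq_trans (rank_submod Ag' (subsetIr _ _)) _.
by rewrite addnC leq_add2l rank_card.
Qed.

Fact contract_mono M F A B : A \subset B -> B \subset ground M :\: F ->
  contract_rank M F A <= contract_rank M F B.
Proof.
by move=> AB Bg; rewrite leq_sub2r // rank_mono ?setSU ?contract_sub.
Qed.

Fact contract_submod M F A B :
    A \subset ground M :\: F -> B \subset ground M :\: F ->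
  contract_rank M F (A :|: B) + contract_rank M F (A :&: B)
    <= contract_rank M F A + contract_rank M F B.
Proof.
move=> Ag Bg; rewrite /contract_rank; set G := F :&: ground M.
have Ag' := contract_sub Ag; have Bg' := contract_sub Bg.
have ge C : C :|: G \subset ground M -> rank M G <= rank M (C :|: G).
  by move=> Cg; apply: rank_mono => //; apply: subsetUr.
have := rank_submod Ag' Bg'; rewrite -setUUl -setUIl => le.
have gAB : A :|: B :|: G \subset ground M by rewrite setUUl subUset Ag'.
have gIB : (A :&: B) :|: G \subset ground M.
  by apply: subset_trans Ag'; rewrite setSU // subsetIl.
move: le (ge _ Ag') (ge _ Bg') (ge _ gAB) (ge _ gIB).
move: (rank M (A :|: B :|: G)) (rank M _) (rank M (A :|: G)) => a b c.
move: (rank M (B :|: G)) (rank M G) => d e le ec ed ea eb.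
by rewrite -(leq_add2r (e + e)) addnACA !subnK // addnACA !subnK.
Qed.

Definition contract M F : matroid T :=
  Matroid (@contract_card M F) (@contract_mono M F) (@contract_submod M F).

(* The minor written M^K_F : restriction to K, then contraction by F. *)
Definition minor M F K : matroid T := contract (restrict M K) F.

Definition is_direct_sum M (M1 M2 : matroid T) : Prop :=
  [/\ [disjoint ground M1 & ground M2],
      ground M = ground M1 :|: ground M2 &
      forall A, A \subset ground M ->
        rank M A = rank M1 (A :&: ground M1) + rank M2 (A :&: ground M2)].

Definition matroid_connected M : Prop :=
  ~ exists M1 M2 : matroid T,
      [/\ ground M1 != set0, ground M2 != set0 & is_direct_sum M M1 M2].

End Matroid.

Local Open Scope ring_scope.

Inductive zspan (V : zmodType) (G : V -> Prop) : V -> Prop :=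
| zspan0 : zspan G 0
| zspan_gen x : G x -> zspan G x
| zspanB x y : zspan G x -> zspan G y -> zspan G (x - y).

Definition zspan_pred (V : zmodType) (G : V -> Prop) : {pred V} :=
  fun x => `[< zspan G x >].

Fact zspan_zmod_closed V G : zmod_closed (@zspan_pred V G).
Proof.
split=> [|x y]; first exact/asboolP/zspan0.
by move=> /asboolP xP /asboolP yP; apply/asboolP/zspanB.
Qed.

HB.instance Definition _ (V : zmodType) (G : V -> Prop) :=
  GRing.isZmodClosed.Build V (zspan_pred G) (zspan_zmod_closed G).

(* The two-sided ideal generated by [G]. *)
Inductive ideal_gen (R : pzRingType) (G : R -> Prop) : R -> Prop :=
| ideal_gen0 : ideal_gen G 0
| ideal_gen_gen x : G x -> ideal_gen G x
| ideal_genB x y : ideal_gen G x -> ideal_gen G y -> ideal_gen G (x - y)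
| ideal_genMl a x : ideal_gen G x -> ideal_gen G (a * x)
| ideal_genMr a x : ideal_gen G x -> ideal_gen G (x * a).

Definition ideal_pred (R : pzRingType) (G : R -> Prop) : {pred R} :=
  fun x => `[< ideal_gen G x >].

Fact ideal_zmod_closed R G : zmod_closed (@ideal_pred R G).
Proof.
split=> [|x y]; first exact/asboolP/ideal_gen0.
by move=> /asboolP xP /asboolP yP; apply/asboolP/ideal_genB.
Qed.

HB.instance Definition _ (R : pzRingType) (G : R -> Prop) :=
  GRing.isZmodClosed.Build R (ideal_pred G) (ideal_zmod_closed G).

Definition ring_quot (R : pzRingType) (G : R -> Prop) : Type :=
  Quotient.quot (ideal_pred G).

HB.instance Definition _ (R : pzRingType) (G : R -> Prop) :=
  GRing.Zmodule.on (ring_quot G).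

Section RingQuotient.
Variables (R : pzRingType) (G : R -> Prop).

Definition rpi : R -> ring_quot G := \pi_(Quotient.quot (ideal_pred G))%qT.
Definition rrepr : ring_quot G -> R := @repr _ (Quotient.quot (ideal_pred G)).

Lemma rreprK : cancel rrepr rpi. Proof. exact: reprK. Qed.

Lemma rpi_eq x y : rpi x = rpi y <-> ideal_gen G (x - y).
Proof.
split=> [e|xy].
  have : x - y \in ideal_pred G by rewrite Quotient.idealrBE; apply/eqP.
  by move/asboolP.
by apply/eqP; rewrite /rpi -Quotient.idealrBE; apply/asboolP.
Qed.

Fact rpi_zmod_morphism : zmod_morphism rpi.
Proof. exact: raddfB. Qed.

HB.instance Definition _ :=
  GRing.isZmodMorphism.Build R (ring_quot G) rpi rpi_zmod_morphism.

Definition rquot_mul (x y : ring_quot G) : ring_quot G :=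
  rpi (rrepr x * rrepr y).

Fact rquot_mulE x y : rquot_mul (rpi x) (rpi y) = rpi (x * y).
Proof.
apply/rpi_eq; set x' := rrepr _; set y' := rrepr _.
have xx' : ideal_gen G (x' - x) by apply/rpi_eq; rewrite rreprK.
have yy' : ideal_gen G (y - y') by apply/rpi_eq; rewrite rreprK.
have -> : x' * y' - x * y = (x' - x) * y' - x * (y - y').
  by rewrite mulrBl mulrBr opprB addrA subrK.
by apply: ideal_genB; [apply: ideal_genMr|apply: ideal_genMl].
Qed.

Fact rquot_mulA : associative rquot_mul.
Proof.
by move=> x y z; rewrite -[x]rreprK -[y]rreprK -[z]rreprK !rquot_mulE mulrA.
Qed.

Fact rquot_mul1l : left_id (rpi 1) rquot_mul.
Proof. by move=> x; rewrite -[x]rreprK rquot_mulE mul1r. Qed.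

Fact rquot_mul1r : right_id (rpi 1) rquot_mul.
Proof. by move=> x; rewrite -[x]rreprK rquot_mulE mulr1. Qed.

Fact rquot_mulDl : left_distributive rquot_mul +%R.
Proof.
move=> x y z; rewrite -[x]rreprK -[y]rreprK -[z]rreprK.
by rewrite -raddfD !rquot_mulE mulrDl raddfD.
Qed.

Fact rquot_mulDr : right_distributive rquot_mul +%R.
Proof.
move=> x y z; rewrite -[x]rreprK -[y]rreprK -[z]rreprK.
by rewrite -raddfD !rquot_mulE mulrDr raddfD.
Qed.

HB.instance Definition _ := GRing.Zmodule_isPzRing.Build (ring_quot G)
  rquot_mulA rquot_mul1l rquot_mul1r rquot_mulDl rquot_mulDr.

Fact rpi_monoid_morphism : monoid_morphism rpi.
Proof. by split=> // x y; rewrite -rquot_mulE. Qed.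

HB.instance Definition _ :=
  GRing.isMonoidMorphism.Build R (ring_quot G) rpi rpi_monoid_morphism.

End RingQuotient.

(* A copy of [N] carrying a [zmodClosed] structure: [submodClosed] only provides
   closure under sums and scaling. *)
Definition submod_pred (R : pzRingType) (V : lmodType R) (N : submodClosed V)
  : {pred V} := N.

Fact submod_pred_zmod_closed (R : pzRingType) (V : lmodType R)
  (N : submodClosed V) : zmod_closed (submod_pred N).
Proof. by apply: GRing.subsemimod_closedB; apply: GRing.subsemimodClosedP. Qed.

HB.instance Definition _ (R : pzRingType) (V : lmodType R)
    (N : submodClosed V) :=
  GRing.isZmodClosed.Build V (submod_pred N) (submod_pred_zmod_closed N).

Definition lmod_quot (R : pzRingType) (V : lmodType R) (N : submodClosed V)
  : Type := Quotient.quot (submod_pred N).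

HB.instance Definition _ (R : pzRingType) (V : lmodType R)
  (N : submodClosed V) := GRing.Zmodule.on (lmod_quot N).

Section LmodQuotient.
Variables (R : pzRingType) (V : lmodType R) (N : submodClosed V).

Definition lpi : V -> lmod_quot N := \pi_(Quotient.quot (submod_pred N))%qT.
Definition lrepr : lmod_quot N -> V := @repr _ (Quotient.quot (submod_pred N)).

Lemma lreprK : cancel lrepr lpi. Proof. exact: reprK. Qed.

Lemma lpi_eq x y : lpi x = lpi y <-> x - y \in N.
Proof.
split=> [e|xy].
  have : x - y \in submod_pred N by rewrite Quotient.idealrBE; apply/eqP.
  by [].
by apply/eqP; rewrite /lpi -Quotient.idealrBE.
Qed.

Fact lpi_zmod_morphism : zmod_morphism lpi.
Proof. exact: raddfB. Qed.

HB.instance Definition _ :=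
  GRing.isZmodMorphism.Build V (lmod_quot N) lpi lpi_zmod_morphism.

Definition lquot_scale (a : R) (x : lmod_quot N) : lmod_quot N :=
  lpi (a *: lrepr x).

Fact lquot_scaleE a x : lquot_scale a (lpi x) = lpi (a *: x).
Proof.
by apply/lpi_eq; rewrite -scalerBr rpredZ //; apply/lpi_eq; rewrite lreprK.
Qed.

Fact lquot_scaleA a b x :
  lquot_scale a (lquot_scale b x) = lquot_scale (a * b) x.
Proof. by rewrite -[x]lreprK !lquot_scaleE scalerA. Qed.

Fact lquot_scale1 : left_id 1 lquot_scale.
Proof. by move=> x; rewrite -[x]lreprK lquot_scaleE scale1r. Qed.

Fact lquot_scaleDr : right_distributive lquot_scale +%R.
Proof.
move=> a x y; rewrite -[x]lreprK -[y]lreprK.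
by rewrite -raddfD !lquot_scaleE scalerDr raddfD.
Qed.

Fact lquot_scaleDl x : {morph lquot_scale^~ x : a b / a + b}.
Proof.
by move=> a b; rewrite /= -[x]lreprK !lquot_scaleE scalerDl raddfD.
Qed.

HB.instance Definition _ := GRing.Zmodule_isLmodule.Build R (lmod_quot N)
  lquot_scaleA lquot_scale1 lquot_scaleDr lquot_scaleDl.

Fact lpi_scalable : scalable lpi.
Proof. by move=> a x; apply: esym; apply: lquot_scaleE. Qed.

HB.instance Definition _ :=
  GRing.isScalable.Build R V (lmod_quot N) *:%R lpi lpi_scalable.

End LmodQuotient.

(* The additive extension of [h] to the free abelian group on [K]. It is locked
   so that unification does not unfold products of paths and of tensors. *)
HB.lock Definition malg_lift (K : choiceType) (W : zmodType) (h : K -> W)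
  (g : {malg int[K]}) : W := \sum_(x <- msupp g) h x *~ g@_x.

Section MalgLift.
Variables (K : choiceType) (W : zmodType).
Implicit Types (h : K -> W) (g : {malg int[K]}).

Lemma malg_liftw h (d : {fset K}) g : (msupp g `<=` d)%fset ->
  malg_lift h g = \sum_(x <- d) h x *~ g@_x.
Proof.
move=> gd; rewrite malg_lift.unlock (big_fset_incl _ gd) //= => x _.
by move=> /mcoeff_outdom ->.
Qed.

Fact malg_lift_zmod_morphism h : zmod_morphism (malg_lift h).
Proof.
move=> g1 g2; pose d := (msupp g1 `|` msupp g2)%fset.
rewrite (malg_liftw h (msuppB_le g1 g2)) (malg_liftw h (fsubsetUl _ (msupp g2))).
rewrite (malg_liftw h (fsubsetUr (msupp g1) _)) -sumrB.
by apply: eq_bigr => x _; rewrite mcoeffB mulrzBr.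
Qed.

HB.instance Definition _ h :=
  GRing.isZmodMorphism.Build {malg int[K]} W (malg_lift h)
    (malg_lift_zmod_morphism h).

Lemma malg_lift0 h : malg_lift h 0 = 0.
Proof. exact: raddf0. Qed.

Lemma malg_liftB h g1 g2 :
  malg_lift h (g1 - g2) = malg_lift h g1 - malg_lift h g2.
Proof. exact: raddfB. Qed.

Lemma malg_liftU h x : malg_lift h << x >> = h x.
Proof.
by rewrite (malg_liftw h msuppU_le) big_seq_fset1 mcoeffUU.
Qed.

End MalgLift.

Lemma malg_ind (K : choiceType) (P : {malg int[K]} -> Prop) :
    P 0 -> (forall x, P << x >>) ->
    (forall g1 g2, P g1 -> P g2 -> P (g1 - g2)) ->
  forall g, P g.
Proof.
move=> P0 PU PB g.
have PN g1 : P g1 -> P (- g1) by rewrite -sub0r; apply: PB.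
have PD g1 g2 : P g1 -> P g2 -> P (g1 + g2).
  by move=> P1 /PN P2; rewrite -[g2]opprK; apply: PB.
have Pn x n : P << n%:Z *g x >>.
  elim: n => [|n IHn]; first by rewrite monalgU0.
  by rewrite intS monalgUD; apply: PD.
rewrite [g]monalgE; elim/big_ind: _ => // x _.
by case: (g@_x) => n; rewrite ?NegzE ?monalgUN; [|apply: PN]; apply: Pn.
Qed.

Section Tensor.
Variables U V : zmodType.

Variant bilin_rel : {malg int[(U * V)%type]} -> Prop :=
| bilin_rel_l u u' v :
    bilin_rel (<< (u + u', v) >> - << (u, v) >> - << (u', v) >>)
| bilin_rel_r u v v' :
    bilin_rel (<< (u, v + v') >> - << (u, v) >> - << (u, v') >>).

Definition tensor : Type := Quotient.quot (zspan_pred bilin_rel).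

HB.instance Definition _ := GRing.Zmodule.on tensor.

Definition tensor_pi : {malg int[(U * V)%type]} -> tensor :=
  \pi_(Quotient.quot (zspan_pred bilin_rel))%qT.
Definition tensor_repr : tensor -> {malg int[(U * V)%type]} :=
  @repr _ (Quotient.quot (zspan_pred bilin_rel)).

Lemma tensor_reprK : cancel tensor_repr tensor_pi.
Proof. exact: reprK. Qed.

Lemma tensor_pi_eq x y : tensor_pi x = tensor_pi y <-> zspan bilin_rel (x - y).
Proof.
split=> [e|xy].
  have : x - y \in zspan_pred bilin_rel by rewrite Quotient.idealrBE; apply/eqP.
  by move/asboolP.
by apply/eqP; rewrite /tensor_pi -Quotient.idealrBE; apply/asboolP.
Qed.

Fact tensor_pi_zmod_morphism : zmod_morphism tensor_pi.
Proof. exact: raddfB. Qed.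

HB.instance Definition _ :=
  GRing.isZmodMorphism.Build {malg int[(U * V)%type]} tensor tensor_pi
    tensor_pi_zmod_morphism.

End Tensor.

HB.lock Definition tens (U V : zmodType) (u : U) (v : V) : tensor U V :=
  tensor_pi << (u, v) >>.

Section TensorTheory.
Variables U V : zmodType.
Local Notation tensor := (tensor U V).
Local Notation tens := (@tens U V).

Lemma tensDl u u' v : tens (u + u') v = tens u v + tens u' v.
Proof.
rewrite tens.unlock -raddfD; apply/tensor_pi_eq; rewrite opprD addrA.
exact/zspan_gen/bilin_rel_l.
Qed.

Lemma tensDr u v v' : tens u (v + v') = tens u v + tens u v'.
Proof.
rewrite tens.unlock -raddfD; apply/tensor_pi_eq; rewrite opprD addrA.
exact/zspan_gen/bilin_rel_r.
Qed.

Lemma tensor_ind (P : tensor -> Prop) :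
    P 0 -> (forall u v, P (tens u v)) ->
    (forall s t, P s -> P t -> P (s - t)) ->
  forall t, P t.
Proof.
move=> P0 PU PB t; rewrite -[t]tensor_reprK.
elim/malg_ind: (tensor_repr t) => [|[u v]|x y Px Py]; rewrite ?raddf0 //.
  by have := PU u v; rewrite tens.unlock.
by rewrite raddfB; apply: PB.
Qed.

Definition tensor_lift (W : zmodType) (f : U -> V -> W) (t : tensor) : W :=
  malg_lift (fun p => f p.1 p.2) (tensor_repr t).

Section Lift.
Variables (W : zmodType) (f : U -> V -> W).
Hypotheses (fDl : forall u u' v, f (u + u') v = f u v + f u' v)
           (fDr : forall u v v', f u (v + v') = f u v + f u v').

Lemma tensor_lift_pi x :
  tensor_lift f (tensor_pi x) = malg_lift (fun p => f p.1 p.2) x.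
Proof.
apply/subr0_eq; rewrite -raddfB /=.
have /tensor_pi_eq := tensor_reprK (tensor_pi x).
elim=> [|_ [u u' v|u v v']|y z _ y0 _ z0]; rewrite ?raddf0 ?raddfB //=.
- by rewrite !malg_liftU /= fDl addrAC addrK subrr.
- by rewrite !malg_liftU /= fDr addrAC addrK subrr.
- by rewrite y0 z0 subrr.
Qed.

Lemma tensor_liftE u v : tensor_lift f (tens u v) = f u v.
Proof. by rewrite tens.unlock tensor_lift_pi malg_liftU. Qed.

Lemma tensor_liftB s t :
  tensor_lift f (s - t) = tensor_lift f s - tensor_lift f t.
Proof.
rewrite -[s]tensor_reprK -[t]tensor_reprK -raddfB.
by rewrite !tensor_lift_pi raddfB.
Qed.

Lemma tensor_lift0 : tensor_lift f 0 = 0.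
Proof. by have := tensor_liftB 0 0; rewrite !subrr. Qed.

End Lift.
End TensorTheory.

(* For modules V over A and W over B, the action of the tensor product of A and
   B on the tensor product of V and W: (a (x) b) (v (x) w) = av (x) bw. *)
Section TensorScale.
Variables (A B : pzRingType) (V : lmodType A) (W : lmodType B).
Implicit Types (s : tensor A B) (t : tensor V W).

Definition tensor_scale s t : tensor V W :=
  tensor_lift (fun a b => tensor_lift (fun v w => tens (a *: v) (b *: w)) t) s.

Let in_l (a : A) (b : B) (v v' : V) (w : W) :
  tens (a *: (v + v')) (b *: w)
    = tens (a *: v) (b *: w) + tens (a *: v') (b *: w).
Proof. by rewrite scalerDr tensDl. Qed.

Let in_r (a : A) (b : B) (v : V) (w w' : W) :
  tens (a *: v) (b *: (w + w'))
    = tens (a *: v) (b *: w) + tens (a *: v) (b *: w').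
Proof. by rewrite scalerDr tensDr. Qed.

Let inner a b t := tensor_lift (fun v w => tens (a *: v) (b *: w)) t.

Let innerE a b v w : inner a b (tens v w) = tens (a *: v) (b *: w) :=
  tensor_liftE (in_l a b) (in_r a b) v w.

Let innerB a b t t' : inner a b (t - t') = inner a b t - inner a b t' :=
  tensor_liftB (in_l a b) (in_r a b) t t'.

Let inner0 a b : inner a b 0 = 0 := tensor_lift0 (in_l a b) (in_r a b).

Let out_l t a a' b : inner (a + a') b t = inner a b t + inner a' b t.
Proof.
elim/tensor_ind: t => [|v w|t t' et et'].
- by rewrite !inner0 addr0.
- by rewrite !innerE scalerDl tensDl.
- by rewrite !innerB et et' opprD addrACA.
Qed.

Let out_r t a b b' : inner a (b + b') t = inner a b t + inner a b' t.
Proof.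
elim/tensor_ind: t => [|v w|t t' et et'].
- by rewrite !inner0 addr0.
- by rewrite !innerE scalerDl tensDr.
- by rewrite !innerB et et' opprD addrACA.
Qed.

Let outE a b t : tensor_scale (tens a b) t = inner a b t :=
  tensor_liftE (out_l t) (out_r t) a b.

Lemma tensor_scaleE a b v w :
  tensor_scale (tens a b) (tens v w) = tens (a *: v) (b *: w).
Proof. by rewrite outE innerE. Qed.

Lemma tensor_scaleBl s s' t :
  tensor_scale (s - s') t = tensor_scale s t - tensor_scale s' t.
Proof. exact: (tensor_liftB (out_l t) (out_r t)). Qed.

Let scale0l t : tensor_scale 0 t = 0.
Proof. exact: (tensor_lift0 (out_l t) (out_r t)). Qed.

Lemma tensor_scaleBr s t t' :
  tensor_scale s (t - t') = tensor_scale s t - tensor_scale s t'.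
Proof.
elim/tensor_ind: s => [|a b|s s' es es'].
- by rewrite !scale0l subr0.
- by rewrite !outE innerB.
- by rewrite !tensor_scaleBl es es' !opprD !opprK addrACA.
Qed.

Lemma tensor_scale0l t : tensor_scale 0 t = 0.
Proof. by have := tensor_scaleBl 0 0 t; rewrite !subrr. Qed.

Lemma tensor_scale0r s : tensor_scale s 0 = 0.
Proof. by have := tensor_scaleBr s 0 0; rewrite !subrr. Qed.

Fact tensor_scale1 t : tensor_scale (tens 1 1) t = t.
Proof.
elim/tensor_ind: t => [|v w|s t es et]; first by rewrite tensor_scale0r.
- by rewrite tensor_scaleE !scale1r.
- by rewrite tensor_scaleBr es et.
Qed.

Fact tensor_scaleDl t : {morph tensor_scale^~ t : s s' / s + s'}.
Proof.
move=> s s' /=; rewrite -{1}[s']opprK tensor_scaleBl -[- s']sub0r.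
by rewrite tensor_scaleBl tensor_scale0l sub0r opprK.
Qed.

Fact tensor_scaleDr : right_distributive tensor_scale +%R.
Proof.
move=> s t t'; rewrite -{1}[t']opprK tensor_scaleBr -[- t']sub0r.
by rewrite tensor_scaleBr tensor_scale0r sub0r opprK.
Qed.

End TensorScale.

Section TensorRing.
Variables A B : pzRingType.

Definition tensor_mul (s t : tensor A B) : tensor A B :=
  @tensor_scale A B A^o B^o s t.

Lemma tensor_mulE a b a' b' :
  tensor_mul (tens a b) (tens a' b') = tens (a * a') (b * b').
Proof. exact: (@tensor_scaleE A B A^o B^o). Qed.

Fact tensor_scaleA (V : lmodType A) (W : lmodType B) s s' (t : tensor V W) :
  tensor_scale s (tensor_scale s' t) = tensor_scale (tensor_mul s s') t.
Proof.
elim/tensor_ind: s => [|a b|s1 s2 e1 e2].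
- by rewrite /tensor_mul !tensor_scale0l.
- elim/tensor_ind: s' => [|a' b'|s1 s2 e1 e2].
  + by rewrite tensor_scale0l /tensor_mul !tensor_scale0r tensor_scale0l.
  + elim/tensor_ind: t => [|v w|t1 t2 e1 e2].
    * by rewrite !tensor_scale0r.
    * by rewrite tensor_mulE !tensor_scaleE !scalerA.
    * by rewrite !tensor_scaleBr e1 e2.
  + rewrite tensor_scaleBl tensor_scaleBr e1 e2 /tensor_mul.
    by rewrite tensor_scaleBr tensor_scaleBl.
- by rewrite tensor_scaleBl e1 e2 /tensor_mul !tensor_scaleBl.
Qed.

Fact tensor_mulA : associative tensor_mul.
Proof. by move=> r s t; apply: (@tensor_scaleA A^o B^o). Qed.

Fact tensor_mul1l : left_id (tens 1 1) tensor_mul.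
Proof. by move=> t; apply: (@tensor_scale1 A B A^o B^o). Qed.

Fact tensor_mul1r : right_id (tens 1 1) tensor_mul.
Proof.
move=> t; elim/tensor_ind: t => [|a b|s t es et].
- exact: (@tensor_scale0l A B A^o B^o).
- by rewrite tensor_mulE !mulr1.
- by rewrite /tensor_mul tensor_scaleBl -!/(tensor_mul _ _) es et.
Qed.

Fact tensor_mulDl : left_distributive tensor_mul +%R.
Proof. by move=> r s t; apply: (@tensor_scaleDl A B A^o B^o). Qed.

Fact tensor_mulDr : right_distributive tensor_mul +%R.
Proof. by move=> r s t; apply: (@tensor_scaleDr A B A^o B^o). Qed.

HB.instance Definition _ := GRing.Zmodule_isPzRing.Build (tensor A B)
  tensor_mulA tensor_mul1l tensor_mul1r tensor_mulDl tensor_mulDr.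

HB.instance Definition _ (V : lmodType A) (W : lmodType B) :=
  GRing.Zmodule_isLmodule.Build (tensor A B) (tensor V W)
    (@tensor_scaleA V W) (@tensor_scale1 A B V W)
    (@tensor_scaleDr A B V W) (@tensor_scaleDl A B V W).

End TensorRing.

Definition simple_submodule (R : pzRingType) (V : lmodType R) (W : {pred V})
  : Prop :=
  [/\ submod_closed W, exists2 v, v \in W & v != 0 &
      forall W' : {pred V}, submod_closed W' -> {subset W' <= W} ->
        W' =i pred1 0 \/ W' =i W].

Definition simple_module (R : pzRingType) (V : lmodType R) : Prop :=
  simple_submodule (predT : {pred V}).

(* V is the internal direct sum of the family W of submodules. *)
Definition internal_direct_sum (R : pzRingType) (V : lmodType R)
    (I : eqType) (W : I -> {pred V}) : Prop :=
  (forall v : V, exists (s : seq I) (w : I -> V),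
     (forall i, w i \in W i) /\ v = \sum_(i <- s) w i) /\
  (forall (s : seq I) (w : I -> V), uniq s -> (forall i, w i \in W i) ->
     \sum_(i <- s) w i = 0 -> forall i, i \in s -> w i = 0).

Definition semisimple_module (R : pzRingType) (V : lmodType R) : Prop :=
  exists (I : eqType) (W : I -> {pred V}),
    (forall i, simple_submodule (W i)) /\ internal_direct_sum W.

Definition semisimple_ring (R : pzRingType) : Prop := semisimple_module R^o.

Definition has_characteristic (k : fieldType) (ell : nat) : Prop :=
  (ell \in [pchar k]) \/ (ell = 0%N /\ [pchar k] =i pred0).

Section FlagPath.
Variables (T : finType) (M : matroid T).

Definition adj (K L : {set T}) : bool := covers M K L || covers M L K.

Definition is_flag_path (p : {set T} * seq {set T}) : bool :=
  (p.1 \in flats M) && path adj p.1 p.2.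

(* The sequence (K_1,...,K_l) is stored as (K_1, [:: K_2; ...; K_l]). *)
Definition flag_path := {p : {set T} * seq {set T} | is_flag_path p}.

Definition fhead (p : flag_path) : {set T} := (val p).1.
Definition ftail (p : flag_path) : seq {set T} := (val p).2.
Definition flast (p : flag_path) : {set T} := last (fhead p) (ftail p).

Definition path_alg : Type := {malg int[flag_path]}.

HB.instance Definition _ := GRing.Zmodule.on path_alg.

End FlagPath.

HB.lock Definition path_basis (T : finType) (M : matroid T) (p : flag_path M)
  : path_alg M := << p >>.

Section PathProduct.
Variables (T : finType) (M : matroid T).
Local Notation path_alg := (path_alg M).
Local Notation flag_path := (flag_path M).
Local Notation is_flag_path := (is_flag_path M).

(* The basis element of the flag path (K, s), or 0 if (K, s) is not one. *)
Definition fpath (K : {set T}) (s : seq {set T}) : path_alg :=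
  if insub (K, s) is Some p then path_basis p else 0.

Lemma fpath_val (p : flag_path) : fpath (fhead p) (ftail p) = path_basis p.
Proof. by rewrite /fpath -surjective_pairing valK. Qed.

Definition path_concat (p q : flag_path) : path_alg :=
  if flast p == fhead q then fpath (fhead p) (ftail p ++ ftail q) else 0.

End PathProduct.

HB.lock Definition path_mul (T : finType) (M : matroid T) (x y : path_alg M)
  : path_alg M :=
  malg_lift (fun p => malg_lift (path_concat p) y) x.

Section PathAlgebra.
Variables (T : finType) (M : matroid T).
Local Notation path_alg := (path_alg M).
Local Notation flag_path := (flag_path M).
Local Notation is_flag_path := (is_flag_path M).
Local Notation fpath := (fpath M).
Local Notation path_mul := (@path_mul T M).

Definition path_one : path_alg := \sum_(F in flats M) fpath F [::].

Lemma path_mulBl x y z : path_mul (x - y) z = path_mul x z - path_mul y z.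
Proof. by rewrite path_mul.unlock malg_liftB. Qed.

Lemma path_alg_ind (P : path_alg -> Prop) :
    P 0 -> (forall p, P (path_basis p)) ->
    (forall x y, P x -> P y -> P (x - y)) ->
  forall x, P x.
Proof.
by move=> P0 PU; apply: malg_ind => // p; have := PU p; rewrite path_basis.unlock.
Qed.

Lemma path_mulUU p q : path_mul (path_basis p) (path_basis q) = path_concat p q.
Proof. by rewrite path_mul.unlock path_basis.unlock !malg_liftU. Qed.

Lemma path_mulBr x y z : path_mul x (y - z) = path_mul x y - path_mul x z.
Proof.
elim/path_alg_ind: x => [|p|x x' ex ex'].
- by rewrite path_mul.unlock !malg_lift0 subr0.
- by rewrite path_mul.unlock path_basis.unlock !malg_liftU malg_liftB.
- by rewrite !path_mulBl ex ex' !opprD !opprK addrACA.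
Qed.

Lemma path_mul0l x : path_mul 0 x = 0.
Proof. by rewrite path_mul.unlock malg_lift0. Qed.

Lemma path_mul0r x : path_mul x 0 = 0.
Proof. by have := path_mulBr x 0 0; rewrite !subrr. Qed.

Lemma path_concatP (p q : flag_path) : flast p = fhead q ->
  exists2 r : flag_path, path_mul (path_basis p) (path_basis q) = path_basis r &
    fhead r = fhead p /\ ftail r = ftail p ++ ftail q.
Proof.
move=> pq; have rP : is_flag_path (fhead p, ftail p ++ ftail q).
  have /andP[p1 p2] := valP p; have /andP[_ q2] := valP q.
  by rewrite /is_flag_path /= p1 cat_path p2 /= -/(flast p) pq.
exists (Sub (fhead p, ftail p ++ ftail q) rP); last by rewrite /fhead /ftail !SubK.
by rewrite path_mulUU /path_concat pq eqxx /fpath insubT.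
Qed.

Lemma path_concat0 (p q : flag_path) : flast p != fhead q ->
  path_mul (path_basis p) (path_basis q) = 0.
Proof. by rewrite path_mulUU /path_concat => /negbTE ->. Qed.

Lemma flag_path_inj (p q : flag_path) :
  fhead p = fhead q -> ftail p = ftail q -> p = q.
Proof.
move=> h t; apply: val_inj.
by rewrite [LHS]surjective_pairing [RHS]surjective_pairing -/(fhead p) h -/(ftail p) t.
Qed.

Fact path_mulA : associative path_mul.
Proof.
move=> x y z; elim/path_alg_ind: x => [|p|x x' ex ex'].
- by rewrite !path_mul0l.
- elim/path_alg_ind: y => [|q|y y' ey ey'].
  + by rewrite path_mul0l path_mul0r path_mul0l.
  + elim/path_alg_ind: z => [|r|z z' ez ez'].
    * by rewrite !path_mul0r.
    * have lcat (p' q' r' : flag_path) : flast p' = fhead q' ->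
          fhead r' = fhead p' /\ ftail r' = ftail p' ++ ftail q' ->
          flast r' = flast q'.
        by move=> pq [h t]; rewrite /flast h t last_cat -/(flast p') pq.
      have [qr|qr] := eqVneq (flast q) (fhead r); last first.
        rewrite (path_concat0 qr) path_mul0r.
        have [pq|pq] := eqVneq (flast p) (fhead q); last first.
          by rewrite (path_concat0 pq) path_mul0l.
        have [s -> sE] := path_concatP pq.
        by rewrite path_concat0 // (lcat _ _ _ pq sE).
      have [s sE [hs ts]] := path_concatP qr; rewrite sE.
      have [pq|pq] := eqVneq (flast p) (fhead q); last first.
        by rewrite (path_concat0 pq) path_mul0l path_concat0 // hs.
      have [s' s'E s'P] := path_concatP pq; rewrite s'E.
      have ps : flast p = fhead s by rewrite hs.
      have s'r : flast s' = fhead r by rewrite (lcat _ _ _ pq s'P).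
      have [t -> [ht tt]] := path_concatP ps.
      have [t' -> [ht' tt']] := path_concatP s'r.
      case: s'P => hs' ts'; congr (path_basis _); apply: flag_path_inj.
        by rewrite ht ht' hs'.
      by rewrite tt tt' ts ts' catA.
    * by rewrite !path_mulBr ez ez'.
  + by rewrite path_mulBl !path_mulBr ey ey' path_mulBl.
- by rewrite !path_mulBl ex ex'.
Qed.

Fact path_mulDl : left_distributive path_mul +%R.
Proof.
move=> x y z; rewrite -{1}[y]opprK path_mulBl -[- y]sub0r.
by rewrite path_mulBl path_mul0l sub0r opprK.
Qed.

Fact path_mulDr : right_distributive path_mul +%R.
Proof.
move=> x y z; rewrite -{1}[z]opprK path_mulBr -[- z]sub0r.
by rewrite path_mulBr path_mul0r sub0r opprK.
Qed.

Lemma fpath1P F : F \in flats M ->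
  exists2 p : flag_path, fpath F [::] = path_basis p & fhead p = F /\ ftail p = [::].
Proof.
move=> Ff; have pP : is_flag_path (F, [::]) by rewrite /is_flag_path /= Ff.
exists (Sub (F, [::]) pP); last by rewrite /fhead /ftail !SubK.
by rewrite /fpath insubT.
Qed.

Fact path_mul1l : left_id path_one path_mul.
Proof.
move=> x; elim/path_alg_ind: x => [|p|x x' ex ex']; first by rewrite path_mul0r.
- have pf : fhead p \in flats M by have /andP[] := valP p.
  rewrite /path_one (big_morph _ (fun y z => path_mulDl y z _) (path_mul0l _)).
  rewrite (bigD1 (fhead p)) //= big1.
    have [q -> [hq tq]] := fpath1P pf.
    rewrite addr0 path_mulUU /path_concat /flast hq tq eqxx /=.
    exact: fpath_val.
  move=> F /andP[Ff Fp]; have [q -> [hq tq]] := fpath1P Ff.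
  by rewrite path_mulUU /path_concat /flast hq tq /= (negbTE Fp).
- by rewrite path_mulBr ex ex'.
Qed.

Fact path_mul1r : right_id path_one path_mul.
Proof.
move=> x; elim/path_alg_ind: x => [|p|x x' ex ex']; first by rewrite path_mul0l.
- have pf : flast p \in flats M.
    have /andP[] := valP p; rewrite -/(fhead p) -/(ftail p) /flast.
    elim: (ftail p) (fhead p) => //= K s IHs L _ /andP[LK]; apply: IHs.
    by case/orP: LK => /and4P[].
  rewrite /path_one (big_morph _ (path_mulDr _) (path_mul0r _)).
  rewrite (bigD1 (flast p)) //= big1.
    have [q -> [hq tq]] := fpath1P pf.
    rewrite addr0 path_mulUU /path_concat hq tq eqxx cats0.
    exact: fpath_val.
  move=> F /andP[Ff Fp]; have [q -> [hq tq]] := fpath1P Ff.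
  by rewrite path_mulUU /path_concat hq eq_sym (negbTE Fp).
- by rewrite path_mulBl ex ex'.
Qed.

HB.instance Definition _ := GRing.Zmodule_isPzRing.Build path_alg
  path_mulA path_mul1l path_mul1r path_mulDl path_mulDr.

Definition cap_value (K K' L : {set T}) : path_alg :=
  if K == K' then fpath K [::] *+ #|L :\: K|
  else if covers M (K :&: K') K then - fpath K [:: K :&: K'; K']
  else 0.

Variant S_rel : path_alg -> Prop :=
| FS_up L K of L \in flats M & K \in flats M & L \proper K
    & rank M K = (rank M L).+2 :
    S_rel (\sum_(X in flats M | covers M L X && covers M X K) fpath L [:: X; K])
| FS_down L K of L \in flats M & K \in flats M & L \proper K
    & rank M K = (rank M L).+2 :
    S_rel (\sum_(X in flats M | covers M L X && covers M X K) fpath K [:: X; L])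
| cap_rel K K' L of covers M K L & covers M K' L :
    S_rel (fpath K [:: L; K'] - cap_value K K' L).

Definition S_alg : pzRingType := ring_quot S_rel.

(* The left ideal generated by (F), as a submodule of the regular module. *)
Definition S_ideal (F : {set T}) : {pred S_alg^o} :=
  fun x => `[< exists s : S_alg, x = s * rpi S_rel (fpath F [::]) >].

Fact S_ideal_submod_closed F : submod_closed (S_ideal F).
Proof.
split=> [|a x y /asboolP[s ->] /asboolP[t ->]]; apply/asboolP.
  by exists 0; rewrite mul0r.
by exists (a * s + t); rewrite mulrDl -mulrA.
Qed.

HB.instance Definition _ F :=
  GRing.isSubmodClosed.Build S_alg S_alg^o (S_ideal F)
    (GRing.submod_closed_semi (S_ideal_submod_closed F)).

Definition S_ideal_type (F : {set T}) := {x : S_alg^o | x \in S_ideal F}.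

HB.instance Definition _ F := Choice.on (S_ideal_type F).
HB.instance Definition _ F := SubType.on (S_ideal_type F).
HB.instance Definition _ F :=
  [SubChoice_isSubLmodule of S_ideal_type F by <:].

(* The Z-span of these images is automatically an S(M)-submodule. *)
Definition bad_path (F : {set T}) (x : S_ideal_type F) : Prop :=
  exists p : flag_path,
    [/\ flast p = F,
        exists2 K, K \in fhead p :: ftail p & ~~ (F \subset K) &
        val x = rpi S_rel (path_basis p)].

Fact bad_path_submod_closed F : submod_closed (zspan_pred (@bad_path F)).
Proof.
split=> [|a x y xN yN]; first exact: rpred0.
apply: rpredD => //; move/asboolP: xN => xN; apply/asboolP.
elim: xN => [|{}x [p [lp [K Kp FK] xE]]|u v _ uN _ vN].
- by rewrite scaler0; apply: zspan0.
- have [e ->] : exists e, a = rpi S_rel e by exists (rrepr a); rewrite rreprK.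
  elim/path_alg_ind: e => [|q|e e' He He'].
  + by rewrite raddf0 scale0r; apply: zspan0.
  + have xqE : val (rpi S_rel (path_basis q) *: x) = rpi S_rel (path_basis q * path_basis p).
      by rewrite rmorphM [in RHS]/= -xE GRing.valZ.
    have [qp|qp] := eqVneq (flast q) (fhead p).
      have [r rE [hr tr]] := path_concatP qp.
      apply: zspan_gen; exists r; split.
      * by rewrite /flast hr tr last_cat -/(flast q) qp.
      * exists K => //; rewrite hr tr -cat_cons mem_cat.
        move: Kp; rewrite in_cons => /orP[/eqP->|->]; last by rewrite orbT.
        by rewrite -qp /flast mem_last.
      * by rewrite xqE -rE.
    suff -> : rpi S_rel (path_basis q) *: x = 0 by apply: zspan0.
    apply: val_inj; rewrite xqE.
    have -> : path_basis q * path_basis p = 0 :> path_alg by apply: path_concat0.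
    by rewrite !raddf0.
  + by rewrite raddfB scalerBl; apply: zspanB.
- by rewrite scalerBr; apply: zspanB.
Qed.

HB.instance Definition _ F :=
  GRing.isSubmodClosed.Build S_alg (S_ideal_type F) (zspan_pred (@bad_path F))
    (GRing.submod_closed_semi (@bad_path_submod_closed F)).

Definition standard (F : {set T}) : lmodType S_alg :=
  lmod_quot (zspan_pred (@bad_path F)).

Definition S_algk (k : fieldType) : pzRingType := tensor S_alg k.

(* (s (x) a) (d (x) b) = sd (x) ab, by [tensor_scale]. *)
Definition standardk (F : {set T}) (k : fieldType) : lmodType (S_algk k) :=
  tensor (standard F) k^o.

End PathAlgebra.

(* Main.v *)
(* The relation (/\) moves the descending steps of a path to the left of the ascending
   ones, so Delta_F is spanned by the descending chains K > ... > F, and it is simple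
   if and only if, for every K, no nonzero combination of chains from K is killed by all
   ascending chains F < ... < K.

   If no connected minor has bad size: let A be a minimal nonempty separator of M^K_F,
   so that M^{A u F}_F is connected. The partial Casimir element, the sum of the
   (K > H < K) over the hyperplanes H of K with K \ H contained in A, acts on the chains
   from K as the scalar |A|. A vector killed by all the (H < K) is then killed by the
   unit |A|. The same argument on the right makes the Gram matrix of the pairing of
   ascending and descending chains nondegenerate on both sides, so its pseudoinverse
   yields, by induction on the rank n, a two-sided unit u of the ideal generated by the
   (F) with F of rank < n; for F of rank n, the vector (1 - u)(F) spans a simple left
   ideal or vanishes, and S_k(M) is the sum of these ideals and their right translates.

   Conversely, let E = K \ F with M^K_F connected and |E| = 0 in k. Represent Delta_F on
   the annihilator V of the Orlik-Solomon ideal inside an exterior algebra, a descending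
   step being a component of D = (sum of E) /\ _ and an ascending step a component of its
   adjoint U. Contraction with an element of E is a contracting homotopy for D; if
   Delta_F is simple, then the form on V is nondegenerate and U is exact as well. As
   UD + DU = |E| = 0, exactness of both makes the Poincare polynomial of V divisible by
   (1 + t)^2; but its derivative at -1 is, up to sign, Crapo's beta invariant of M^K_F,
   which is positive for a connected matroid of positive rank. *)
Require Import Defs.
From HB Require Import structures.
From mathcomp Require Import all_boot all_order all_algebra.
From mathcomp.multinomials Require Import monalg.
From mathcomp Require Import boolp zify ring.

Set Implicit Arguments.
Unset Strict Implicit.
Unset Printing Implicit Defensive.
Import Order.TTheory GRing.Theory Num.Theory.

(** * The lattice of flats and separators *)

(** The Casimir argument is run in S_k(M), in its quotient by the ideal of the flats of small rank,
    and in the opposite of that quotient, which supplies the right-hand half of every unit. Hence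
    the abstract [flag_alg], which records relations and generators but no basis. Without a basis,
    chains from [K] to [F] may be dependent and [(F)] itself may vanish in a quotient; this is why a
    pseudoinverse replaces the inverse of the Gram matrix, and why the exterior model is also needed
    when all sizes are good: its vector 1 shows that the generator of the standard module is
    nonzero. Simplicity gives nondegeneracy because ascending and descending steps are adjoint, so
    the radical of the form on V pulls back to a submodule of Delta_F. The Poincare polynomial of V
    is reached without a basis of V. Exactness of D on each interval [F, G] gives the signed
    dimensions of the components of V the recursion of the Moebius function of the interval; the
    alternating sums over subsets with a given closure obey the same recursion. Grouping subsets by
    closure then turns the alternating sum of ranks into the derivative at -1. *)

Section Lattice.
Variables (T : finType) (M : matroid T).
Implicit Types (A B C F G H K L X Y : {set T}) (x y : T).
Local Notation gr := (ground M).
Local Notation rho := (rank M).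

Lemma rank_set0 : rho set0 = 0.
Proof. by apply/eqP; rewrite -leqn0 -(cards0 T) rank_card ?sub0set. Qed.

Lemma rank_setU A B : A \subset gr -> B \subset gr -> rho (A :|: B) <= rho A + rho B.
Proof. by move=> Ag Bg; apply: leq_trans (rank_submod Ag Bg); apply: leq_addr. Qed.

Lemma rank_setU1 x A : x \in gr -> A \subset gr -> rho (x |: A) <= (rho A).+1.
Proof.
move=> xg Ag; apply: leq_trans (rank_setU _ Ag) _; first by rewrite sub1set.
by rewrite -add1n leq_add2r -(cards1 x) rank_card ?sub1set.
Qed.

Lemma flat_ground K : K \in flats M -> K \subset gr.
Proof. by rewrite inE => /andP[]. Qed.

Lemma flat_setU1 K x : K \in flats M -> x \in gr -> x \notin K -> rho K < rho (x |: K).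
Proof.
rewrite inE => /andP[_ /forall_inP KP] xg xK.
by apply: KP; rewrite inE xK.
Qed.

Lemma flat_ltn K L : K \in flats M -> L \subset gr -> K \proper L -> rho K < rho L.
Proof.
move=> Kf Lg /properP[KL [x xL xK]].
apply: leq_trans (flat_setU1 Kf (subsetP Lg x xL) xK) _.
by rewrite rank_mono // subUset sub1set xL.
Qed.

(** If [x] were outside [L], then [L] and [x |: A] would meet in [A], and submodularity would turn
    the rank increase of [L] by [x] into one of [A]. *)
Lemma flat_span_sub A L x : L \in flats M -> A \subset L -> x \in gr ->
  rho (x |: A) <= rho A -> x \in L.
Proof.
move=> Lf AL xg le; apply: contraLR le => xL; rewrite -ltnNge.
have Lg := flat_ground Lf; have Ag := subset_trans AL Lg.
have xAg : x |: A \subset gr by rewrite subUset sub1set xg.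
have := rank_submod Lg xAg.
have -> : L :|: (x |: A) = x |: L.
  by rewrite setUCA (setUidPl AL).
have -> : L :&: (x |: A) = A.
  by rewrite setIUr (setIidPr AL); apply/setUidPr; apply/subsetP => y;
     rewrite !inE => /andP[yL /eqP yx]; rewrite -yx yL in xL.
by have := flat_setU1 Lf xg xL; lia.
Qed.

(** Among the supersets of [A] of the same rank, one of largest cardinality is a flat. *)
Lemma closure_ex A : A \subset gr ->
  exists K, [/\ K \in flats M, A \subset K & rho K = rho A].
Proof.
move=> Ag; pose P K := [&& A \subset K, K \subset gr & rho K == rho A].
have PA : P A by rewrite /P subxx Ag eqxx.
case: (arg_maxnP (fun K => #|K|) PA) => K /and3P[AK Kg /eqP rK] maxK.
exists K; split=> //; rewrite inE Kg; apply/forall_inP => x.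
rewrite inE => /andP[xK xg]; rewrite ltn_neqAle rank_mono ?subsetUr ?subUset ?sub1set ?xg ?Kg // andbT.
apply/eqP => e; have := maxK (x |: K).
rewrite /P -e rK eqxx andbT subUset sub1set xg Kg /= (subset_trans AK (subsetUr _ _)).
by move/(_ isT); rewrite cardsU1 xK /=; lia.
Qed.

Definition clos A := [set x in gr | rho (x |: A) == rho A].

Lemma closE A K : K \in flats M -> A \subset K -> rho K = rho A -> clos A = K.
Proof.
move=> Kf AK rK; have Kg := flat_ground Kf; apply/setP => x; rewrite inE.
apply/andP/idP => [[xg /eqP e]|xK].
  by apply: (flat_span_sub Kf AK) => //; rewrite e.
have xg := subsetP Kg x xK; split=> //.
have xAK : x |: A \subset K by rewrite subUset sub1set xK.
rewrite eqn_leq -{1}rK rank_mono //= rank_mono ?subsetUr //.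
exact: subset_trans xAK Kg.
Qed.

Lemma closP A : A \subset gr ->
  [/\ clos A \in flats M, A \subset clos A & rho (clos A) = rho A].
Proof. by move=> /closure_ex[K [Kf AK rK]]; rewrite (closE Kf AK rK). Qed.

Lemma clos_flat A : A \subset gr -> clos A \in flats M.
Proof. by case/closP. Qed.
Lemma sub_clos A : A \subset gr -> A \subset clos A.
Proof. by case/closP. Qed.
Lemma rank_clos A : A \subset gr -> rho (clos A) = rho A.
Proof. by case/closP. Qed.

Lemma clos_sub A L : L \in flats M -> A \subset L -> clos A \subset L.
Proof.
move=> Lf AL; apply/subsetP => x; rewrite inE => /andP[xg /eqP e].
by apply: (flat_span_sub Lf AL) => //; rewrite e.
Qed.

Lemma flatI K L : K \in flats M -> L \in flats M -> K :&: L \in flats M.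
Proof.
move=> Kf Lf; have g : K :&: L \subset gr := subset_trans (subsetIl _ _) (flat_ground Kf).
suff <- : clos (K :&: L) = K :&: L by apply: clos_flat.
apply/eqP; rewrite eqEsubset sub_clos // andbT subsetI.
by rewrite !clos_sub ?subsetIl ?subsetIr.
Qed.

Lemma flat_sub_eq K L : K \in flats M -> L \in flats M -> K \subset L -> rho L <= rho K -> K = L.
Proof.
move=> Kf Lf KL le; apply/eqP; rewrite eqEproper KL /=; apply/negP => /(flat_ltn Kf (flat_ground Lf)).
by rewrite ltnNge le.
Qed.

(** For [x] in [L] outside [K], the closure of [x |: K] is a flat strictly above [K] inside [L]. As
    nothing lies in between, it is [L], and one element raises the rank by at most one. *)
Lemma coversP K L : reflect
  [/\ K \in flats M, L \in flats M, K \subset L & rho L = (rho K).+1] (covers M K L).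
Proof.
apply: (iffP and4P) => [[Kf Lf KL /forall_inP no]|[Kf Lf KL rL]].
  have Lg := flat_ground Lf; split=> //; first exact: proper_sub.
  have /properP[sKL [x xL xK]] := KL; have xg := subsetP Lg x xL.
  have xKg : x |: K \subset gr by rewrite subUset sub1set xg flat_ground.
  have xKL : clos (x |: K) \subset L by rewrite clos_sub // subUset sub1set xL.
  have Kc : K \proper clos (x |: K).
    apply: proper_sub_trans (sub_clos xKg); rewrite properEneq subsetUr andbT.
    by apply/eqP => e; rewrite e setU11 in xK.
  have := no _ (clos_flat xKg); rewrite Kc /= properE xKL negbK => Lc.
  have -> : L = clos (x |: K) by apply/eqP; rewrite eqEsubset Lc.
  rewrite rank_clos //; apply/eqP; rewrite eqn_leq rank_setU1 ?flat_ground //=.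
  exact: flat_setU1.
have Lg := flat_ground Lf; split=> //.
  by rewrite properEneq KL andbT; apply/eqP => e; rewrite e in rL; lia.
apply/forall_inP => X Xf; apply/negP => /andP[KX XL].
by have := flat_ltn Kf (flat_ground Xf) KX; have := flat_ltn Xf Lg XL; lia.
Qed.

Lemma covers_flatl K L : covers M K L -> K \in flats M. Proof. by case/coversP. Qed.
Lemma covers_flatr K L : covers M K L -> L \in flats M. Proof. by case/coversP. Qed.
Lemma covers_sub K L : covers M K L -> K \subset L. Proof. by case/coversP. Qed.
Lemma covers_rank K L : covers M K L -> rho L = (rho K).+1. Proof. by case/coversP. Qed.
Lemma covers_proper K L : covers M K L -> K \proper L. Proof. by case/and4P. Qed.

(** The relation (/\) tests only one side; [K] and [K'] have equal rank, so the other side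
    follows. *)
Lemma covers_cap K K' L : covers M K L -> covers M K' L ->
  covers M (K :&: K') K = covers M (K :&: K') K'.
Proof.
move=> c c'; have e : rho K = rho K'.
  by have := covers_rank c; rewrite (covers_rank c') => -[].
by apply/coversP/coversP => -[f1 f2 s]; rewrite ?e -?e => r; split;
  rewrite ?subsetIr ?subsetIl ?(covers_flatl c) ?(covers_flatl c').
Qed.

Lemma covers_capE K K' L Y : covers M K L -> covers M K' L -> K != K' ->
  covers M Y K -> Y \subset K' -> K :&: K' = Y.
Proof.
move=> c c' ne cY YK'; have Yf := covers_flatl cY; have Kf := covers_flatl c.
apply/esym/flat_sub_eq => //; first by rewrite flatI // (covers_flatl c').
  by rewrite subsetI (covers_sub cY).
rewrite -ltnS -(covers_rank cY); apply: flat_ltn; rewrite ?flatI ?(covers_flatl c') ?flat_ground //.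
rewrite properE subsetIl subsetI subxx /=; apply: contraNN ne => KK'.
apply/eqP; apply: flat_sub_eq => //; first exact: covers_flatl c'.
by have := covers_rank c; rewrite (covers_rank c') => -[->].
Qed.

Definition crank F A := rho (A :|: F) - rho F.

Lemma crankE F A : A \subset gr -> F \subset gr -> rho (A :|: F) = crank F A + rho F.
Proof. by move=> Ag Fg; rewrite subnK // rank_mono ?subsetUr // subUset Ag. Qed.

Lemma crank_submod F A B : F \subset gr -> A \subset gr -> B \subset gr ->
  crank F (A :|: B) + crank F (A :&: B) <= crank F A + crank F B.
Proof.
move=> Fg Ag Bg; have ABg : A :|: B \subset gr by rewrite subUset Ag.
have AIg : A :&: B \subset gr := subset_trans (subsetIl _ _) Ag.
have AFg : A :|: F \subset gr by rewrite subUset Ag.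
have BFg : B :|: F \subset gr by rewrite subUset Bg.
have := rank_submod AFg BFg; rewrite -setUUl -setUIl !crankE //; lia.
Qed.

Lemma crank_mono F A B : F \subset gr -> B \subset gr -> A \subset B -> crank F A <= crank F B.
Proof. by move=> Fg Bg AB; rewrite leq_sub2r // rank_mono ?setSU // subUset Bg. Qed.

Lemma crank0 F : crank F set0 = 0.
Proof. by rewrite /crank set0U subnn. Qed.

Lemma minor_rank F K A : F \subset K -> K \subset gr -> rank (minor M F K) A = crank F A.
Proof. by move=> FK Kg; rewrite /= /contract_rank /= (setIidPl Kg) (setIidPl FK). Qed.

Lemma minor_ground F K : K \subset gr -> ground (minor M F K) = K :\: F.
Proof. by move=> Kg; rewrite /= (setIidPl Kg). Qed.

End Lattice.

(** Submodularity for [X, A] and then for [X :|: A, E :\: A] bounds the right-hand side by [r X];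
    submodularity for the two pieces of [X] gives the converse. *)
Lemma separator_split (T : finType) (E A : {set T}) (r : {set T} -> nat) (X : {set T}) :
    (forall B C : {set T}, B \subset E -> C \subset E ->
       r (B :|: C) + r (B :&: C) <= r B + r C) -> r set0 = 0 ->
    A \subset E -> r A + r (E :\: A) = r E -> X \subset E ->
  r X = r (X :&: A) + r (X :\: A).
Proof.
move=> sm r0 AE rE XE; have DE : E :\: A \subset E := subsetDl _ _.
have h1 := sm X A XE AE.
have XAE : X :|: A \subset E by rewrite subUset XE.
have h2 := sm (X :|: A) (E :\: A) XAE DE.
have e1 : X :|: A :|: (E :\: A) = E.
  by rewrite -setUA -{1}(setIidPr AE) setID; apply/setUidPr.
have e2 : (X :|: A) :&: (E :\: A) = X :\: A.
  by apply/setP => y; rewrite !inE; have := subsetP XE y; case: (y \in X) => // [->|_] //;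
     case: (y \in A); rewrite ?andbF ?andbT.
rewrite e1 e2 in h2.
have h3 := sm _ _ (subset_trans (subsetIl X A) XE) (subset_trans (subsetDl X A) XE).
by rewrite setID in h3; lia.
Qed.

(** * Separators and connected minors *)

Section Separators.
Variables (T : finType) (M : matroid T).
Implicit Types (A B C F G H K L X Y : {set T}) (x y : T).

(** Without the strict inequality, [separator_split] would make [N] the direct sum of its
    restrictions to [A] and to the complement of [A]. *)
Lemma connected_sep (N : matroid T) A : matroid_connected N ->
  A \subset ground N -> A != set0 -> A != ground N ->
  rank N (ground N) < rank N A + rank N (ground N :\: A).
Proof.
move=> conN AE A0 AE'; rewrite ltnNge; apply/negP => le; apply: conN.
have E : rank N A + rank N (ground N :\: A) = rank N (ground N).
  apply/eqP; rewrite eqn_leq le /=.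
  have := rank_submod AE (subsetDl (ground N) A).
  by rewrite -{1}(setIidPr AE) setID; lia.
exists (restrict N A), (restrict N (ground N :\: A)); split=> /=.
- by rewrite (setIidPl AE).
- rewrite (setIidPl (subsetDl _ _)) setD_eq0; apply: contraNN AE' => EA.
  by rewrite eqEsubset AE.
split=> /=.
- rewrite (setIidPl AE) (setIidPl (subsetDl _ _)).
  by rewrite -setI_eq0; apply/eqP/setP => x; rewrite !inE; case: (x \in A); rewrite ?andbF.
- by rewrite -setIUl -{1}(setIidPr AE) setID setIid.
move=> X XE; rewrite (setIidPl AE) (setIidPl (subsetDl _ _)).
rewrite (separator_split (@rank_submod _ N) (rank_set0 N) AE E XE); congr (_ + rank N _).
by rewrite setIDA (setIidPl XE).
Qed.

Lemma connected_separator F K : F \in flats M -> K \in flats M -> F \proper K ->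
  exists A, [/\ A :|: F \in flats M, A != set0, A \subset K :\: F,
    matroid_connected (minor M F (A :|: F)) &
    forall H L, F \subset H -> L \subset K -> covers M H L ->
      L :\: H \subset A \/ [disjoint L :\: H & A]].
Proof.
move=> Ff Kf FK; have Fg := flat_ground Ff; have Kg := flat_ground Kf.
pose r := crank M F; pose E := K :\: F.
have Eg : E \subset ground M := subset_trans (subsetDl _ _) Kg.
have r0 : r set0 = 0 by apply: crank0.
have sm B C : B \subset E -> C \subset E -> r (B :|: C) + r (B :&: C) <= r B + r C.
  by move=> BE CE; apply: crank_submod => //; apply: subset_trans Eg.
pose P A := [&& A != set0, A \subset E & r A + r (E :\: A) == r E].
have PE : P E.
  by rewrite /P setDv r0 addn0 eqxx subxx !andbT setD_eq0 proper_subn.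
(* [E] itself is a candidate, so a nonempty separator of least cardinality exists. *)
case: (arg_minnP (fun A => #|A|) PE) => A /and3P[A0 AE /eqP rA] minA.
have split X : X \subset E -> r X = r (X :&: A) + r (X :\: A).
  exact: separator_split.
have Ag := subset_trans AE Eg.
have AFg : A :|: F \subset ground M by rewrite subUset Ag.
have AK : A :|: F \subset K.
  by rewrite subUset (proper_sub FK) (subset_trans AE) ?subsetDl.
have DF : (A :|: F) :\: F = A.
  rewrite setDUl setDv setU0; apply/setDidPl; rewrite -setI_eq0 -subset0.
  by have := setSI F AE; rewrite /E setIDAC setIC -setIDA setDv setI0.
have nl x : x \in E -> 0 < r [set x].
  rewrite inE => /andP[xF xK].
  by rewrite /r /crank subn_gt0; apply: flat_setU1; rewrite // (subsetP Kg).
(* An element of the closure outside [A :|: F] would have rank 0 after contraction, since ranks add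
   along the separator; but [F] is a flat. *)
have AFf : A :|: F \in flats M.
  suff <- : clos M (A :|: F) = A :|: F by apply: clos_flat.
  apply/eqP; rewrite eqEsubset sub_clos // andbT; apply/subsetP => x xc.
  apply: contraT => xAF.
  have xK : x \in K by apply: subsetP xc; apply: clos_sub.
  move: xAF; rewrite inE negb_or => /andP[xA xF].
  have xE : x \in E by rewrite inE xF.
  have xAE : x |: A \subset E by rewrite subUset sub1set xE.
  have := split _ xAE.
  have -> : (x |: A) :&: A = A by apply/setIidPr; apply: subsetUr.
  have -> : (x |: A) :\: A = [set x].
    by rewrite setDUl setDv setU0; apply/setDidPl; rewrite disjoints1.
  have -> : r (x |: A) = r A.
    by rewrite /r /crank -setUA; move: xc; rewrite inE => /andP[_ /eqP ->].
  by move: (nl _ xE); clear; lia.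
exists A; split=> //.
  (* A proper direct summand of the minor on [A] would be a smaller nonempty separator of [E]. *)
  case=> M1 [M2 [n1 n2 []]]; rewrite minor_ground // DF => dis AU rU.
  pose A1 := ground M1.
  have A1A : A1 \subset A by rewrite AU subsetUl.
  have A2A : ground M2 \subset A by rewrite AU subsetUr.
  have mr X : rank (minor M F (A :|: F)) X = r X.
    by apply: minor_rank; rewrite ?subsetUr.
  have I12 : ground M1 :&: ground M2 = set0 by apply/eqP; rewrite setI_eq0.
  have I21 : ground M2 :&: ground M1 = set0 by rewrite setIC.
  have z1 : rank M1 set0 = 0 := rank_set0 M1.
  have z2 : rank M2 set0 = 0 := rank_set0 M2.
  have e1 : r A1 = rank M1 A1 by rewrite -mr rU // setIid I12 z2 addn0.
  have e2 : r (ground M2) = rank M2 (ground M2) by rewrite -mr rU // setIid I21 z1.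
  have eA : r A = r A1 + r (ground M2).
    by rewrite -mr rU // (setIidPr A1A) (setIidPr A2A) e1 e2.
  have D1 : E :\: A1 = ground M2 :|: (E :\: A).
    apply/setP => x; rewrite AU !inE /A1.
    have := subsetP (subset_trans A2A AE) x; have /setP/(_ x) := I12; rewrite !inE.
    by do !case: (_ \in _) => //=; move=> // _ /(_ isT).
  have A1E := subset_trans A1A AE.
  have := minA A1; rewrite /P n1 A1E /=.
  have -> : r A1 + r (E :\: A1) == r E.
    rewrite eqn_leq; apply/andP; split.
      have := sm (ground M2) (E :\: A) (subset_trans A2A AE) (subsetDl _ _).
      by rewrite -D1; move: eA rA; clear; lia.
    have := sm A1 (E :\: A1) A1E (subsetDl _ _).
    by rewrite -{1}(setIidPr A1E) setID; clear; lia.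
  move=> /(_ isT); apply/negP; rewrite -ltnNge; apply: proper_card.
  rewrite properE A1A /=; apply/negP => AA1; case/negP: n2.
  by rewrite -subset0 -I12 subsetI subxx andbT (subset_trans A2A).
(* Suppose [L :\: H] has [x] in [A] and [y] outside. Both extend [H] to the rank of [L]: by [x] the
   whole increase happens inside [A], by [y] outside. Ranks add along [A], so there is no increase
   at all, against the cover. *)
move=> H L FH LK c; have /coversP[Hf Lf HL rL] := c.
have [sA|/subsetPn[y]] := boolP (L :\: H \subset A); first by left.
rewrite inE => /andP[yH yL] yA; right; rewrite -setI_eq0; apply: contraT => /set0Pn[x].
rewrite !inE => /andP[/andP[xH xL] xA].
have Lg := flat_ground Lf; have Hg := flat_ground Hf.
pose H' := H :\: F; pose L' := L :\: F.
have HU : H' :|: F = H by rewrite setUC -[RHS](setID H F) (setIidPr FH).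
have LU : L' :|: F = L by rewrite setUC -[RHS](setID L F) (setIidPr (subset_trans FH HL)).
have L'E : L' \subset E by apply: setSD.
have H'E : H' \subset E by apply: setSD (subset_trans HL LK).
have rH z : z \in L -> z \notin H -> r (z |: H') = r L'.
  move=> zL zH; rewrite /r /crank -setUA HU LU; congr (_ - _).
  have := flat_setU1 Hf (subsetP Lg z zL) zH.
  have : rank M (z |: H) <= rank M L by rewrite rank_mono // subUset sub1set zL.
  by move: rL; clear; lia.
have rlt : r H' < r L'.
  rewrite /r /crank HU LU ltn_sub2rE ?rL ?ltnSn // rank_mono //.
have FE z : z \notin H -> z \notin F by apply: contraNN => /(subsetP FH).
have xE : x \in E by rewrite inE FE // (subsetP LK).
have yE : y \in E by rewrite inE FE // (subsetP LK).
have xHE : x |: H' \subset E by rewrite subUset sub1set xE.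
have yHE : y |: H' \subset E by rewrite subUset sub1set yE.
have s1 := split _ xHE; have s2 := split _ yHE.
have s3 := split _ H'E; have s4 := split _ L'E.
rewrite rH // in s1; rewrite rH // in s2.
have d1 : (x |: H') :\: A = H' :\: A.
  by rewrite setDUl; apply/setUidPr; rewrite subDset sub1set inE xA.
have d2 : (y |: H') :&: A = H' :&: A.
  by rewrite setIUl; apply/setUidPr; apply/subsetP => z; rewrite !inE => /andP[/eqP->]; rewrite (negbTE yA).
rewrite d1 in s1; rewrite d2 in s2.
have yL' : y |: H' \subset L' by rewrite subUset sub1set inE FE // yL setSD.
have xL' : x |: H' \subset L' by rewrite subUset sub1set inE FE // xL setSD.
have L'g := subset_trans L'E Eg.
have m1 : r ((x |: H') :&: A) <= r (L' :&: A).
  by apply: crank_mono; rewrite ?setSI // (subset_trans (subsetIl _ _)).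
have m2 : r ((y |: H') :\: A) <= r (L' :\: A).
  by apply: crank_mono; rewrite ?setSD // (subset_trans (subsetDl _ _)).
by exfalso; move: s1 s2 s3 s4 m1 m2 rlt; clear; lia.
Qed.

End Separators.

(** * Crapo's beta invariant *)

Section Beta.
Local Open Scope ring_scope.
Variable T : finType.
Implicit Types (N : matroid T) (A B C D E X Y : {set T}) (x y e : T).

Definition alt_sum E (r : {set T} -> nat) : int := \sum_(A in powerset E) (-1) ^+ #|A| * (r A)%:R.

(** For a nonempty ground set this is, up to sign, the derivative at 1 of the characteristic
    polynomial, the sum of (-1)^|A| t^(r(E) - r(A)); the sign makes it nonnegative. *)
Definition beta N : int := (-1) ^+ rank N (ground N) * alt_sum (ground N) (rank N).

(** The rank form of connectedness, which is the convenient one for comparing deletion and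
    contraction. *)
Definition sepfree N := forall A, A \subset ground N -> A != set0 -> A != ground N ->
  (rank N (ground N) < rank N A + rank N (ground N :\: A))%N.

Lemma sum_powersetD1 E e (f : {set T} -> int) : e \in E ->
  \sum_(A in powerset E) f A
    = \sum_(A in powerset (E :\ e)) (f A + f (e |: A)).
Proof.
move=> eE; rewrite (bigID (fun A => e \in A)) /= addrC big_split /=; congr (_ + _).
  by apply: eq_bigl => A; rewrite !powersetE subsetD1.
rewrite (reindex_onto (fun A => e |: A) (fun A => A :\ e)) /=.
  apply: eq_bigl => A; rewrite !powersetE subUset sub1set eE setU11 andbT /= subsetD1.
  congr (_ && _); apply/eqP/idP => [<-|eA]; first by rewrite setD11.
  by rewrite setU1K.
by move=> A /andP[_ eA]; rewrite setD1K.
Qed.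

Lemma sum_powerset_sign E : E != set0 -> \sum_(A in powerset E) (-1) ^+ #|A| = 0 :> int.
Proof.
case/set0Pn => e eE; rewrite (sum_powersetD1 _ eE) big1 // => A.
rewrite powersetE subsetD1 => /andP[_ eA].
by rewrite cardsU1 eA exprS mulN1r subrr.
Qed.

Lemma alt_sumD1 E e (r : {set T} -> nat) : e \in E ->
  alt_sum E r = alt_sum (E :\ e) r - alt_sum (E :\ e) (fun A => r (e |: A)).
Proof.
move=> eE; rewrite /alt_sum (sum_powersetD1 _ eE) -sumrB; apply: eq_bigr => A.
rewrite powersetE subsetD1 => /andP[_ eA].
by rewrite cardsU1 eA exprS mulN1r mulNr.
Qed.

Lemma alt_sum_const E (r r' : {set T} -> nat) c : E != set0 ->
  (forall A, A \subset E -> r' A = r A + c)%N -> alt_sum E r' = alt_sum E r.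
Proof.
move=> E0 rr; transitivity (alt_sum E r + (\sum_(A in powerset E) (-1) ^+ #|A|) * c%:R).
  rewrite mulr_suml -big_split; apply: eq_bigr => A.
  by rewrite powersetE => /rr ->; rewrite natrD mulrDr.
by rewrite sum_powerset_sign // mul0r addr0.
Qed.

Lemma rank_one N x : x \in ground N -> (rank N [set x] <= 1)%N.
Proof. by move=> xg; rewrite -(cards1 x) rank_card ?sub1set. Qed.

Lemma rank_del N e A : rank (restrict N (ground N :\ e)) A = rank N A. Proof. by []. Qed.
Lemma ground_del N e : ground (restrict N (ground N :\ e)) = ground N :\ e.
Proof. by rewrite /= setIC; apply/setIidPr/subsetDl. Qed.
Lemma ground_con N e : ground (contract N [set e]) = ground N :\ e. Proof. by []. Qed.

Lemma rank_con N e A : e \in ground N -> A \subset ground N ->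
  (rank N (e |: A) = rank (contract N [set e]) A + rank N [set e])%N.
Proof.
move=> eg Ag; have eS : [set e] \subset ground N by rewrite sub1set.
rewrite /= /contract_rank (setIidPl eS) setUC subnK //.
by rewrite rank_mono ?subsetUr // subUset eS Ag.
Qed.

(** Pair each subset without [e] with the one obtained by adding [e]. If [e] is a loop or a coloop,
    the two ranks differ by a constant, and constants disappear from an alternating sum over a
    nonempty set. *)
Lemma beta_recursion N e : e \in ground N -> ground N :\ e != set0 ->
  (rank N [set e] = 1%N -> rank N (ground N :\ e) = rank N (ground N) ->
    beta N = beta (restrict N (ground N :\ e)) + beta (contract N [set e])) /\
  (rank N [set e] != 1%N \/ rank N (ground N :\ e) != rank N (ground N) -> beta N = 0).
Proof.
move=> eg E0; have sub A : A \subset ground N :\ e -> A \subset ground N.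
  by move/subset_trans; apply; apply: subsetDl.
have eS : [set e] \subset ground N by rewrite sub1set.
have conE A : A \subset ground N :\ e ->
    (rank N (e |: A) = rank (contract N [set e]) A + rank N [set e])%N.
  by move=> /sub; apply: rank_con.
split=> [re rE|].
  have rc : (rank (contract N [set e]) (ground N :\ e) + 1 = rank N (ground N))%N.
    by rewrite -re -conE // setD1K.
  rewrite /beta ground_del ground_con !rank_del (alt_sumD1 _ eg).
  rewrite (alt_sum_const E0 conE) rE -rc mulrBr; congr (_ + _).
  by rewrite addn1 exprS mulN1r mulNr opprK.
move=> h; rewrite /beta (alt_sumD1 _ eg); apply/eqP; rewrite mulf_eq0; apply/orP; right.
rewrite subr_eq0 eq_sym; apply/eqP; move: h; have le1 := rank_one eg.
case: (eqVneq (rank N [set e]) 1%N) => [re [//|ne]|ne _].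
  (* Here [e] is a coloop: it raises every rank by 1. *)
  apply: (@alt_sum_const _ _ _ 1) => // A AE; have Ag := sub _ AE.
  have := rank_submod (sub _ (subxx _)) (_ : e |: A \subset ground N).
  rewrite setUCA (setUidPl AE) setD1K //.
  have -> : (ground N :\ e) :&: (e |: A) = A.
    have eA : e \notin A by apply/negP => /(subsetP AE); rewrite !inE eqxx.
    apply/setP => y; rewrite !inE; case: (eqVneq y e) => [->|_] /=; first by rewrite (negbTE eA).
    by case yA: (y \in A); rewrite ?andbF ?andbT //; apply: (subsetP Ag).
  rewrite subUset eS Ag => /(_ isT).
  have := rank_setU1 eg Ag; have := rank_mono (subsetDl (ground N) [set e]) (subxx _).
  by move: ne; clear; lia.
(* Here [e] is a loop: it raises no rank. *)
apply: (@alt_sum_const _ _ _ 0) => // A AE; have Ag := sub _ AE.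
have := rank_setU eS Ag; have := @rank_mono _ N _ _ (subsetUr [set e] A).
rewrite subUset eS Ag => /(_ isT).
by move: ne le1; clear; lia.
Qed.

Lemma beta_small N e : ground N = [set e] -> beta N = (rank N [set e])%:R.
Proof.
move=> E; have eg : e \in ground N by rewrite E set11.
rewrite /beta (alt_sumD1 _ eg) E /alt_sum setDv powerset0 !big_set1 cards0 setU0 rank_set0.
rewrite mulr0 sub0r expr0 mul1r; have := rank_one eg.
by case: (rank N [set e]) => [|[|]] // _; rewrite ?mulr0 ?oppr0 ?expr1 ?mulN1r ?opprK.
Qed.

(** Needed for positivity: only one of deletion and contraction is known to stay connected, and the
    other must not subtract. *)
Lemma beta_ge0 N : 0 <= beta N.
Proof.
have [n] := ubnP #|ground N|; elim: n N => // n IHn N; rewrite ltnS => le.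
have [E0|[e eg]] := set_0Vmem (ground N).
  by rewrite /beta /alt_sum E0 powerset0 big_set1 rank_set0 !mulr0.
have [E0|E0] := eqVneq (ground N :\ e) set0.
  have E : ground N = [set e].
    by apply/eqP; rewrite eqEsubset sub1set eg -setD_eq0 E0 eqxx.
  by rewrite (beta_small E) ler0n.
have [h1 h2] := beta_recursion eg E0.
have lt : (#|ground N :\ e| < n)%N by move: le; rewrite (cardsD1 e) eg; clear; lia.
case: (eqVneq (rank N [set e]) 1%N) => [re|ne]; last by rewrite h2 //; left.
case: (eqVneq (rank N (ground N :\ e)) (rank N (ground N))) => [rE|ne]; last by rewrite h2 //; right.
by rewrite h1 // addr_ge0 ?IHn // ?ground_del.
Qed.

(* Let A | B separate the deletion and C | D the contraction of [e]. By submodularity, if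
   A n C and B n D are both nonempty, then one of them separates [N]; likewise for A n D
   and B n C. Otherwise one of A, B, C, D is empty. *)
Lemma sepfree_del_or_con N e : sepfree N -> e \in ground N ->
    rank N [set e] = 1%N -> rank N (ground N :\ e) = rank N (ground N) ->
  sepfree (restrict N (ground N :\ e)) \/ sepfree (contract N [set e]).
Proof.
move=> sf eg re rE; pose E := ground N :\ e.
pose bad (r : {set T} -> nat) A :=
  [&& A \subset E, A != set0, A != E & (r A + r (E :\: A) <= r E)%N].
have eS : [set e] \subset ground N by rewrite sub1set.
have Eg : E \subset ground N by apply: subsetDl.
have sfE N' : ground N' = E -> (forall A, ~~ bad (rank N') A) -> sepfree N'.
  move=> gE nb A; rewrite gE => AE A0 AE'; have := nb A.
  by rewrite /bad AE A0 AE' /= -ltnNge.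
have [/existsP[A bA]|] := boolP [exists A, bad (rank N) A]; last first.
  move/existsPn => nb; left; apply: sfE => //; exact: ground_del.
have [/existsP[C bC]|] := boolP [exists C, bad (rank (contract N [set e])) C]; last first.
  by move/existsPn => nb; right; apply: sfE.
exfalso; case/and4P: bA => AE A0 AE' rA; case/and4P: bC => CE C0 CE' rC.
have conE B : B \subset E -> (rank N (e |: B) = rank (contract N [set e]) B + 1)%N.
  by move=> BE; rewrite -re rank_con // (subset_trans BE).
have eE : e \notin E by rewrite !inE eqxx.
pose B := E :\: A; pose D := E :\: C.
have BE : B \subset E by apply: subsetDl.
have DE : D \subset E by apply: subsetDl.
have B0 : B != set0 by rewrite setD_eq0; apply: contraNN AE' => EA; rewrite eqEsubset AE.
have D0 : D != set0 by rewrite setD_eq0; apply: contraNN CE' => EC; rewrite eqEsubset CE.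
have rC' : (rank N (e |: C) + rank N (e |: D) <= rank N (ground N) + 1)%N.
  have rN : (rank N (ground N) = rank (contract N [set e]) E + 1)%N by rewrite -conE // setD1K.
  by rewrite !conE // rN; move: rC; rewrite -/D; move: (rank (contract _ _)) => r; clear; lia.
have rA' : (rank N A + rank N B <= rank N (ground N))%N by rewrite -rE.
have key X Y : X \subset E -> Y \subset E ->
    (rank N (X :&: Y) + rank N (e |: (X :|: Y)) <= rank N X + rank N (e |: Y))%N.
  move=> XE YE; have eX : e \notin X by apply: contraNN eE; apply: (subsetP XE).
  have Yg : e |: Y \subset ground N by rewrite subUset eS (subset_trans YE).
  have := rank_submod (subset_trans XE Eg) Yg.
  have -> : X :&: (e |: Y) = X :&: Y.
    rewrite setIUr; apply/setUidPr; apply/subsetP => z; rewrite !inE => /andP[zX /eqP ez].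
    by rewrite ez (negbTE eX) in zX.
  by rewrite setUCA addnC.
have cross X Y (X' Y' : {set T}) : X \subset E -> Y \subset E -> X' = E :\: X -> Y' = E :\: Y ->
    X :&: Y != set0 ->
    (rank N (ground N) < rank N (X :&: Y) + rank N (e |: (X' :|: Y')))%N.
  move=> XE YE -> -> XY0; have XYE : X :&: Y \subset E := subset_trans (subsetIl _ _) XE.
  have -> : e |: (E :\: X :|: E :\: Y) = ground N :\: (X :&: Y).
    rewrite -setDIr -(setD1K eg) -/E; apply/setP => z; rewrite !inE.
    by case: (eqVneq z e) => [->|//]; have := contraNN (subsetP XYE e) eE; rewrite inE => ->.
  apply: sf => //; first exact: subset_trans XYE Eg.
  by apply: contraNneq eE => e'; apply: (subsetP XYE); rewrite e'.
have DD (X : {set T}) : X \subset E -> E :\: (E :\: X) = X.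
  by move=> XE; rewrite setDDr setDv set0U (setIidPr XE).
have bothE X Y (X' Y' : {set T}) : X \subset E -> Y \subset E -> X' = E :\: X -> Y' = E :\: Y ->
    (rank N X + rank N X' <= rank N (ground N))%N ->
    (rank N (e |: Y) + rank N (e |: Y') <= rank N (ground N) + 1)%N ->
    X :&: Y = set0 \/ X' :&: Y' = set0.
  move=> XE YE eX' eY' rX rY.
  have [X'E Y'E] : X' \subset E /\ Y' \subset E by rewrite eX' eY' !subsetDl.
  have [->|n1] := eqVneq (X :&: Y) set0; first by left.
  have [->|n2] := eqVneq (X' :&: Y') set0; first by right.
  have eX : X = E :\: X' by rewrite eX' DD.
  have eY : Y = E :\: Y' by rewrite eY' DD.
  (* The two strict inequalities [cross] sum to at least 2r + 2, with r the rank of [N], while [key]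
     and the two separations bound the same sum by 2r + 1. *)
  exfalso; move: (cross _ _ _ _ XE YE eX' eY' n1) (cross _ _ _ _ X'E Y'E eX eY n2).
  move: (key _ _ XE YE) (key _ _ X'E Y'E) rX rY; clear; lia.
have cover (X Y Z : {set T}) : X \subset E -> Z = E :\: Y -> X :&: Y = set0 -> X :&: Z = set0 -> X = set0.
  by move=> XE -> h1 h2; rewrite -[X](setIidPl XE) -(setID (X :&: E) Y) -setIDA h2 setU0 (setIidPl XE).
have CD : C = E :\: D by rewrite DD.
have AB : A = E :\: B by rewrite DD.
have [h1|h1] := bothE A C B D AE CE erefl erefl rA' rC'.
  have rC'' : (rank N (e |: D) + rank N (e |: C) <= rank N (ground N) + 1)%N by rewrite addnC.
  have [h2|h2] := bothE A D B C AE DE erefl CD rA' rC''.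
    by case/eqP: A0; apply: (cover A C D).
  by case/eqP: C0; apply: (cover C A B) => //; rewrite setIC.
have rC'' : (rank N (e |: D) + rank N (e |: C) <= rank N (ground N) + 1)%N by rewrite addnC.
have [h2|h2] := bothE A D B C AE DE erefl CD rA' rC''.
  by case/eqP: D0; apply: (cover D A B) => //; rewrite setIC.
by case/eqP: B0; apply: (cover B C D).
Qed.

Lemma beta_gt0 N : sepfree N -> (0 < rank N (ground N))%N -> 0 < beta N.
Proof.
have [n] := ubnP #|ground N|; elim: n N => // n IHn N; rewrite ltnS => le sf r0.
have [E0|[e eg]] := set_0Vmem (ground N); first by rewrite E0 rank_set0 in r0.
have [E0|E0] := eqVneq (ground N :\ e) set0.
  have E : ground N = [set e].
    by apply/eqP; rewrite eqEsubset sub1set eg -setD_eq0 E0 eqxx.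
  by rewrite (beta_small E) -E ltr0n.
have lt : (#|ground N :\ e| < n)%N by move: le; rewrite (cardsD1 e) eg; clear; lia.
have [h1 _] := beta_recursion eg E0.
have sS : [set e] \subset ground N by rewrite sub1set.
have := sf _ sS.
have -> : [set e] != set0 by apply/set0Pn; exists e; rewrite set11.
have -> : [set e] != ground N.
  by apply: contraNneq E0 => <-; rewrite setDv.
(* As [[set e]] is not a separator, [e] is neither a loop nor a coloop. *)
move=> /(_ isT isT) lts; have re1 := rank_one eg.
have rE1 := rank_mono (subsetDl (ground N) [set e]) (subxx _).
have re : rank N [set e] = 1%N by move: lts re1 rE1; clear; lia.
have rE : rank N (ground N :\ e) = rank N (ground N) by move: lts re1 rE1; clear; lia.
rewrite h1 //.
(* In rank 1 the contraction has rank 0 and is of no use; but then there are no loops, and every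
   splitting of the deletion has rank sum at least 2. In higher rank either minor serves. *)
have [r1|r1] := leqP (rank N (ground N)) 1.
  rewrite ltr_pwDl ?beta_ge0 // IHn ?ground_del ?rank_del ?rE // => A.
  rewrite ground_del !rank_del rE => AE A0 AE'.
  have nl x : x \in ground N -> (0 < rank N [set x])%N.
    move=> xg; have xS : [set x] \subset ground N by rewrite sub1set.
    have xn : [set x] != ground N.
      apply: contraNneq E0 => xE; have /set1P -> : e \in [set x] by rewrite xE.
      by rewrite -xE setDv.
    have := sf _ xS; rewrite xn => /(_ _ isT).
    have -> : [set x] != set0 by apply/set0Pn; exists x; rewrite set11.
    move=> /(_ isT); have := rank_mono (subsetDl (ground N) [set x]) (subxx _).
    by clear; lia.
  have nl' B : B \subset ground N -> B != set0 -> (0 < rank N B)%N.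
    move=> Bg /set0Pn[x xB]; apply: leq_trans (nl x (subsetP Bg x xB)) _.
    by rewrite rank_mono // sub1set.
  have Eg := subsetDl (ground N) [set e].
  have h3 := nl' A (subset_trans AE Eg) A0.
  have h4 := nl' (ground N :\ e :\: A) (subset_trans (subsetDl _ _) Eg).
  move: h4; rewrite setD_eq0; have -> : ~~ (ground N :\ e \subset A).
    by apply: contraNN AE' => h; rewrite eqEsubset AE.
  by move=> /(_ isT); move: h3 r1; clear; lia.
case: (sepfree_del_or_con sf eg re rE) => sf'.
  by rewrite ltr_pwDl ?beta_ge0 // IHn ?ground_del ?rank_del ?rE.
rewrite ltr_wpDl ?beta_ge0 // IHn //.
have := rank_con eg (subsetDl (ground N) [set e]); rewrite setD1K // re ground_con.
by move: r1; clear; lia.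
Qed.

End Beta.

(** * Highest weight vectors and the Casimir element *)

Local Open Scope ring_scope.

(* A [k]-algebra generated by the images [fe K] of the paths [(K)] and [fg K L] of
   the paths [(K, L)], subject to the defining relations of S(M). *)
Record flag_alg (T : finType) (M : matroid T) (k : fieldType) (R : pzRingType) := FlagAlg {
  fe : {set T} -> R;
  fg : {set T} -> {set T} -> R;
  fk : k -> R;
  fkB : forall a b, fk (a - b) = fk a - fk b;
  fkM : forall a b, fk (a * b) = fk a * fk b;
  fk1 : fk 1 = 1;
  fkC : forall a x, fk a * x = x * fk a;
  fee : forall K L, fe K * fe L = if K == L then fe K else 0;
  feg : forall K L, fe K * fg K L = fg K L;
  fge : forall K L, fg K L * fe L = fg K L;
  fg0 : forall K L, ~~ adj M K L -> fg K L = 0;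
  fsu : forall L K, L \in flats M -> K \in flats M -> L \proper K -> rank M K = (rank M L).+2 ->
    \sum_(X in flats M | covers M L X && covers M X K) fg L X * fg X K = 0;
  fsd : forall L K, L \in flats M -> K \in flats M -> L \proper K -> rank M K = (rank M L).+2 ->
    \sum_(X in flats M | covers M L X && covers M X K) fg K X * fg X L = 0;
  fcap : forall K K' L, covers M K L -> covers M K' L ->
    fg K L * fg L K' = if K == K' then fe K *+ #|L :\: K|
      else if covers M (K :&: K') K then - (fg K (K :&: K') * fg (K :&: K') K') else 0;
  fone : 1 = \sum_(K in flats M) fe K;
  fgen : forall P : R -> Prop, P 0 -> (forall x y, P x -> P y -> P (x - y)) ->
    (forall x y, P x -> P y -> P (x * y)) -> (forall a, P (fk a)) ->
    (forall K, P (fe K)) -> (forall K L, P (fg K L)) -> forall x, P x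
}.

Section HighestWeight.
Variables (T : finType) (M : matroid T) (k : fieldType) (R : pzRingType).
Variable S : flag_alg M k R.
Implicit Types (A F G H K L X Y : {set T}) (t : seq {set T}).
Local Notation e := (fe S).
Local Notation g := (fg S).
Local Notation kap := (fk S).

Lemma fk0 : kap 0 = 0.
Proof. by have := fkB S 0 0; rewrite !subrr. Qed.

Lemma fkN a : kap (- a) = - kap a.
Proof. by rewrite -sub0r fkB fk0 sub0r. Qed.

Lemma fkD a b : kap (a + b) = kap a + kap b.
Proof. by rewrite -[b]opprK fkB fkN !opprK. Qed.

Lemma fk_nat n : kap n%:R = n%:R.
Proof. by elim: n => [|n IHn]; rewrite ?fk0 // !mulrS fkD fk1 IHn. Qed.

Lemma fkV a : a != 0 -> kap a^-1 * kap a = 1.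
Proof. by move=> a0; rewrite -fkM mulVf ?fk1. Qed.

(** The elements that preserve [U] contain the generators and are closed under differences and
    products, so [fgen] applies. *)
Lemma flag_alg_stable (V : lmodType R) (U : V -> Prop) :
    U 0 -> (forall x y, U x -> U y -> U (x - y)) ->
    (forall a v, U v -> U (kap a *: v)) -> (forall K v, U v -> U (e K *: v)) ->
    (forall K L v, U v -> U (g K L *: v)) ->
  forall a v, U v -> U (a *: v).
Proof.
move=> U0 UB Uk Ue Ug a; pose P a := forall v, U v -> U (a *: v); change (P a).
apply: (@fgen _ _ _ _ S P) => [v _|x y Ux Uy v Uv|x y Ux Uy v Uv|{}a v|K v|K L v].
- by rewrite scale0r.
- by rewrite scalerBl; apply: UB; [apply: Ux|apply: Uy].
- by rewrite -scalerA; apply/Ux/Uy.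
- exact: Uk.
- exact: Ue.
- exact: Ug.
Qed.

(** In both products [t] lists the chain downwards from [K], with [K] left out, so that one list
    indexes a path and its reverse and passing to the opposite ring swaps the two. *)
Fixpoint dn K t : R := if t is H :: t' then g K H * dn H t' else e K.
Fixpoint up K t : R := if t is H :: t' then up H t' * g H K else e K.

Definition dchain F K t := path (fun K H => covers M H K) K t && (last K t == F).

Lemma dchain_cons F K H t : dchain F K (H :: t) = covers M H K && dchain F H t.
Proof. by rewrite /dchain /= andbA. Qed.

Lemma dchain_sub F K t : dchain F K t -> F \subset K.
Proof.
elim: t K => [|H t IHt] K; first by rewrite /dchain /= => /eqP->.
by rewrite dchain_cons => /andP[/covers_sub HK /IHt FH]; apply: subset_trans HK.
Qed.

Lemma dchain_rank F K t : dchain F K t -> rank M K = (rank M F + size t)%N.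
Proof.
elim: t K => [|H t IHt] K; first by rewrite /dchain /= addn0 => /eqP->.
by rewrite dchain_cons => /andP[/covers_rank -> /IHt ->]; rewrite addnS.
Qed.

Lemma e_dn K t : e K * dn K t = dn K t.
Proof. by case: t => [|H t] /=; rewrite ?fee ?eqxx // mulrA feg. Qed.

Lemma dn_e F K t : dchain F K t -> dn K t * e F = dn K t.
Proof.
elim: t K => [|H t IHt] K; first by rewrite /dchain /= => /eqP->; rewrite fee eqxx.
by rewrite dchain_cons => /andP[_ /IHt E]; rewrite /= -mulrA E.
Qed.

Lemma up_e K t : up K t * e K = up K t.
Proof. by case: t => [|H t] /=; rewrite ?fee ?eqxx // -mulrA fge. Qed.

Lemma e_up F K t : dchain F K t -> e F * up K t = up K t.
Proof.
elim: t K => [|H t IHt] K; first by rewrite /dchain /= => /eqP->; rewrite fee eqxx.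
by rewrite dchain_cons => /andP[_ /IHt E]; rewrite /= mulrA E.
Qed.

Lemma fs_downE Y K' K : covers M Y K' -> covers M K' K ->
  \sum_(H | (H != K') && (covers M Y H && covers M H K)) g K H * g H Y = - (g K K' * g K' Y).
Proof.
move=> cY cK; have := fsd S (covers_flatl cY) (covers_flatr cK).
rewrite (covers_rank cK) (covers_rank cY) (proper_trans (covers_proper cY) (covers_proper cK)).
move=> /(_ isT erefl); rewrite (bigD1 K') /=; last by rewrite cY cK (covers_flatl cK).
rewrite addrC => /eqP; rewrite addr_eq0 => /eqP <-; apply: eq_bigl => X.
rewrite andbC; case c: (covers M Y X) => /=; rewrite ?andbF //.
by rewrite (covers_flatr c).
Qed.

Section Module.
Variables (V : lmodType R) (F : {set T}).

(** A path acts from its last flat to its first, so [g G F] maps the component at [F] to the one at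
    [G]. This is the analogue of a highest weight vector; the generator of the standard module is
    the model case. *)
Definition singular (w : V) := e F *: w = w /\ forall G, covers M G F -> g G F *: w = 0.

Lemma fk_scale_eq0 a (v : V) : a != 0 -> kap a *: v = 0 -> v = 0.
Proof. by move=> a0 e0; rewrite -[v]scale1r -(fkV a0) -scalerA e0 scaler0. Qed.

Lemma natr_scale_eq0 n (v : V) : (n%:R : k) != 0 -> v *+ n = 0 -> v = 0.
Proof. by move=> n0 vn; apply: (fk_scale_eq0 n0); rewrite fk_nat scaler_nat. Qed.

Variable B : V -> Prop.
Hypotheses (Bsing : forall w, B w -> singular w) (B0 : B 0)
  (BB : forall w w', B w -> B w' -> B (w - w')).

Inductive hw K : V -> Prop :=
| hw_gen t w : dchain F K t -> B w -> hw K (dn K t *: w)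
| hw0 : hw K 0
| hwB v v' : hw K v -> hw K v' -> hw K (v - v').

Lemma hwN K v : hw K v -> hw K (- v).
Proof. by move=> h; rewrite -sub0r; apply: hwB => //; apply: hw0. Qed.

Lemma hwD K v v' : hw K v -> hw K v' -> hw K (v + v').
Proof. by move=> h /hwN h'; rewrite -[v']opprK; apply: hwB. Qed.

Lemma hwMn K v n : hw K v -> hw K (v *+ n).
Proof. by move=> h; elim: n => [|n IHn]; [apply: hw0|rewrite mulrS; apply: hwD]. Qed.

Lemma hw_e K v : hw K v -> e K *: v = v.
Proof.
elim=> [t w _ _||{}v v' _ E _ E']; rewrite ?scaler0 ?scalerBr ?E ?E' //.
by rewrite scalerA e_dn.
Qed.

Lemma hw_dn K L v : hw K v -> covers M K L -> hw L (g L K *: v).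
Proof.
move=> h c; elim: h => [t w d b||{}v v' _ E _ E']; rewrite ?scaler0 ?scalerBr.
- by rewrite scalerA; apply: (@hw_gen L (K :: t)) => //; rewrite dchain_cons c.
- exact: hw0.
- exact: hwB.
Qed.

Lemma hw_base v : hw F v -> B v.
Proof.
elim=> [t w d b||{}v v' _ E _ E'] //; last exact: BB.
have := dchain_rank d; case: t d => [|H t] d /=; last by rewrite addnS; lia.
by have [-> _] := Bsing b.
Qed.

(** The relation (/\) turns [g K L * g L K'] into a scalar, into minus the detour through
    [K :&: K'], or into 0; induction pushes the ascending step down the chain, and at [F]
    singularity kills it. The two claims are proved together because [K'] contains [F], so
    [K :&: K'] contains [F] exactly when [K] does. *)
Lemma hw_up K L v : hw L v -> covers M K L ->
  (F \subset K -> hw K (g K L *: v)) /\ (~~ (F \subset K) -> g K L *: v = 0).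
Proof.
move=> h; elim: h K => [t w d b||{}v v' _ IH _ IH'] K c; first last.
- have [h1 h2] := IH _ c; have [h1' h2'] := IH' _ c; rewrite scalerBr; split=> [FK|nFK].
    by apply: hwB; [apply: h1|apply: h1'].
  by rewrite h2 // h2' // subrr.
- by rewrite scaler0; split=> // _; apply: hw0.
elim: t L d K c => [|K' t IHt] L; rewrite ?dchain_cons => d K c.
  move: d c; rewrite /dchain /= => /eqP-> c; split=> [FK|_].
    by have := flat_ltn (covers_flatl c) (flat_ground (covers_flatr c)) (covers_proper c);
       rewrite ltnNge rank_mono // flat_ground // (covers_flatl c).
  by have [-> s] := Bsing b; apply: s.
case/andP: d => c' d /=; have h' := hw_gen d b.
rewrite scalerA mulrA (fcap S c c') -scalerA.
case: eqP => [EK|/eqP nK].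
  rewrite -EK in c' d h' *; split; last by rewrite (dchain_sub d).
  rewrite -scalerMnl scalerA e_dn => _; exact: hwMn.
case: ifP => [cY|_]; last by rewrite scale0r; split=> // _; apply: hw0.
have cY' := cY; rewrite (covers_cap c c') in cY'.
have [h1 h2] := IHt _ d _ cY'.
rewrite scaleNr -scalerA; split=> [FK|nFK].
  apply/hwN/hw_dn => //; apply: h1.
  by rewrite subsetI FK (dchain_sub d).
by rewrite h2 ?scaler0 ?oppr0 // subsetI negb_and nFK.
Qed.

(* (/\) followed by (FS) commutes the Casimir element of [K] past [g K K'], turning it
   into the one of [K'] plus the scalar [#|(K :\: K') :&: A|]. *)
Lemma casimir A K0 K v :
    (forall H L, F \subset H -> L \subset K0 -> covers M H L ->
      L :\: H \subset A \/ [disjoint L :\: H & A]) ->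
    K \subset K0 -> hw K v ->
  \sum_(H : {set T} | [&& F \subset H, covers M H K & K :\: H \subset A]) g K H *: (g H K *: v)
    = v *+ #|(K :\: F) :&: A|.
Proof.
move=> sep KK0 h; elim: h => [t w d b||{}v v' _ IH _ IH']; first last.
- by rewrite mulrnBl -IH -IH' -sumrB; apply: eq_bigr => H _; rewrite !scalerBr.
- by rewrite mul0rn big1 // => H _; rewrite !scaler0.
elim: t K KK0 d => [|K' t IHt] K KK0; rewrite ?dchain_cons.
  rewrite /dchain /= => /eqP ->; rewrite setDv set0I cards0 mulr0n big1 // => H /and3P[_ c _].
  by have [-> s] := Bsing b; rewrite s ?scaler0.
case/andP=> c' d; have FK' := dchain_sub d; have h' := hw_gen d b.
have K'K0 := subset_trans (covers_sub c') KK0.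
pose v' := dn K' t *: w; have -> : dn K (K' :: t) *: w = g K K' *: v' by rewrite /= scalerA.
have {}IHt := IHt _ K'K0 d; rewrite -/v' in h' IHt *.
have -> : #|(K :\: F) :&: A| = (#|(K :\: K') :&: A| + #|(K' :\: F) :&: A|)%N.
  rewrite -(cardsID K' ((K :\: F) :&: A)) addnC; congr (_ + _)%N; apply: eq_card => x; rewrite !inE.
    have := subsetP FK' x; case: (x \in F) => [/(_ isT)->|_] //=.
    by case: (x \in A); case: (x \in K'); rewrite ?andbF ?andbT.
  have := subsetP (covers_sub c') x.
  by case: (x \in K') => [/(_ isT)->|_]; rewrite ?andbF ?andbT.
(* The term [H = K'] yields the new scalar; the remaining terms must reproduce the Casimir sum of
   [K']. *)
rewrite mulrnDr (bigID (pred1 K')) /=; congr (_ + _).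
  have [sA|dA] := sep _ _ FK' KK0 c'.
    rewrite (big_pred1 K') => [|H].
      rewrite 2!scalerA -mulrA (fcap S c' c') eqxx mulrnAr fge.
      by rewrite -scalerMnl (setIidPl sA).
    by rewrite /=; case: eqP => [->|_]; rewrite ?andbF // FK' c' sA.
  rewrite (disjoint_setI0 dA) cards0 mulr0n big1 // => H /andP[/and3P[_ cH sA] /eqP E].
  have := covers_proper cH; rewrite properE => /andP[_ /subsetPn[x xK xH]].
  have xD : x \in K :\: H by rewrite inE xH.
  by have := disjointFr dA; rewrite -E => /(_ x xD); rewrite (subsetP sA).
transitivity (g K K' *: (v' *+ #|(K' :\: F) :&: A|)); last by rewrite -scalerMnr.
rewrite -IHt scaler_sumr.
pose Q H := [&& F \subset H, covers M H K & K :\: H \subset A] && (H != K').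
have s1 : \sum_(H | Q H) g K H *: (g H K *: (g K K' *: v'))
    = \sum_(H | Q H && covers M (H :&: K') H)
        - ((g K H * g H (H :&: K')) *: (g (H :&: K') K' *: v')).
  rewrite [RHS]big_mkcondr /=; apply: eq_bigr => H /andP[/and3P[FH cH _] /negbTE nH].
  rewrite [g H K *: _]scalerA (fcap S cH c') nH; case: ifP => _; last by rewrite scale0r scaler0.
  by rewrite scaleNr scalerN -!scalerA.
rewrite [LHS]s1 (partition_big (fun H => H :&: K')
   (fun Y => [&& F \subset Y, covers M Y K' & K' :\: Y \subset A])) /=; last first.
  move=> H /andP[/andP[/and3P[FH cH sA] nH] cY]; rewrite subsetI FH FK' /=.
  rewrite -(covers_cap cH c') cY /= setDIr setDv setU0.
  exact: subset_trans (setSD _ (covers_sub c')) sA.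
apply: eq_bigr => Y /and3P[FY cY sA].
transitivity (\sum_(H | (H != K') && (covers M Y H && covers M H K))
    - ((g K H * g H Y) *: (g Y K' *: v'))); last first.
  by rewrite sumrN -scaler_suml fs_downE // scaleNr opprK -scalerA.
apply: congr_big => // [H|H /andP[_ /eqP ->] //].
apply/idP/idP.
  by case/andP=> /andP[/andP[/and3P[_ -> _] ->] cH] /eqP <-; rewrite cH.
case/and3P=> nH cYH cHK.
have E : H :&: K' = Y by apply: (covers_capE cHK c' nH cYH (covers_sub cY)).
rewrite E eqxx cYH andbT /Q nH cHK /= (subset_trans FY (covers_sub cYH)) /= !andbT.
(* [K :\: H] contains the nonempty set [K' :\: Y], which lies in [A], so the dichotomy puts all of
   [K :\: H] in [A]. Thus the fibre over [Y] consists of all [H] other than [K'] between [Y] and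
   [K], as (FS) requires. *)
have [//|dA] := sep _ _ (subset_trans FY (covers_sub cYH)) KK0 cHK.
have := covers_proper cY; rewrite properE => /andP[_ /subsetPn[x xK' xY]].
have xA : x \in A by apply: (subsetP sA); rewrite inE xY.
have xD : x \in K :\: H.
  rewrite inE (subsetP (covers_sub c')) // andbT.
  by apply: contraNN xY => xH; rewrite -E inE xH.
by have := disjointFr dA xD; rewrite xA.
Qed.

Hypothesis Ff : F \in flats M.
Hypothesis good : forall K, K \in flats M -> F \proper K ->
  matroid_connected (minor M F K) -> (#|K :\: F|%:R : k) != 0.

Lemma hw_nondeg K v : K \in flats M -> F \proper K -> hw K v ->
  (forall H, covers M H K -> F \subset H -> g H K *: v = 0) -> v = 0.
Proof.
move=> Kf FK h z; have [A [AFf A0 AK con sep]] := connected_separator Ff Kf FK.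
have DF : (A :|: F) :\: F = A.
  rewrite setDUl setDv setU0; apply/setDidPl; rewrite -setI_eq0 -subset0.
  by have := setSI F AK; rewrite setIDAC setIC -setIDA setDv setI0.
have := casimir sep (subxx K) h; rewrite (setIidPr AK) big1 => [|H /and3P[FH c _]]; last first.
  by rewrite z ?scaler0.
move/esym; apply: natr_scale_eq0; have := good AFf; rewrite DF; apply=> //.
by rewrite properE subsetUr /= -setD_eq0 DF.
Qed.

(** Iterates [hw_nondeg]: as long as [K] is above [F], some ascending step keeps the vector nonzero
    and lowers the rank; at [F] only vectors of [B] remain. *)
Lemma hw_detect K v : K \in flats M -> F \subset K -> hw K v -> v != 0 ->
  exists2 t, dchain F K t & up K t *: v != 0 /\ B (up K t *: v).
Proof.
have [n] := ubnP (rank M K); elim: n K v => // n IHn K v; rewrite ltnS => le Kf FK h v0.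
have [E|nE] := eqVneq F K.
  rewrite -E in h v0 *; exists [::] => /=; first by rewrite /dchain /= eqxx.
  by rewrite hw_e //; split=> //; apply: hw_base.
have FpK : F \proper K by rewrite properEneq nE.
have [/existsP[H /and3P[c FH n0]]|] :=
  boolP [exists H, [&& covers M H K, F \subset H & g H K *: v != 0]]; last first.
  move/existsPn => z; case/eqP: v0; apply: (hw_nondeg Kf FpK h) => H c FH.
  by apply/eqP; have := z H; rewrite c FH /= negbK.
have lt : (rank M H < n)%N by rewrite -(covers_rank c).
have [t d [u0 Bu]] := IHn H _ lt (covers_flatl c) FH ((hw_up h c).1 FH) n0.
by exists (H :: t); rewrite ?dchain_cons ?c //= -scalerA.
Qed.

Hypothesis Bk : forall a w, B w -> B (kap a *: w).

Inductive hwT : V -> Prop :=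
| hwT_gen K v : hw K v -> hwT v
| hwTB v v' : hwT v -> hwT v' -> hwT (v - v').

Lemma hwT0 : hwT 0.
Proof. by apply: (@hwT_gen F); apply: hw0. Qed.

Lemma hw_fe K L v : hw K v -> hw L (e L *: v).
Proof.
move=> h; rewrite -(hw_e h) scalerA fee; case: eqP => [->|_]; first by rewrite hw_e.
by rewrite scale0r; apply: hw0.
Qed.

(** The sum of the spans of chains is a submodule: [hw_dn] and [hw_up] treat matching steps between
    adjacent flats, and the other steps act by 0. *)
Lemma hwT_stable a v : hwT v -> hwT (a *: v).
Proof.
apply: flag_alg_stable => [|x y||K {}v|K L {}v]; first exact: hwT0.
- exact: hwTB.
- move=> c x; elim=> [K {}v h|x1 x2 _ h1 _ h2]; last by rewrite scalerBr; apply: hwTB.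
  apply: (@hwT_gen K); elim: h => [t w d b||x1 x2 _ h1 _ h2].
  + by rewrite scalerA fkC -scalerA; apply: hw_gen => //; apply: Bk.
  + by rewrite scaler0; apply: hw0.
  + by rewrite scalerBr; apply: hwB.
- elim=> [L {}v h|x1 x2 _ h1 _ h2]; last by rewrite scalerBr; apply: hwTB.
  by apply: (@hwT_gen K); apply: hw_fe h.
- elim=> [H {}v h|x1 x2 _ h1 _ h2]; last by rewrite scalerBr; apply: hwTB.
  have [E|nE] := eqVneq L H; last first.
    by rewrite -(hw_e h) -(fge S) !scalerA -mulrA fee (negbTE nE) mulr0 scale0r; apply: hwT0.
  rewrite {}E; have [|/(fg0 S)->] := boolP (adj M K H); last by rewrite scale0r; apply: hwT0.
  case/orP=> c; last by apply: hwT_gen (hw_dn h c).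
  have [h1 h2] := hw_up h c.
  have [FK|/h2 ->] := boolP (F \subset K); last exact: hwT0.
  exact: hwT_gen (h1 FK).
Qed.

Lemma hwT_fe K v : hwT v -> hw K (e K *: v).
Proof.
elim=> [L {}v h|x1 x2 _ h1 _ h2]; last by rewrite scalerBr; apply: hwB.
exact: hw_fe h.
Qed.

Lemma hwT_base w : B w -> hwT w.
Proof.
move=> b; apply: (@hwT_gen F); have [<- _] := Bsing b.
by apply: (@hw_gen F [::]) => //; rewrite /dchain /= eqxx.
Qed.

(** The triangular decomposition in the form used below: at [K], any multiple of a vector of [B] is
    a combination of descending chains. *)
Lemma hw_cyclic K a w : B w -> hw K (e K *: (a *: w)).
Proof. by move=> /hwT_base b; apply/hwT_fe/hwT_stable. Qed.

Lemma hw_sub K v : hw K v -> v != 0 -> F \subset K.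
Proof.
move=> h; apply: contraR => nFK; elim: h => [t w d||v1 v2 _ /eqP-> _ /eqP->] //.
  by rewrite (dchain_sub d) in nFK.
by rewrite subrr.
Qed.

End Module.

Lemma sum_fe (V : lmodType R) (v : V) : v = \sum_(K in flats M) e K *: v.
Proof. by rewrite -scaler_suml -fone scale1r. Qed.

Lemma singular_scale (V : lmodType R) F (w : V) a : singular F w -> singular F (kap a *: w).
Proof.
case=> h1 h2; split=> [|G c]; first by rewrite scalerA -fkC -scalerA h1.
by rewrite scalerA -fkC -scalerA h2 ?scaler0.
Qed.

(** With [B] the line through [w], [hw_detect] carries a nonzero component of any nonzero vector
    back to a nonzero multiple of [w]. *)
Lemma hw_simple (V : lmodType R) F (w : V) : F \in flats M ->
    (forall K, K \in flats M -> F \proper K ->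
      matroid_connected (minor M F K) -> (#|K :\: F|%:R : k) != 0) ->
    singular F w -> w != 0 ->
  simple_submodule (fun v : V => `[< exists a, v = a *: w >]).
Proof.
move=> Ff good sw w0; pose B v := exists c, v = kap c *: w.
have Bs v : B v -> singular F v by case=> c ->; apply: singular_scale.
have B0 : B 0 by exists 0; rewrite fk0 scale0r.
have BB x y : B x -> B y -> B (x - y).
  by case=> c -> [d ->]; exists (c - d); rewrite fkB scalerBl.
have Bk a x : B x -> B (kap a *: x) by case=> c ->; exists (a * c); rewrite fkM scalerA.
have Bw : B w by exists 1; rewrite fk1 scale1r.
split.
- split=> [|a x y /asboolP[b ->] /asboolP[c ->]]; apply/asboolP.
    by exists 0; rewrite scale0r.
  by exists (a * b + c); rewrite scalerDl scalerA.
- by exists w => //; apply/asboolP; exists 1; rewrite scale1r.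
move=> W' [W0 WD] sub; have [[x xW x0]|no] := pselect (exists2 x, x \in W' & x != 0); last first.
  left=> x; apply/idP/eqP => [xW|->//]; apply/eqP; apply: contraT => x0.
  by case: no; exists x.
right=> y; apply/idP/idP; first exact: sub.
move=> /asboolP[b ->]; have Wsc a v : v \in W' -> a *: v \in W'.
  by move=> vW; rewrite -[_ *: _]addr0 WD.
apply: (Wsc); have /asboolP[a Ex] := sub _ xW.
have [/existsP[K /andP[Kf nz]]|] := boolP [exists K, (K \in flats M) && (e K *: x != 0)]; last first.
  move/existsPn => z; case/eqP: x0; rewrite [x]sum_fe big1 // => K Kf.
  by apply/eqP; have := z K; rewrite Kf negbK.
have h : hw F B K (e K *: x) by rewrite Ex; apply: hw_cyclic.
have [t d [n0 [c Ec]]] := hw_detect Bs B0 BB Ff good Kf (hw_sub h nz) h nz.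
have c0 : c != 0 by apply: contraNneq n0 => c0; rewrite Ec c0 fk0 scale0r.
by rewrite -[w]scale1r -(fkV c0) -scalerA -Ec; do !apply: (Wsc).
Qed.

End HighestWeight.

(** * Units of the ideals and semisimplicity *)

Section Constructions.
Variables (T : finType) (M : matroid T) (k : fieldType) (R : pzRingType).
Variable S : flag_alg M k R.

(* The relations are stable under reversing paths. *)
Fact conv_cap (K K' L : {set T}) : covers M K L -> covers M K' L ->
  (fg S L K : R^c) * fg S K' L = if K == K' then (fe S K : R^c) *+ #|L :\: K|
      else if covers M (K :&: K') K then - ((fg S (K :&: K') K : R^c) * fg S K' (K :&: K')) else 0.
Proof.
move=> c c'; have := fcap S c' c; rewrite eq_sym setIC -(covers_cap c c').
by case: eqP => [->|_].
Qed.

(** Statements about right multiplication are those about left multiplication in this opposite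
    algebra. The definition is transparent so that its idempotents and steps compute to those of
    [S]. *)
Definition conv : flag_alg M k R^c.
refine (@FlagAlg T M k R^c (fe S) (fun K L => fg S L K) (fk S) _ _ _ _ _ _ _ _ _ _ _ _ _).
- exact: (fkB S).
- by move=> a b; rewrite [X in fk S X]mulrC; apply: (fkM S).
- exact: (fk1 S).
- by move=> a x; symmetry; apply: (fkC S).
- move=> K L; have := fee S L K; rewrite eq_sym.
  by case: eqP => [->|_].
- by move=> K L; apply: (fge S).
- by move=> K L; apply: (feg S).
- by move=> K L h; apply: (fg0 S); rewrite /adj orbC.
- by move=> L K; apply: (fsd S).
- by move=> L K; apply: (fsu S).
- exact: conv_cap.
- exact: (fone S).
- move=> P P0 PB PM Pk Pe Pg; apply: (@fgen _ _ _ _ S P) => //.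
  by move=> x y Px Py; apply: (PM y x).
Defined.

Variable J : R -> Prop.
Local Notation pi := (rpi J).

Definition quo : flag_alg M k (ring_quot J).
refine (@FlagAlg T M k (ring_quot J) (fun K => pi (fe S K)) (fun K L => pi (fg S K L))
  (fun a => pi (fk S a)) _ _ _ _ _ _ _ _ _ _ _ _ _).
- by move=> a b; rewrite fkB raddfB.
- by move=> a b; rewrite fkM rmorphM.
- by rewrite fk1 rmorph1.
- by move=> a x; rewrite -[x]rreprK -!rmorphM fkC.
- by move=> K L; rewrite -rmorphM fee; case: eqP; rewrite ?raddf0.
- by move=> K L; rewrite -rmorphM feg.
- by move=> K L; rewrite -rmorphM fge.
- by move=> K L /(fg0 S)->; rewrite raddf0.
- move=> L K Lf Kf LK r; rewrite -[RHS](raddf0 pi) -(fsu S Lf Kf LK r) raddf_sum.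
  by apply: eq_bigr => X _; rewrite -rmorphM.
- move=> L K Lf Kf LK r; rewrite -[RHS](raddf0 pi) -(fsd S Lf Kf LK r) raddf_sum.
  by apply: eq_bigr => X _; rewrite -rmorphM.
- move=> K K' L c c'; rewrite -rmorphM (fcap S c c').
  case: eqP => _; first by rewrite raddfMn.
  by case: ifP => _; rewrite ?raddf0 // rmorphN rmorphM.
- by rewrite -[LHS](rmorph1 pi) (fone S) raddf_sum.
- move=> P P0 PB PM Pk Pe Pg x; rewrite -[x]rreprK.
  elim/(@fgen _ _ _ _ S): (rrepr x) => [|{}x y Px Py|{}x y Px Py|a|K|K L] //.
  + by rewrite raddf0.
  + by rewrite raddfB; apply: PB.
  + by rewrite rmorphM; apply: PM.
Defined.

Lemma dn_quo K t : dn quo K t = pi (dn S K t).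
Proof. by elim: t K => [|H t IHt] K //=; rewrite IHt -rmorphM. Qed.

Lemma up_quo K t : up quo K t = pi (up S K t).
Proof. by elim: t K => [|H t IHt] K //=; rewrite IHt -rmorphM. Qed.

Lemma dn_conv K t : dn conv K t = up S K t :> R.
Proof. by elim: t K => [|H t IHt] K //=; rewrite IHt. Qed.

Lemma up_conv K t : up conv K t = dn S K t :> R.
Proof. by elim: t K => [|H t IHt] K //=; rewrite IHt. Qed.

End Constructions.

(** * Gram matrices of chains and local units *)

Section LocalUnit.
Variables (T : finType) (M : matroid T) (k : fieldType).
Implicit Types (F G H K L X Y : {set T}) (t : seq {set T}) (cs : seq (seq {set T})).

(** The coefficients are functions on pairs of naturals, not a matrix of size [size cs], so that
    they can be chosen for all pairs [F], [K] at once without dependent types. *)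
Definition eta (R : pzRingType) (S : flag_alg M k R) K cs (h : nat -> nat -> k) : R :=
  \sum_(j < size cs) \sum_(i < size cs)
    fk S (h j i) * (dn S K (nth [::] cs i) * up S K (nth [::] cs j)).

Lemma eta_conv R (S : flag_alg M k R) K cs h :
  eta (conv S) K cs (fun j i => h i j) = eta S K cs h :> R.
Proof.
rewrite /eta [LHS]exchange_big; apply: eq_bigr => j _; apply: eq_bigr => i _.
by rewrite -!dn_conv -!up_conv; apply: esym; apply: (fkC S).
Qed.

Lemma eta_quo R (S : flag_alg M k R) J K cs h : eta (quo S J) K cs h = rpi J (eta S K cs h).
Proof.
rewrite /eta rmorph_sum; apply: eq_bigr => j _; rewrite rmorph_sum; apply: eq_bigr => i _.
by rewrite !rmorphM dn_quo up_quo.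
Qed.

Definition lists_chains F K cs := forall t, (t \in cs) = dchain M F K t.

Lemma lists_chains_ex F K : exists cs, lists_chains F K cs.
Proof.
pose n := (rank M K - rank M F)%N.
exists [seq val s | s <- enum {: n.-tuple {set T}} & dchain M F K (val s)] => t.
apply/mapP/idP => [[s] |d]; first by rewrite mem_filter => /andP[? _] ->.
have st : size t == n by rewrite /n (dchain_rank d) addKn.
by exists (Tuple st) => //; rewrite mem_filter d mem_enum.
Qed.

Lemma nth_chain F K cs i : lists_chains F K cs -> (i < size cs)%N -> dchain M F K (nth [::] cs i).
Proof. by move=> E lt; rewrite -E mem_nth. Qed.

Section Gram.
Variables (R : pzRingType) (S : flag_alg M k R) (F K : {set T}) (cs : seq (seq {set T})).
Local Notation c i := (nth [::] cs i).
Hypotheses (csP : lists_chains F K cs) (Ff : F \in flats M) (Kf : K \in flats M)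
  (FK : F \subset K).
Hypothesis good : forall K, K \in flats M -> F \proper K ->
  matroid_connected (minor M F K) -> (#|K :\: F|%:R : k) != 0.
(** True in the quotient by the ideal of the flats of rank below that of [F]; it makes [(F)] a
    singular vector of the regular module. *)
Hypothesis sing : forall G, covers M G F -> fg S G F = 0.

Let B (x : R^o) := exists a, x = fk S a * fe S F.

Let singF : @singular T M k R S R^o F (fe S F).
Proof.
split=> [|G cG]; first by rewrite [LHS]fee eqxx.
by rewrite sing // scale0r.
Qed.

Let Bs w : B w -> singular S F w.
Proof. by case=> a ->; apply: (singular_scale _ singF). Qed.

Let B0 : B 0. Proof. by exists 0; rewrite fk0 mul0r. Qed.

Let BB x y : B x -> B y -> B (x - y).
Proof. by case=> a -> [b ->]; exists (a - b); rewrite fkB mulrBl. Qed.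

Let Bk a x : B x -> B (fk S a *: x).
Proof. by case=> b ->; exists (a * b); rewrite fkM -mulrA. Qed.

Let Be : B (fe S F). Proof. by exists 1; rewrite fk1 mul1r. Qed.

(** The left kernel of a Gram matrix consists of linear relations between chains: a nonzero
    combination would be detected by some ascending chain, that is, by a column. *)
Lemma comb_zero (Gm : 'M[k]_(size cs)) (a : 'rV_(size cs)) :
    (forall i j : 'I_(size cs),
      up S K (c j) * dn S K (c i) = fk S (Gm i j) * fe S F) ->
    a *m Gm = 0 ->
  \sum_i fk S (a 0 i) * dn S K (c i) = 0.
Proof.
move=> GmE aG; set v := \sum_i _.
have h : hw S F B K (v : R^o).
  apply: big_ind => [|x y|i _]; [exact: hw0|exact: hwD|].
  have di := nth_chain csP (ltn_ord i).
  rewrite -(dn_e S di) mulrA fkC -mulrA.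
  by apply: hw_gen => //; apply: Bk.
apply/eqP; apply: contraT => v0.
have [t d [n0 _]] := hw_detect Bs B0 BB Ff good Kf FK h v0.
have tc : t \in cs by rewrite csP.
have ti : (index t cs < size cs)%N by rewrite index_mem.
case/eqP: n0; rewrite -(nth_index [::] tc) -[index _ _]/(nat_of_ord (Ordinal ti)).
set j := Ordinal ti; transitivity (fk S ((a *m Gm) 0 j) * fe S F); last first.
  by rewrite aG mxE fk0 mul0r.
rewrite [LHS]/GRing.scale /= mulr_sumr mxE.
rewrite (big_morph _ (fkD S) (fk0 S)) mulr_suml; apply: eq_bigr => i _.
by rewrite mulrA -fkC -mulrA fkM -[RHS]mulrA -GmE.
Qed.

(** Going down and up again ends at [F], where only scalar multiples of [(F)] are left. The scalars
    are merely chosen, since [(F)] may be zero. *)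
Lemma gram_ex : exists Gm : 'M[k]_(size cs), forall i j : 'I_(size cs),
  up S K (c j) * dn S K (c i) = fk S (Gm i j) * fe S F.
Proof.
have ex (ij : 'I_(size cs) * 'I_(size cs)) :
    exists a, up S K (c ij.2) * dn S K (c ij.1) = fk S a * fe S F.
  have d1 := nth_chain csP (ltn_ord ij.1); have d2 := nth_chain csP (ltn_ord ij.2).
  have := @hw_cyclic T M k R S R^o F B Bs Bk F (up S K (c ij.2) * dn S K (c ij.1)) _ Be.
  rewrite /GRing.scale /= -mulrA (dn_e S d1) mulrA (e_up S d2).
  by move/(hw_base Bs B0 BB).
have [f fE] := choice ex.
by exists (\matrix_(i, j) f (i, j)) => i j; rewrite mxE -fE.
Qed.

End Gram.

Section LocalUnitEx.
Variables (F K : {set T}) (cs : seq (seq {set T})).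
Hypotheses (csP : lists_chains F K cs) (Ff : F \in flats M) (Kf : K \in flats M)
  (FK : F \subset K).
Hypothesis good : forall K, K \in flats M -> F \proper K ->
  matroid_connected (minor M F K) -> (#|K :\: F|%:R : k) != 0.

Definition mxnat m (A : 'M[k]_m) (j i : nat) : k :=
  if insub j is Some j' then if insub i is Some i' then A j' i' else 0 else 0.

Lemma mxnatE m (A : 'M[k]_m) (j i : 'I_m) : mxnat A j i = A j i.
Proof. by rewrite /mxnat !valK. Qed.

(** As chains may be dependent, [Gm *m H] need not be the identity. But each row of [Gm *m H - 1] is
    killed by [Gm], so by [comb_zero] it is a relation between chains. *)
Lemma eta_dn (R : pzRingType) (S : flag_alg M k R) (Gm H : 'M[k]_(size cs)) t :
    (forall G, covers M G F -> fg S G F = 0) ->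
    (forall i j : 'I_(size cs), up S K (nth [::] cs j) * dn S K (nth [::] cs i)
       = fk S (Gm i j) * fe S F) ->
    Gm *m H *m Gm = Gm -> dchain M F K t ->
  eta S K cs (mxnat H) * dn S K t = dn S K t.
Proof.
move=> sing GmE GHG d; have tc : t \in cs by rewrite csP.
have ti : (index t cs < size cs)%N by rewrite index_mem.
rewrite -(nth_index [::] tc) -[index _ _]/(nat_of_ord (Ordinal ti)); set l := Ordinal ti.
have z := @comb_zero R S F K cs csP Ff Kf FK good sing Gm (row l (Gm *m H - 1%:M)) GmE.
apply/eqP; rewrite -subr_eq0 -z; last first.
  by rewrite -row_mul mulmxBl GHG mul1mx subrr row0.
under eq_bigr => i _ do rewrite !mxE fkB mulrBl.
rewrite sumrB; apply/eqP; congr (_ - _); last first.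
  rewrite (bigD1 l) //= eqxx fk1 mul1r big1 ?addr0 // => i il.
  by rewrite eq_sym (negbTE il) fk0 mul0r.
rewrite /eta mulr_suml.
under eq_bigr => j _ do rewrite mulr_suml.
rewrite exchange_big; apply: eq_bigr => i _.
rewrite (big_morph _ (fkD S) (fk0 S)) mulr_suml; apply: eq_bigr => j _.
have E : dn S K (nth [::] cs i) * (up S K (nth [::] cs j) * dn S K (nth [::] cs l))
    = fk S (Gm l j) * dn S K (nth [::] cs i).
  by rewrite GmE mulrA -fkC -mulrA (dn_e S (nth_chain csP (ltn_ord i))).
by rewrite mxnatE -!mulrA E mulrA -fkM [X in fk S X]mulrC.
Qed.

(** A single [H] serves both sides: in the opposite algebra the Gram matrix is [Gm^T], and [H^T] is
    a pseudoinverse of it. *)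
Lemma local_unit (R : pzRingType) (S : flag_alg M k R) :
    (forall G, covers M G F -> fg S G F = 0) -> (forall G, covers M G F -> fg S F G = 0) ->
  exists h, forall t, dchain M F K t ->
    eta S K cs h * dn S K t = dn S K t /\ up S K t * eta S K cs h = up S K t.
Proof.
move=> sing sing'; have [Gm GmE] := gram_ex csP sing.
pose H := pinvmx Gm; have GHG : Gm *m H *m Gm = Gm by apply: mulmxKpV.
exists (mxnat H) => t d; split; first exact: eta_dn sing GmE GHG d.
rewrite -eta_conv -!dn_conv.
have -> : eta (conv S) K cs (fun j i => mxnat H i j) = eta (conv S) K cs (mxnat H^T).
  apply: eq_bigr => j _; apply: eq_bigr => i _.
  have -> : mxnat H i j = mxnat H^T j i by rewrite !mxnatE [RHS]mxE.
  by [].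
apply: (@eta_dn R^c (conv S) Gm^T H^T t sing' _ _ d).
  move=> i j; rewrite mxE; have := GmE j i.
  by rewrite fkC -up_conv -dn_conv.
by rewrite -!trmx_mul mulmxA GHG.
Qed.

End LocalUnitEx.

Lemma eta_e R (S : flag_alg M k R) K cs h : eta S K cs h * fe S K = eta S K cs h.
Proof.
rewrite /eta mulr_suml; apply: eq_bigr => j _; rewrite mulr_suml; apply: eq_bigr => i _.
by rewrite -!mulrA up_e.
Qed.

Lemma eta_zero R (S : flag_alg M k R) F K cs h v : lists_chains F K cs ->
  (forall y, fe S F * (y * v) = 0) -> eta S K cs h * v = 0.
Proof.
move=> csP z; rewrite /eta mulr_suml big1 // => j _; rewrite mulr_suml big1 // => i _.
have dj := nth_chain csP (ltn_ord j).
by rewrite -(e_up S dj) -!mulrA z !mulr0.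
Qed.

(** On a chain from [K] to [F] only the summand of the pair [F], [K] acts: another [K] dies by
    orthogonality of the idempotents, another [F'] because a nonzero component at [F'] forces [F]
    into [F'], of equal rank. The chains from all [K] span the left ideal of [(F)]. *)
Lemma eta_sum_unit R (S : flag_alg M k R) n (cs : {set T} -> {set T} -> seq (seq {set T}))
    (h : {set T} -> {set T} -> nat -> nat -> k) F a :
    (forall F K, lists_chains F K (cs F K)) ->
    (forall F G, F \in flats M -> rank M F = n -> covers M G F -> fg S G F = 0) ->
    (forall F K t, F \in flats M -> rank M F = n -> dchain M F K t ->
       eta S K (cs F K) (h F K) * dn S K t = dn S K t) ->
    F \in flats M -> rank M F = n ->
  (\sum_(F in flats M | rank M F == n) \sum_(K in flats M | F \subset K)
     eta S K (cs F K) (h F K)) * (a * fe S F) = a * fe S F.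
Proof.
move=> csP sing hP Ff rF; set s := \sum_(F in _ | _) _.
pose B (x : R^o) := exists c, x = fk S c * fe S F.
have singF : @singular T M k R S R^o F (fe S F).
  by split=> [|G cG]; [rewrite [LHS]fee eqxx|rewrite sing // scale0r].
have Bs w : B w -> singular S F w by case=> c ->; apply: (singular_scale _ singF).
have B0 : B 0 by exists 0; rewrite fk0 mul0r.
have BB x y : B x -> B y -> B (x - y).
  by case=> c -> [d ->]; exists (c - d); rewrite fkB mulrBl.
have Bk c x : B x -> B (fk S c *: x).
  by case=> b ->; exists (c * b); rewrite fkM -mulrA.
have Be : B (fe S F) by exists 1; rewrite fk1 mul1r.
have step K t : K \in flats M -> dchain M F K t -> s * dn S K t = dn S K t.
  move=> Kf d; rewrite -[RHS](hP F K t Ff rF d) /s mulr_suml.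
  rewrite (bigD1 F) /=; last by rewrite Ff rF eqxx.
  rewrite mulr_suml (bigD1 K) /=; last by rewrite Kf (dchain_sub d).
  rewrite [X in _ + X + _]big1 => [|K' /andP[_ nK]]; last first.
    by rewrite -(e_dn S) -eta_e -!mulrA [fe S K' * _]mulrA fee (negbTE nK) mul0r mulr0.
  rewrite addr0 [X in _ + X]big1 ?addr0 // => F' /andP[/andP[F'f /eqP rF'] nF].
  rewrite mulr_suml big1 // => K' _; apply: eta_zero => // y.
  apply/eqP; apply: contraT => nz.
  have := hw_cyclic Bs Bk F' (y * dn S K t) Be; rewrite /GRing.scale /=.
  rewrite -[y * _ * _]mulrA (dn_e S d) => /hw_sub /(_ nz) FF'.
  by case/eqP: nF; apply/esym/(flat_sub_eq Ff F'f FF'); rewrite rF rF'.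
have stepT (v : R^o) : hwT S F B v -> s * v = v.
  elim=> [K {}v|x y _ hx _ hy]; last by rewrite mulrBr hx hy.
  have [Kf|nKf] := boolP (K \in flats M); last first.
    elim=> [t w d _||x y _ hx _ hy]; rewrite ?mulr0 ?mulrBr ?hx ?hy //.
    case: t d nKf => [|H t]; first by rewrite /dchain /= => /eqP->; rewrite Ff.
    by rewrite dchain_cons => /andP[/covers_flatr ->].
  elim=> [t w d _||x y _ hx _ hy]; rewrite ?mulr0 ?mulrBr ?hx ?hy //.
  by rewrite mulrA step.
exact/stepT/(hwT_stable Bs Bk)/(hwT_base Bs).
Qed.

End LocalUnit.

(** * Two-sided units of the ideals generated by flats of small rank *)

Section Units.
Variables (T : finType) (M : matroid T) (k : fieldType) (R : pzRingType).
Variable S : flag_alg M k R.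
Implicit Types (F G H K L X Y : {set T}).
Hypothesis good : forall F K, F \in flats M -> K \in flats M -> F \proper K ->
  matroid_connected (minor M F K) -> (#|K :\: F|%:R : k) != 0.

Definition low n (x : R) := exists F, [/\ F \in flats M, (rank M F < n)%N & x = fe S F].

Lemma ideal_genD (J : R -> Prop) x y : ideal_gen J x -> ideal_gen J y -> ideal_gen J (x + y).
Proof.
move=> hx hy; rewrite -[y]opprK; apply: ideal_genB => //.
by rewrite -sub0r; apply: ideal_genB => //; apply: ideal_gen0.
Qed.

Lemma ideal_unit_ex n : exists2 u, ideal_gen (low n) u &
  forall y, ideal_gen (low n) y -> u * y = y /\ y * u = y.
Proof.
elim: n => [|n [u uI uP]].
  exists 0; first exact: ideal_gen0.
  have z y : ideal_gen (low 0) y -> y = 0.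
    elim=> [|x [F []]|x x' _ -> _ ->|a x _ ->|a x _ ->]; rewrite ?subr0 ?mulr0 ?mul0r //.
  by move=> y /z ->; rewrite mulr0.
(* Both [u * a] and [a * u] lie in the ideal, so both equal [u * a * u]. *)
have uC a : u * a = a * u.
  have [_ <-] := uP _ (ideal_genMr a uI); have [<- _] := uP _ (ideal_genMl a uI).
  by rewrite mulrA.
set J := low n in uI uP *; pose Q := quo S J.
have e0 F : F \in flats M -> (rank M F < n)%N -> rpi J (fe S F) = 0.
  move=> Ff lt; rewrite -[RHS](raddf0 (rpi J)); apply/rpi_eq; rewrite subr0.
  by apply: ideal_gen_gen; exists F.
have sing F G : F \in flats M -> rank M F = n -> covers M G F -> fg Q G F = 0.
  move=> Ff rF c; rewrite -feg /= e0 ?mul0r ?(covers_flatl c) //.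
  by rewrite -rF (covers_rank c).
have sing' F G : F \in flats M -> rank M F = n -> covers M G F -> fg Q F G = 0.
  move=> Ff rF c; rewrite -fge /= e0 ?mulr0 ?(covers_flatl c) //.
  by rewrite -rF (covers_rank c).
have [cs0 csP0] := choice (fun FK => @lists_chains_ex T M FK.1 FK.2).
pose cs F K := cs0 (F, K); have csP F K : lists_chains M F K (cs F K) by apply: (csP0 (F, K)).
have exh (FK : {set T} * {set T}) : exists h : nat -> nat -> k,
    FK.1 \in flats M -> rank M FK.1 = n -> forall t, dchain M FK.1 FK.2 t ->
    eta Q FK.2 (cs FK.1 FK.2) h * dn Q FK.2 t = dn Q FK.2 t /\
    up Q FK.2 t * eta Q FK.2 (cs FK.1 FK.2) h = up Q FK.2 t.
  case: FK => F K /=.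
  have [/and4P[Ff /eqP rF Kf FK]|no] :=
      boolP [&& F \in flats M, rank M F == n, K \in flats M & F \subset K]; last first.
    exists (fun _ _ => 0) => Ff rF t d; move: no; rewrite Ff rF eqxx (dchain_sub d) andbT /=.
    case: t d => [|H t]; first by rewrite /dchain /= => /eqP->; rewrite Ff.
    by rewrite dchain_cons => /andP[/covers_flatr ->].
  have [h hP] := @local_unit _ _ _ _ _ _ (csP F K) Ff Kf FK (fun K => @good F K Ff) _ Q
    (fun G => @sing F G Ff rF) (fun G => @sing' F G Ff rF).
  by exists h.
have [h0 hP0] := choice exh.
pose h F K := h0 (F, K).
pose v := \sum_(F in flats M | rank M F == n) \sum_(K in flats M | F \subset K)
  eta S K (cs F K) (h F K).
have vL F a : F \in flats M -> rank M F = n -> rpi J v * rpi J (a * fe S F) = rpi J (a * fe S F).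
  move=> Ff rF.
  have := @eta_sum_unit _ _ _ _ Q n cs h F (rpi J a) csP sing _ Ff rF.
  rewrite [rpi J v]rmorph_sum rmorphM => E; rewrite -[RHS]E => [|F' K t F'f rF' d]; last first.
    by have [] := hP0 (F', K) F'f rF' t d.
  congr (_ * _); apply: eq_bigr => F' _; rewrite rmorph_sum; apply: eq_bigr => K _.
  by rewrite eta_quo.
have vR F a : F \in flats M -> rank M F = n -> rpi J (fe S F * a) * rpi J v = rpi J (fe S F * a).
  move=> Ff rF.
  have := @eta_sum_unit _ _ _ _ (conv Q) n cs (fun F K j i => h F K i j) F (rpi J a) csP sing' _ Ff rF.
  rewrite [rpi J v]rmorph_sum rmorphM => E; rewrite -[RHS]E => [|F' K t F'f rF' d]; last first.
    have [_] := hP0 (F', K) F'f rF' t d.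
    by rewrite -eta_conv -dn_conv.
  congr (_ * _); apply: eq_bigr => F' _; rewrite rmorph_sum; apply: eq_bigr => K _.
  by rewrite eta_conv eta_quo.
have vI : ideal_gen (low n.+1) v.
  apply: big_ind => [|x y|F /andP[Ff /eqP rF]]; [exact: ideal_gen0|exact: ideal_genD|].
  apply: big_ind => [|x y|K /andP[Kf FK]]; [exact: ideal_gen0|exact: ideal_genD|].
  apply: big_ind => [|x y|j _]; [exact: ideal_gen0|exact: ideal_genD|].
  apply: big_ind => [|x y|i _]; [exact: ideal_gen0|exact: ideal_genD|].
  apply/ideal_genMl/ideal_genMr; rewrite -(dn_e S (nth_chain (csP F K) (ltn_ord i))).
  by apply/ideal_genMl/ideal_gen_gen; exists F; rewrite rF.
(* [v] is a two-sided unit of the next ideal modulo the present one; the factors [a] and [b] let the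
   induction pass through products. *)
have vP y : ideal_gen (low n.+1) y -> forall a b,
    rpi J v * rpi J (a * y * b) = rpi J (a * y * b) /\
    rpi J (a * y * b) * rpi J v = rpi J (a * y * b).
  elim=> [|{}y [F [Ff lt ->]]|x x' _ h1 _ h2|c x _ hx|c x _ hx] a b.
  - by rewrite mulr0 mul0r raddf0 mulr0 mul0r.
  - move: lt; rewrite ltnS leq_eqVlt => /orP[/eqP rF|lt].
      by rewrite rmorphM mulrA vL // -rmorphM -mulrA; split=> //; rewrite rmorphM -mulrA vR.
    by rewrite !rmorphM /= e0 // !(mulr0, mul0r).
  - have [e1 e1'] := h1 a b; have [e2 e2'] := h2 a b.
    by rewrite mulrBr mulrBl rmorphB mulrBr mulrBl e1 e1' e2 e2'.
  - by rewrite mulrA; apply: hx.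
  - by rewrite mulrA -[_ * c * b]mulrA; apply: hx.
have sub y : ideal_gen J y -> ideal_gen (low n.+1) y.
  elim=> [|x [F [Ff lt ->]]|x x' _ h1 _ h2|c x _ hx|c x _ hx].
  - exact: ideal_gen0.
  - by apply: ideal_gen_gen; exists F; rewrite ltnW.
  - exact: ideal_genB.
  - exact: ideal_genMl.
  - exact: ideal_genMr.
(* [u] acts as the identity on the old ideal and [1 - u] annihilates it, so [v], a unit only modulo
   that ideal, becomes exact once multiplied by [1 - u]. *)
exists (u + (1 - u) * v); first by apply: ideal_genD; [apply: sub|apply: ideal_genMl].
move=> y yI; have [] := vP y yI 1 1; rewrite mul1r mulr1 -!rmorphM => /rpi_eq h1 /rpi_eq h2.
have kill z : ideal_gen J z -> (1 - u) * z = 0.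
  by move=> zI; rewrite mulrBl mul1r (uP z zI).1 subrr.
have f1 : (1 - u) * (v * y) = (1 - u) * y.
  by apply/eqP; rewrite -subr_eq0 -mulrBr kill.
have f2 : (1 - u) * (y * v) = (1 - u) * y.
  by apply/eqP; rewrite -subr_eq0 -mulrBr kill.
have yu : y * (1 - u) = (1 - u) * y by rewrite mulrBr mulrBl mulr1 mul1r uC.
split; first by rewrite mulrDl -mulrA f1 mulrBl mul1r addrC subrK.
by rewrite mulrDr mulrA yu -mulrA f2 -uC mulrBl mul1r addrC subrK.
Qed.

End Units.

Section Semisimple.

Section DirectSum.
Variables (R : pzRingType) (V : lmodType R).
Implicit Types (us ws : seq V).

Definition cyc (w : V) : {pred V} := fun v => `[< exists a, v = a *: w >].

Fixpoint inspan us (v : V) : Prop :=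
  if us is w :: us' then exists a, inspan us' (v - a *: w) else v = 0.

Fixpoint indep us : Prop :=
  if us is w :: us' then (forall a, inspan us' (a *: w) -> a *: w = 0) /\ indep us' else True.

Lemma inspan_lin us a x y : inspan us x -> inspan us y -> inspan us (a *: x + y).
Proof.
elim: us x y => [|w us IHus] x y /= => [-> ->|[b hx] [c hy]]; first by rewrite scaler0 addr0.
exists (a * b + c); have := IHus _ _ hx hy.
by rewrite scalerBr scalerDl scalerA opprD addrACA.
Qed.

Lemma inspan0 us : inspan us 0.
Proof. by elim: us => //= w us IHus; exists 0; rewrite scale0r subr0. Qed.

Lemma inspan_cons us w v : inspan us v -> inspan (w :: us) v.
Proof. by move=> h; exists 0; rewrite scale0r subr0. Qed.

(** Greedy choice: [w] is kept only if it is not yet in the span, and then simplicity of [cyc w]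
    makes its intersection with that span zero. *)
Lemma indep_ex ws : (forall w, w \in ws -> simple_submodule (cyc w)) ->
  exists us, [/\ {subset us <= ws}, indep us & forall v, inspan ws v -> inspan us v].
Proof.
elim: ws => [|w ws IHws] sim; first by exists [::].
have [u uws|us [sub ind sp]] := IHws; first by apply: sim; rewrite in_cons uws orbT.
have [win|nin] := pselect (inspan us w).
  exists us; split=> // [u /sub|v [a /sp h]]; first by rewrite in_cons orbC => ->.
  by rewrite -[v](subrK (a *: w)) addrC; apply: inspan_lin.
exists (w :: us); split=> [u|/=|v [a /sp h]]; last by exists a.
  by rewrite !in_cons => /orP[->//|/sub ->]; rewrite orbT.
split=> // a aw; have [_ _ /(_ (fun v => `[< inspan us v >] && cyc w v))] := sim w (mem_head _ _).
case=> [|v|z|z].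
- split=> [|b x y /andP[/asboolP hx /asboolP[c xE]] /andP[/asboolP hy /asboolP[d yE]]].
    by apply/andP; split; apply/asboolP; [apply: inspan0|exists 0; rewrite scale0r].
  apply/andP; split; apply/asboolP; first exact: inspan_lin.
  by exists (b * c + d); rewrite xE yE scalerDl scalerA.
- by case/andP.
- have : a *: w \in pred1 0.
    by rewrite -z; apply/andP; split; apply/asboolP => //; exists a.
  by rewrite inE => /eqP.
have : w \in cyc w by apply/asboolP; exists 1; rewrite scale1r.
by rewrite -z => /andP[/asboolP].
Qed.

Lemma indep_zero us (f : nat -> V) : indep us ->
  (forall i, (i < size us)%N -> f i \in cyc (nth 0 us i)) ->
  \sum_(i < size us) f i = 0 -> forall i, (i < size us)%N -> f i = 0.
Proof.
elim: us f => [|w us IHus] f //= [iw ind] fc.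
rewrite big_ord_recl /= => s0.
have in_us (g : nat -> V) : (forall i, (i < size us)%N -> g i \in cyc (nth 0 us i)) ->
    inspan us (\sum_(i < size us) g i).
  elim: us g {IHus iw ind fc s0} => [|u us IHus] g gc /=; first by rewrite big_ord0.
  rewrite big_ord_recl /=; have /asboolP[a aE] := gc 0%N isT.
  exists a; rewrite {1}aE addrAC subrr add0r.
  by apply: (IHus (fun i => g i.+1)) => i lt; apply: (gc i.+1).
have fc' i : (i < size us)%N -> f i.+1 \in cyc (nth 0 us i) by apply: (fc i.+1).
have f0 : f 0%N = 0.
  have /asboolP[a aE] := fc 0%N isT.
  rewrite aE; apply: iw; rewrite -aE; move/eqP: s0; rewrite addr_eq0 => /eqP ->.
  by rewrite -scaleN1r -[_ *: _]addr0; apply: inspan_lin (inspan0 _); apply: (in_us (fun i => f i.+1)).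
rewrite f0 add0r in s0; case=> [//|i]; rewrite ltnS.
exact: (IHus (fun i => f i.+1)).
Qed.

Lemma semisimple_of_cyclic ws : (forall w, w \in ws -> simple_submodule (cyc w)) ->
  (forall v, inspan ws v) -> semisimple_module V.
Proof.
move=> sim all; have [us [sub ind sp]] := indep_ex sim.
exists 'I_(size us), (fun i : 'I_(size us) => cyc (nth 0 us i)); split=> [i|].
  by apply/sim/sub/mem_nth.
split=> [v|s w us_s wc s0 i is_].
  exists (index_enum 'I_(size us)).
  elim: us v {sub ind sp} (sp v (all v)) => [|u us IHus] v /=.
    by move=> ->; exists (fun=> 0); split=> [[]//|]; rewrite big1.
  case=> a /IHus[f [fc vE]].
  exists (fun i => if unlift ord0 i is Some j then f j else a *: u); split=> [i|].
    case: unliftP => [j ->|->] /=; first exact: fc.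
    by apply/asboolP; exists a.
  rewrite big_ord_recl unlift_none; under eq_bigr => j _ do rewrite liftK.
  by rewrite -vE addrC subrK.
pose f n := if insub n is Some j then if j \in s then w j else 0 else 0.
have fE (j : 'I_(size us)) : f j = if j \in s then w j else 0 by rewrite /f valK.
have := indep_zero (f := f) ind _ _ (ltn_ord i); rewrite fE is_; apply=> [n lt|].
  rewrite -[n]/(nat_of_ord (Ordinal lt)) fE; case: ifP => _; first exact: wc.
  by apply/asboolP; exists 0; rewrite scale0r.
transitivity (\sum_(j <- s) w j); last exact: s0.
rewrite [RHS]big_uniq //= [RHS]big_mkcond; apply: eq_bigr => j _; apply: fE.
Qed.

End DirectSum.

Variables (T : finType) (M : matroid T) (k : fieldType) (R : pzRingType).
Variable S : flag_alg M k R.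
Implicit Types (F G H K L X Y : {set T}).
Hypothesis good : forall F K, F \in flats M -> K \in flats M -> F \proper K ->
  matroid_connected (minor M F K) -> (#|K :\: F|%:R : k) != 0.

Let sumsing (y : R) := exists ws : seq R^o,
  inspan ws y /\ forall w, w \in ws -> exists2 F, F \in flats M & singular S F w.

Lemma inspan_catl (us ws : seq R^o) v : inspan us v -> inspan (us ++ ws) v.
Proof.
elim: us v => [|u us IHus] v /= => [->|[a /IHus h]]; first exact: inspan0.
by exists a.
Qed.

Lemma inspan_catr (us ws : seq R^o) v : inspan ws v -> inspan (us ++ ws) v.
Proof. by elim: us => // u us IHus /IHus; apply: inspan_cons. Qed.

Let ss0 : sumsing 0. Proof. by exists [::]. Qed.

Let ssB x y : sumsing x -> sumsing y -> sumsing (x - y).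
Proof.
move=> [us [xu uP]] [ws [yw wP]]; exists (us ++ ws); split; last first.
  by move=> w; rewrite mem_cat => /orP[/uP|/wP].
by rewrite addrC -[- y]mulN1r; apply: inspan_lin; [apply: inspan_catr|apply: inspan_catl].
Qed.

Let ssMl a x : sumsing x -> sumsing (a * x).
Proof.
move=> [us [xu uP]]; exists us; split=> //; rewrite -[a * x]addr0.
exact: inspan_lin (inspan0 _).
Qed.

(** Singularity is a condition on left multiplication, so right translates of singular vectors are
    singular. *)
Let ssMr a x : sumsing x -> sumsing (x * a).
Proof.
move=> [us [xu uP]]; exists [seq u * a | u <- us]; split.
  elim: us x xu {uP} => [|u us IHus] x /= => [->|[b /IHus h]]; first by rewrite mul0r.
  by exists b; move: h; rewrite mulrBl -[b *: u * a]mulrA.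
move=> _ /mapP[u /uP[F Ff [h1 h2]] ->]; exists F => //; split=> [|G c].
  by rewrite [LHS]mulrA; congr (_ * _).
by rewrite [LHS]mulrA; have := h2 G c; rewrite /GRing.scale /= => ->; rewrite mul0r.
Qed.

(** Split [(F)] as [(1 - u)(F) + u(F)], with [u] the unit for the ranks below that of [F]. The first
    part is singular; the second lies in the two-sided ideal generated by the flats of smaller rank,
    which induction covers. *)
Lemma sumsing_fe F : F \in flats M -> sumsing (fe S F).
Proof.
have [n] := ubnP (rank M F); elim: n F => // n IHn F; rewrite ltnS => le Ff.
have [u uI uP] := ideal_unit_ex S good (rank M F).
have uC a : u * a = a * u.
  have [_ <-] := uP _ (ideal_genMr a uI); have [<- _] := uP _ (ideal_genMl a uI).
  by rewrite mulrA.
have uS : sumsing u.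
  elim: uI => [|x [G [Gf lt ->]]|x y _ hx _ hy|a x _ hx|a x _ hx].
  - exact: ss0.
  - by apply: IHn => //; apply: leq_trans lt le.
  - exact: ssB.
  - exact: ssMl.
  - exact: ssMr.
have wS : sumsing ((1 - u) * fe S F).
  exists [:: (1 - u) * fe S F]; split=> [|w /[!inE] /eqP ->].
    by exists 1; rewrite scale1r subrr.
  exists F => //; split=> [|G c]; rewrite /GRing.scale /=.
    have uF : (1 - u) * fe S F = fe S F * (1 - u) by rewrite mulrBl mulrBr mul1r mulr1 uC.
    by rewrite {1}uF mulrA fee eqxx -uF.
  (* The step from [F] to [G] factors through the lower idempotent [(G)], hence lies in the ideal
     and is killed by [1 - u]. *)
  have gI : ideal_gen (low S (rank M F)) (fg S G F).
    rewrite -(feg S); apply/ideal_genMr/ideal_gen_gen; exists G.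
    by rewrite (covers_flatl c) (covers_rank c).
  by rewrite mulrA mulrBr mulr1 (uP _ gI).2 subrr mul0r.
have -> : fe S F = (1 - u) * fe S F - (- u) * fe S F by rewrite -mulrBl opprK subrK mul1r.
by apply: ssB => //; apply: ssMr; rewrite -mulN1r; apply: ssMl.
Qed.

Lemma flag_alg_semisimple : semisimple_ring R.
Proof.
have [ws [h wP]] : sumsing 1.
  rewrite (fone S); apply: big_ind => // [x y hx hy|F]; last exact: sumsing_fe.
  rewrite -[y]opprK; apply: ssB => //; rewrite -sub0r; exact: ssB.
pose ws' : seq R^o := [seq w <- ws | w != 0].
apply: (@semisimple_of_cyclic R R^o ws') => [w|v].
  by rewrite mem_filter => /andP[w0 /wP[F Ff sw]]; apply: (hw_simple Ff _ sw w0) => K; apply: good.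
have {h} : inspan ws' (1 : R^o).
  rewrite /ws'; elim: ws (1 : R^o) h {wP ws'} => [|w ws IHws] x //= [a /IHws h].
  case: eqVneq => [w0|_] /=; last by exists a.
  by move: h; rewrite w0 scaler0 subr0.
move=> h; rewrite -[v]addr0 -[v]mulr1; exact: inspan_lin (inspan0 _).
Qed.

End Semisimple.

(** * The algebra S_k(M) and its standard modules *)

Section TensorExtra.
Variables U V : zmodType.

Lemma tens0l (v : V) : tens (0 : U) v = 0.
Proof. by apply: (@addrI _ (tens 0 v)); rewrite -tensDl !addr0. Qed.

Lemma tens0r (u : U) : tens u (0 : V) = 0.
Proof. by apply: (@addrI _ (tens u 0)); rewrite -tensDr !addr0. Qed.

Lemma tensNl (u : U) (v : V) : tens (- u) v = - tens u v.
Proof. by apply: (@addrI _ (tens u v)); rewrite -tensDl !subrr tens0l. Qed.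

Lemma tensNr (u : U) (v : V) : tens u (- v) = - tens u v.
Proof. by apply: (@addrI _ (tens u v)); rewrite -tensDr !subrr tens0r. Qed.

Lemma tens_suml I (r : seq I) (P : pred I) (f : I -> U) (v : V) :
  tens (\sum_(i <- r | P i) f i) v = \sum_(i <- r | P i) tens (f i) v.
Proof. by apply: (big_morph (fun u => tens u v)) => [x y|]; rewrite ?tensDl ?tens0l. Qed.

Lemma tensMnl (u : U) (v : V) n : tens (u *+ n) v = tens u v *+ n.
Proof. by elim: n => [|n IHn]; rewrite ?tens0l // !mulrS tensDl IHn. Qed.

End TensorExtra.

Section PathAlgebra.
Variables (T : finType) (M : matroid T).
Implicit Types (F G H K L X Y : {set T}) (s t : seq {set T}).
Local Notation fp := (@Defs.fpath T M).

Lemma adj_flatr K L : adj M K L -> L \in flats M.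
Proof. by case/orP => c; [apply: covers_flatr c|apply: covers_flatl c]. Qed.

Lemma is_flag_path_cat K s t :
  is_flag_path M (K, s ++ t) = is_flag_path M (K, s) && is_flag_path M (last K s, t).
Proof.
rewrite /is_flag_path /= cat_path; case Kf: (K \in flats M) => //=.
case ps: (path _ K s) => //=; suff -> : last K s \in flats M by [].
elim: s K Kf ps => //= L s IHs K _ /andP[/adj_flatr Lf ps]; exact: IHs Lf ps.
Qed.

Lemma fpath_invalid K s : ~~ is_flag_path M (K, s) -> fp K s = 0.
Proof. by move=> h; rewrite /Defs.fpath insubN. Qed.

Lemma fpath_basisE K s (p : is_flag_path M (K, s)) : fp K s = path_basis (Sub (K, s) p).
Proof. by rewrite /Defs.fpath insubT. Qed.

Lemma fpath_mul K s L t : fp K s * fp L t = if last K s == L then fp K (s ++ t) else 0.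
Proof.
have [p|np] := boolP (is_flag_path M (K, s)); last first.
  rewrite (fpath_invalid np) mul0r; case: ifP => // _; rewrite fpath_invalid // is_flag_path_cat.
  by rewrite (negbTE np).
have [q|nq] := boolP (is_flag_path M (L, t)); last first.
  rewrite (fpath_invalid nq) mulr0; case: eqP => // E; rewrite fpath_invalid // is_flag_path_cat E.
  by rewrite (negbTE nq) andbF.
rewrite (fpath_basisE p) (fpath_basisE q) [LHS]path_mulUU /path_concat /flast /fhead /ftail !SubK /=.
by case: eqP => // ->.
Qed.

Lemma fpath_cons K L s : fp K (L :: s) = fp K [:: L] * fp L s.
Proof. by rewrite fpath_mul /= eqxx. Qed.

Variable k : fieldType.
Local Notation Sk := (S_algk M k).
Local Notation pi := (rpi (@S_rel T M)).

Definition Se K : Sk := tens (pi (fp K [::])) 1.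
Definition Sg K L : Sk := tens (pi (fp K [:: L])) 1.
Definition Skap (a : k) : Sk := tens (1 : S_alg M) a.

Lemma SkM (a b : S_alg M) (c d : k) : (tens a c : Sk) * tens b d = tens (a * b) (c * d).
Proof. exact: tensor_mulE. Qed.

Lemma fs_sum (r : {set T} -> bool) (f g h : {set T} -> path_alg M) :
  (forall X, r X -> h X = f X * g X) -> pi (\sum_(X | r X) h X) = 0 ->
  \sum_(X | r X) (tens (pi (f X)) 1 : Sk) * tens (pi (g X)) 1 = 0.
Proof.
move=> hE; rewrite rmorph_sum => z.
rewrite -[RHS](tens0l (S_alg M) (1 : k)) -[X in tens X _]z tens_suml.
by apply: eq_bigr => X rX; rewrite SkM mulr1 hE // rmorphM.
Qed.

Definition Sk_alg : flag_alg M k Sk.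
refine (@FlagAlg T M k Sk Se Sg Skap _ _ _ _ _ _ _ _ _ _ _ _ _).
- by move=> a b; rewrite /Skap tensDr tensNr.
- by move=> a b; rewrite /Skap SkM mulr1.
- by [].
- move=> a; elim/tensor_ind => [|u v|x y hx hy]; first by rewrite mulr0 mul0r.
    by rewrite !SkM mul1r mulr1 mulrC.
  by rewrite mulrBr mulrBl hx hy.
- move=> K L; rewrite SkM mulr1 -rmorphM fpath_mul /=.
  by case: eqP => // _; rewrite rmorph0 tens0l.
- by move=> K L; rewrite SkM mulr1 -rmorphM fpath_mul /= eqxx.
- by move=> K L; rewrite SkM mulr1 -rmorphM fpath_mul /= eqxx.
- move=> K L nadj; rewrite /Sg fpath_invalid ?rmorph0 ?tens0l //.
  by rewrite /is_flag_path /= (negbTE nadj) andbF.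
- move=> L K Lf Kf LK r; apply: (@fs_sum _ _ _ (fun X => fp L [:: X; K])) => [X _|].
    exact: fpath_cons.
  by rewrite -[RHS](rmorph0 pi); apply/rpi_eq; rewrite subr0; apply/ideal_gen_gen/FS_up.
- move=> L K Lf Kf LK r; apply: (@fs_sum _ _ _ (fun X => fp K [:: X; L])) => [X _|].
    exact: fpath_cons.
  by rewrite -[RHS](rmorph0 pi); apply/rpi_eq; rewrite subr0; apply/ideal_gen_gen/FS_down.
- move=> K K' L c c'; rewrite SkM mulr1 -rmorphM -fpath_cons /=.
  have -> : pi (fp K [:: L; K']) = pi (cap_value M K K' L).
    by apply/rpi_eq/ideal_gen_gen/cap_rel.
  rewrite /cap_value; case: eqP => _; first by rewrite rmorphMn tensMnl.
  case: ifP => _; last by rewrite rmorph0 tens0l.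
  by rewrite rmorphN tensNl SkM mulr1 -rmorphM -fpath_cons.
- transitivity (tens (pi (path_one M)) (1 : k) : Sk).
    by congr (tens _ _); apply/esym; apply: (rmorph1 pi).
  by rewrite /path_one rmorph_sum tens_suml.
- move=> P P0 PB PM Pk Pe Pg; elim/tensor_ind => [//|u v|]; last exact: PB.
  have -> : tens u v = (tens u 1 : Sk) * Skap v by rewrite SkM mul1r mulr1.
  apply: (PM) => //; rewrite -[u]rreprK; elim/path_alg_ind: (rrepr u) => [|p|x y Px Py].
  + by rewrite rmorph0 tens0l.
  + rewrite -fpath_val; elim: (ftail p) (fhead p) => [|L s IHs] K; first exact: Pe.
    rewrite fpath_cons rmorphM -[1]mulr1 -SkM; apply: PM; [exact: Pg|exact: IHs].
  + by rewrite rmorphB tensDl tensNl; apply: PB.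
Defined.

Section Standard.
Variable F : {set T}.
Hypothesis Ff : F \in flats M.

Fact gen_in_ideal : pi (fp F [::]) \in @S_ideal T M F.
Proof. by apply/asboolP; exists 1; rewrite mul1r. Qed.

Definition ideal_genF : S_ideal_type M F :=
  exist (fun x : (S_alg M)^o => x \in @S_ideal T M F) _ gen_in_ideal.

Lemma val_ideal_genF : val ideal_genF = pi (fp F [::]) :> S_alg M.
Proof. by []. Qed.

Definition std_gen : standard M F := lpi _ ideal_genF.

Definition stdk_gen : standardk M F k := tens std_gen (1 : k^o).

Lemma SkZ (a : S_alg M) (c : k) (x : standard M F) (d : k^o) :
  (tens a c : Sk) *: (tens x d : standardk M F k) = tens (a *: x) (c * d).
Proof. exact: tensor_scaleE. Qed.

Lemma stdk_gen_cyclic (v : standardk M F k) : exists a : Sk, v = a *: stdk_gen.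
Proof.
elim/tensor_ind: v => [|x c|x y [a ->] [b ->]]; first by exists 0; rewrite scale0r.
  rewrite -[x]lreprK; have /asboolP[s sE] := valP (lrepr x).
  exists (tens s c); rewrite SkZ mulr1; congr tens.
  have -> : lrepr x = s *: ideal_genF.
    by apply: val_inj; rewrite GRing.valZ val_ideal_genF; apply: sE.
  exact: lpi_scalable.
by exists (a - b); rewrite scalerBl.
Qed.

(** For [G] covered by [F], the path [(G, F)] ends at [F] and starts at a flat not containing [F],
    so it is zero in the quotient. *)
Lemma stdk_gen_singular : singular Sk_alg F stdk_gen.
Proof.
split=> [|G c]; rewrite [LHS]SkZ mulr1.
  congr tens; rewrite -[LHS]lpi_scalable; congr lpi; apply: val_inj.
  by rewrite GRing.valZ val_ideal_genF -[LHS](rmorphM pi) fpath_mul eqxx.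
suff -> : pi (fp G [:: F]) *: std_gen = 0 by rewrite tens0l.
rewrite -[LHS]lpi_scalable -[RHS](raddf0 (lpi _)); apply/lpi_eq; rewrite subr0.
apply/asboolP/zspan_gen.
have p : is_flag_path M (G, [:: F]).
  by rewrite /is_flag_path /= (covers_flatl c) /adj c.
exists (Sub (G, [:: F]) p); split.
- by rewrite /flast /fhead /ftail SubK.
- exists G; first by rewrite /fhead SubK mem_head.
  by have := covers_proper c; rewrite properE => /andP[].
- by rewrite GRing.valZ val_ideal_genF -fpath_basisE -[LHS](rmorphM pi) fpath_mul eqxx.
Qed.

Lemma standardk_simple : stdk_gen != 0 ->
    (forall K, K \in flats M -> F \proper K ->
      matroid_connected (minor M F K) -> (#|K :\: F|%:R : k) != 0) ->
  simple_module (standardk M F k).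
Proof.
move=> nz good; have := hw_simple Ff good stdk_gen_singular nz.
rewrite /simple_module; set W := (W in simple_submodule W); suff -> : W = predT by [].
by apply: funext => v; apply/asboolP; apply: stdk_gen_cyclic.
Qed.

(* The summand of the regular module that hits [stdk_gen] maps onto the standard module. *)
Lemma semisimple_standardk : stdk_gen != 0 -> semisimple_ring Sk -> simple_module (standardk M F k).
Proof.
move=> nz [I [W [sim [span _]]]]; pose B (x : standardk M F k) := exists c, x = Skap c *: stdk_gen.
have Bs w : B w -> singular Sk_alg F w.
  by case=> c ->; apply: (singular_scale (S := Sk_alg) c stdk_gen_singular).
have B0 : B 0 by exists 0; rewrite /Skap tens0r scale0r.
have BB x y : B x -> B y -> B (x - y).
  by case=> c -> [d ->]; exists (c - d); rewrite /Skap tensDr tensNr scalerBl.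
have Bk c x : B x -> B (Skap c *: x).
  by case=> d ->; exists (c * d); rewrite scalerA; congr (_ *: _); rewrite SkM mulr1.
have Be : B stdk_gen by exists 1; rewrite [LHS](_ : _ = 1 *: stdk_gen) ?scale1r.
have [s [w [wW E1]]] := span 1.
have [i _ nzi] : exists2 i, i \in s & Se F *: (w i *: stdk_gen) != 0.
  apply/hasP; apply: contraNT nz => /hasPn z.
  have [<- _] := stdk_gen_singular; rewrite -[stdk_gen in X in X == _]scale1r [1 in X in X == _]E1.
  rewrite scaler_suml scaler_sumr big_seq big1 // => i /z.
  by rewrite negbK => /eqP.
have [c cE] : B (Se F *: (w i *: stdk_gen)).
  have h := @hw_cyclic T M k Sk Sk_alg (standardk M F k) F B Bs Bk F (w i) stdk_gen Be.
  exact: (hw_base Bs B0 BB h).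
have c0 : c != 0 by apply: contraNneq nzi => c0; rewrite cE c0 /Skap tens0r scale0r.
have [Wc Wnz Wmin] := sim i; case: (Wc) => W0 WD.
have Wsc a v : v \in W i -> a *: v \in W i by move=> vW; rewrite -[_ *: _]addr0 WD.
have reg (b : Sk) (x y : Sk^o) :
    ((b *: x + y : Sk^o) : Sk) *: stdk_gen = b *: ((x : Sk) *: stdk_gen) + (y : Sk) *: stdk_gen.
  by rewrite [LHS]scalerDl; congr (_ + _); apply/esym; apply: scalerA.
(* The component at [F] of [w i *: stdk_gen] is [c] times the generator; rescaling gives an element
   of [W i] that fixes the generator. Evaluation there maps [W i] onto the standard module, so
   submodules can be compared through their preimages in [W i]. *)
pose u : Sk^o := Skap c^-1 *: (Se F *: w i).
have uW : u \in W i by do 2!apply: (Wsc).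
have uE : (u : Sk) *: stdk_gen = stdk_gen.
  transitivity ((Skap c^-1 * (Se F * (w i : Sk))) *: stdk_gen); first by [].
  rewrite -!scalerA; have -> : Se F *: (w i *: stdk_gen) = Skap c *: stdk_gen by [].
  by have := fkV Sk_alg c0; rewrite /= scalerA => ->; rewrite scale1r.
have inj (a : Sk) : a \in W i -> a *: stdk_gen = 0 -> a = 0.
  have [||z|z] := Wmin (fun a : Sk^o => (a \in W i) && ((a : Sk) *: stdk_gen == 0)).
  - split=> [|b x y /andP[xW /eqP x0] /andP[yW /eqP y0]].
      by apply/andP; split; rewrite ?W0 // scale0r.
    apply/andP; split; first exact: WD.
    by rewrite reg x0 y0 scaler0 addr0.
  - by move=> b /andP[].
  - move=> aW a0; have : (a : Sk^o) \in pred1 0 by rewrite -z; apply/andP; rewrite a0.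
    by rewrite inE => /eqP.
  - by have := uW; rewrite -z => /andP[_]; rewrite uE (negbTE nz).
split=> // [|W' [W'0 W'D] _]; first by exists stdk_gen.
pose N (a : Sk^o) := (a \in W i) && ((a : Sk) *: stdk_gen \in W').
have [||z|z] := Wmin N.
- split=> [|b x y /andP[xW x0] /andP[yW y0]].
    by apply/andP; split; rewrite ?W0 // scale0r.
  apply/andP; split; first exact: WD.
  by rewrite reg W'D.
- by move=> a /andP[].
- left=> x; rewrite [RHS]inE; apply/idP/eqP => [xW'|->//].
  have [a aE] := stdk_gen_cyclic x; have E : (a * u : Sk) *: stdk_gen = x by rewrite -scalerA uE.
  have : (a * u : Sk^o) \in N.
    by apply/andP; split; [apply: (Wsc)|rewrite E].
  by rewrite z inE => /eqP a0; rewrite -E a0 scale0r.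
right=> x; rewrite [RHS]inE; have [a aE] := stdk_gen_cyclic x.
have : (a * u : Sk^o) \in N by rewrite z; apply: (Wsc).
by case/andP=> _; rewrite -scalerA uE -aE => ->.
Qed.

End Standard.
End PathAlgebra.

(** * The exterior algebra model *)

(* The exterior algebra on [T]: the function [f] stands for the sum of the
   [f A *: e_A], where [e_A] is the product of the elements of [A] in increasing
   order. *)
Section Exterior.
Variables (T : finType) (k : fieldType).
Definition ext : vectType k := {ffun {set T} -> k^o}.
Implicit Types (A B E G : {set T}) (a e x : T) (f g : ext).

Definition before a e := (enum_rank a < enum_rank e)%N.

(** The sign of sorting [e] into [A]: e_e /\ e_A is this sign times the basis vector of [e |: A],
    for [e] outside [A]. *)
Definition sgn e A : k := (-1) ^+ #|[set a in A | before a e]|.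

Definition bsgn a e : k := if before a e then -1 else 1.

Lemma before_asym a e : a != e -> before e a = ~~ before a e.
Proof.
move=> ae; rewrite /before -leqNgt ltn_neqAle andbC; case: leqP => //= _.
by rewrite (inj_eq val_inj) (inj_eq enum_rank_inj) eq_sym.
Qed.

Lemma bsgn_swap a e : a != e -> bsgn a e = - bsgn e a.
Proof. by move=> ae; rewrite /bsgn (before_asym ae); case: ifP => _ /=; rewrite ?opprK. Qed.

Lemma bsgnK a e : bsgn a e * bsgn a e = 1.
Proof. by rewrite /bsgn; case: ifP; rewrite ?mulrNN mulr1. Qed.

Lemma sgnK e A : sgn e A * sgn e A = 1.
Proof. by rewrite /sgn -expr2 sqrr_sign. Qed.

Lemma sgnU1 a e A : a \notin A -> sgn e (a |: A) = bsgn a e * sgn e A.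
Proof.
move=> aA; rewrite /sgn /bsgn; case: ifP => ae.
  have -> : [set b in a |: A | before b e] = a |: [set b in A | before b e].
    by apply/setP => b; rewrite !inE; case: eqVneq => [->|].
  by rewrite cardsU1 inE (negbTE aA) exprS.
rewrite mul1r; congr (_ ^+ _); apply: eq_card => b; rewrite !inE.
by case: eqVneq => [->|//]; rewrite ae (negbTE aA).
Qed.

Lemma sgnU1_id e A : sgn e (e |: A) = sgn e A.
Proof.
congr (_ ^+ _); apply: eq_card => b; rewrite !inE.
by case: eqVneq => [->|//]; rewrite /before ltnn !andbF.
Qed.

Lemma sgnD1 a e A : a \in A -> sgn e (A :\ a) = bsgn a e * sgn e A.
Proof.
move=> aA; rewrite -[in RHS](setD1K aA) sgnU1 ?setD11 //.
by rewrite mulrA bsgnK mul1r.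
Qed.

(** Each ordered pair is matched with its swap; deducing the claim from the sum being its own
    negative would fail in characteristic 2. *)
Lemma antisym_sum (t : T -> T -> k) : (forall e, t e e = 0) ->
  (forall a e, a != e -> t a e = - t e a) -> \sum_a \sum_e t a e = 0.
Proof.
move=> t0 tN; rewrite pair_big (bigID (fun p => before p.1 p.2)) /=.
rewrite [X in _ + X](bigID (fun p => p.1 == p.2)) /=.
rewrite [X in _ + (X + _)]big1 => [|[a e] /= /andP[_ /eqP ->]]; last exact: t0.
rewrite add0r [X in _ + X](reindex_inj (h := fun p => (p.2, p.1))) /=; last first.
  by move=> [a e] [b c] [-> ->].
apply/eqP; rewrite addr_eq0 -sumrN; apply/eqP/eq_big => [[a e]|[a e] /=].
  rewrite /= eq_sym; case: (eqVneq a e) => [->|ae]; first by rewrite andbF /before ltnn.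
  by rewrite andbT (before_asym ae) negbK.
move=> ae; rewrite tN //; apply: contraTneq ae => ->; by rewrite /before ltnn.
Qed.

(** On coefficients, [eps E] is exterior multiplication on the left by the sum of [E], and [iprod E]
    is contraction with the sum of the dual vectors of [E]. *)
Definition eps E f : ext := [ffun B : {set T} => \sum_(e in B :&: E) sgn e B * f (B :\ e)].
Definition iprod E f : ext := [ffun A : {set T} => \sum_(e in E :\: A) sgn e A * f (e |: A)].

Fact eps_linear E : linear (eps E).
Proof.
move=> c f g; apply/ffunP => B; rewrite !ffunE /GRing.scale /= mulr_sumr -big_split.
by apply: eq_bigr => e _; rewrite !ffunE /GRing.scale /= mulrDr mulrCA.
Qed.

HB.instance Definition _ E := GRing.isLinear.Build k ext ext _ (eps E) (eps_linear E).

Fact iprod_linear E : linear (iprod E).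
Proof.
move=> c f g; apply/ffunP => B; rewrite !ffunE /GRing.scale /= mulr_sumr -big_split.
by apply: eq_bigr => e _; rewrite !ffunE /GRing.scale /= mulrDr mulrCA.
Qed.

HB.instance Definition _ E := GRing.isLinear.Build k ext ext _ (iprod E) (iprod_linear E).

Lemma eps_sq E f : eps E (eps E f) = 0.
Proof.
apply/ffunP => B; rewrite !ffunE big_mkcond.
transitivity (\sum_a \sum_e if [&& a \in B :&: E, e \in B :&: E & a != e]
   then sgn a B * (sgn e (B :\ a) * f (B :\ a :\ e)) else 0); last first.
  apply: antisym_sum => [e|a e ae]; first by rewrite eqxx !andbF.
  rewrite (eq_sym e a) ae !andbT andbC; case: ifP => [/andP[eB aB]|_]; last by rewrite oppr0.
  move: eB aB; rewrite !inE => /andP[eB _] /andP[aB _].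
  rewrite !sgnD1 // (bsgn_swap ae) setDDl setUC -setDDl.
  by ring.
apply: eq_bigr => a _; case: ifP => aB /=; last by rewrite big1.
rewrite ffunE mulr_sumr [LHS]big_mkcond; apply: eq_bigr => e _.
by rewrite !inE (eq_sym a e) [in RHS]andbC andbA.
Qed.

Lemma iprod_sq E f : iprod E (iprod E f) = 0.
Proof.
apply/ffunP => B; rewrite !ffunE big_mkcond.
transitivity (\sum_a \sum_e if [&& a \in E :\: B, e \in E :\: B & a != e]
   then sgn a B * (sgn e (a |: B) * f (e |: (a |: B))) else 0); last first.
  apply: antisym_sum => [e|a e ae]; first by rewrite eqxx !andbF.
  rewrite (eq_sym e a) ae !andbT andbC; case: ifP => [/andP[eB aB]|_]; last by rewrite oppr0.
  move: eB aB; rewrite !inE => /andP[eB _] /andP[aB _].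
  by rewrite !sgnU1 // (bsgn_swap ae) setUCA; ring.
apply: eq_bigr => a _; case: ifP => aB /=; last by rewrite big1.
rewrite ffunE mulr_sumr [LHS]big_mkcond; apply: eq_bigr => e _.
by rewrite !inE negb_or (eq_sym a e) [in RHS]andbC andbA.
Qed.

Lemma sum_setU1 E A e (h : T -> k) : e \notin A ->
  \sum_(a in (e |: A) :&: E) h a = (if e \in E then h e else 0) + \sum_(a in A :&: E) h a.
Proof.
move=> eA; rewrite (bigID (pred1 e)) /=; congr (_ + _).
  case: ifP => eE; first by rewrite (big_pred1 e) // => a; rewrite !inE; case: eqVneq => [->|]; rewrite ?eE ?andbF.
  by rewrite big1 // => a; rewrite !inE => /andP[/andP[_ aE] /eqP ae]; rewrite -ae aE in eE.
by apply: eq_bigl => a; rewrite !inE; case: eqVneq => [->|]; rewrite ?(negbTE eA) ?andbF ?andbT.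
Qed.

Lemma sum_setD1 E A e (h : T -> k) : e \in A ->
  \sum_(a in E :\: (A :\ e)) h a = (if e \in E then h e else 0) + \sum_(a in E :\: A) h a.
Proof.
move=> eA; rewrite (bigID (pred1 e)) /=; congr (_ + _).
  case: ifP => eE; first by rewrite (big_pred1 e) // => a; rewrite !inE; case: eqVneq => [->|]; rewrite ?eE ?andbF.
  by rewrite big1 // => a; rewrite !inE => /andP[/andP[_ aE] /eqP ae]; rewrite -ae aE in eE.
by apply: eq_bigl => a; rewrite !inE; case: eqVneq => [->|]; rewrite ?eA ?andbF ?andbT.
Qed.

(** The canonical anticommutation relation. Adding and removing the same element contributes [f A]
    once for each element of [E :&: G], from one summand or the other according to membership in
    [A]; mixed terms cancel by sign. *)
Lemma car E G f : iprod G (eps E f) + eps E (iprod G f) = f *+ #|E :&: G|.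
Proof.
apply/ffunP => A; rewrite ffunE !ffunE.
transitivity (\sum_(e in G :\: A) (if e \in E then f A else 0)
    + \sum_(e in A :&: E) (if e \in G then f A else 0)
    + (\sum_(e in G :\: A) \sum_(a in A :&: E) sgn e A * (sgn a (e |: A) * f (e |: A :\ a))
    + \sum_(a in A :&: E) \sum_(e in G :\: A) sgn a A * (sgn e (A :\ a) * f (e |: A :\ a)))).
  rewrite addrACA -!big_split /=; congr (_ + _); apply: eq_bigr => e.
    rewrite inE => /andP[eA _]; rewrite ffunE sum_setU1 // mulrDr mulr_sumr; congr (_ + _).
      by case: ifP => _; rewrite ?mulr0 // sgnU1_id mulrA sgnK mul1r setU1K.
    apply: eq_bigr => a /setIP[aA _]; do 2!congr (_ * _); congr (f _).
    by rewrite setDUl; congr (_ :|: _); apply/setDidPl; rewrite disjoints1 inE; apply: contraNneq eA => ->.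
  rewrite inE => /andP[eA _]; rewrite ffunE sum_setD1 // mulrDr mulr_sumr; congr (_ + _).
  by case: ifP => _; rewrite ?mulr0 // setD1K // mulrA sgnD1 // /bsgn /before ltnn mul1r sgnK mul1r.
rewrite [X in _ + (_ + X)]exchange_big -big_split /= [X in _ + X]big1 ?addr0 => [|e].
  rewrite -!big_mkcondr !sumr_const -mulrnDr [RHS]ffunMnE; congr (_ *+ _).
  rewrite -(cardsID A (E :&: G)) addnC; congr (_ + _)%N; apply: eq_card => a;
    by rewrite [LHS]unfold_in /= !inE; case: (a \in A); case: (a \in E); case: (a \in G).
move=> /setDP[_ eA]; rewrite -big_split big1 //= => a /setIP[aA _].
have ae : a != e by apply: contraNneq eA => <-.
by rewrite sgnU1 // sgnD1 // (bsgn_swap ae); ring.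
Qed.

Definition dot f g : k := \sum_A f A * g A.

Lemma dotC f g : dot f g = dot g f.
Proof. by apply: eq_bigr => A _; rewrite mulrC. Qed.

Fact dot_linear f : linear_for *%R (dot f).
Proof.
move=> c g h; rewrite /dot mulr_sumr -big_split; apply: eq_bigr => A _.
by rewrite !ffunE /GRing.scale /= mulrDr mulrCA.
Qed.

HB.instance Definition _ f := GRing.isLinear.Build k ext k *%R (dot f) (dot_linear f).

Lemma dot_eq0 f : (forall g, dot f g = 0) -> f = 0.
Proof.
move=> z; apply/ffunP => A; have := z [ffun B => (B == A)%:R]; rewrite ffunE => <-.
rewrite /dot (bigD1 A) //= ffunE eqxx mulr1 big1 ?addr0 // => B BA.
by rewrite ffunE (negbTE BA) mulr0.
Qed.

Lemma eps_adj E f g : dot (eps E f) g = dot f (iprod E g).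
Proof.
rewrite /dot; under eq_bigr => B _ do rewrite ffunE mulr_suml big_mkcond.
rewrite exchange_big; under [RHS]eq_bigr => A _ do rewrite ffunE mulr_sumr big_mkcond.
rewrite [RHS]exchange_big; apply: eq_bigr => e _.
rewrite -big_mkcond -[RHS]big_mkcond /=.
rewrite (reindex_onto (fun A => e |: A) (fun B => B :\ e)) => [|B /setIP[eB _]] /=; last exact: setD1K.
apply: eq_big => [A|A /andP[/setIP[_ eE] /eqP EA]].
  rewrite !inE eqxx /= andbC; congr (_ && _).
  by apply/eqP/idP => [<-|eA]; [rewrite !inE eqxx|rewrite setU1K].
by rewrite sgnU1_id EA; rewrite mulrCA mulrA.
Qed.

End Exterior.

(** * The flag relations on the exterior algebra and the subspace V *)

Section Model.
Variables (T : finType) (M : matroid T) (k : fieldType) (F : {set T}).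
Hypothesis Ff : F \in flats M.
Implicit Types (A B C G H K L S X Y : {set T}) (a e x : T).
Local Notation ext := (ext T k).
Local Notation gr := (ground M).
Local Notation rho := (rank M).
Local Notation E0 := (gr :\: F).
Implicit Types (f g h : ext).

Definition ind A := (A \subset E0) && (rho (A :|: F) == #|A| + rho F)%N.

(** [A] is a basis of the minor M^K_F, [ind] being independence in the contraction by [F]. *)
Definition bas K A := ind A && (clos M (A :|: F) == K).

Let Fg : F \subset gr := flat_ground Ff.

Lemma ind_sub A : ind A -> A \subset gr.
Proof. by case/andP=> /subset_trans h _; apply/h/subsetDl. Qed.

Lemma indU A : ind A -> A :|: F \subset gr.
Proof. by move/ind_sub => Ag; rewrite subUset Ag. Qed.

Lemma ind_rank A : ind A -> rho (A :|: F) = (#|A| + rho F)%N.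
Proof. by case/andP=> _ /eqP. Qed.

Lemma indS A B : ind A -> B \subset A -> ind B.
Proof.
move=> iA BA; have Ag := ind_sub iA; have Bg := subset_trans BA Ag.
have BE : B \subset E0 by case/andP: iA => /(subset_trans BA).
have BFg : B :|: F \subset gr by rewrite subUset Bg.
have Dg : A :\: B \subset gr := subset_trans (subsetDl _ _) Ag.
have h1 := rank_setU Bg Fg; have h2 := rank_card Bg; have h3 := rank_card Dg.
have h4 := rank_setU Dg BFg.
have EA : A :\: B :|: (B :|: F) = A :|: F.
  by rewrite setUA -{2}(setIidPr BA) setUC [_ :|: (A :&: B)]setUC setID setUC.
rewrite EA (ind_rank iA) in h4; have h5 := cardsID B A; rewrite (setIidPr BA) in h5.
rewrite /ind BE eqn_leq /=; move: h1 h2 h3 h4 h5; clear; lia.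
Qed.

Lemma ind0 : ind set0.
Proof. by rewrite /ind sub0set set0U cards0 eqxx. Qed.

Lemma bas_ind K A : bas K A -> ind A.
Proof. by case/andP. Qed.

Lemma bas_clos K A : bas K A -> clos M (A :|: F) = K.
Proof. by case/andP=> _ /eqP. Qed.

Lemma bas_self A : ind A -> bas (clos M (A :|: F)) A.
Proof. by move=> iA; rewrite /bas iA eqxx. Qed.

Lemma bas_flat K A : bas K A -> K \in flats M.
Proof. by move=> b; rewrite -(bas_clos b); apply/clos_flat/indU/(bas_ind b). Qed.

Lemma bas_subU K A : bas K A -> A :|: F \subset K.
Proof. by move=> b; rewrite -(bas_clos b); apply/sub_clos/indU/(bas_ind b). Qed.

Lemma bas_sub K A : bas K A -> A \subset K.
Proof. by move/bas_subU; rewrite subUset => /andP[]. Qed.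

Lemma bas_subF K A : bas K A -> F \subset K.
Proof. by move/bas_subU; rewrite subUset => /andP[]. Qed.

Lemma bas_rank K A : bas K A -> rho K = (#|A| + rho F)%N.
Proof.
by move=> b; have i := bas_ind b; rewrite -(bas_clos b) rank_clos ?indU // ind_rank.
Qed.

Lemma basP K A : ind A -> K \in flats M -> A :|: F \subset K -> rho K = (#|A| + rho F)%N -> bas K A.
Proof. by move=> iA Kf AK r; rewrite /bas iA (closE Kf AK) ?ind_rank ?eqxx. Qed.

Lemma bas_uniq K L A : bas K A -> bas L A -> K = L.
Proof. by move=> /bas_clos <- /bas_clos <-. Qed.

Lemma bas_F A : bas F A = (A == set0).
Proof.
apply/idP/eqP => [b|->].
  by have := bas_rank b => /eqP; rewrite -{1}[rho F]add0n eqn_add2r eq_sym cards_eq0 => /eqP.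
by apply: basP; rewrite ?ind0 ?set0U ?cards0.
Qed.

Lemma clos_setU1 B e : B \subset gr -> e \in clos M B -> clos M (e |: B) = clos M B.
Proof.
move=> Bg ec; have eg : e \in gr by move: ec; rewrite inE => /andP[].
apply: closE; rewrite ?clos_flat ?subUset ?sub1set ?ec ?sub_clos ?rank_clos //.
by move: ec; rewrite inE => /andP[_ /eqP].
Qed.

Lemma ind_setU1 A e : ind A -> e \in gr -> e \notin clos M (A :|: F) -> ind (e |: A).
Proof.
move=> iA eg ec; have AFg := indU iA.
have eAF : e \notin A :|: F by apply: contraNN ec => /(subsetP (sub_clos AFg)).
move: eAF; rewrite inE negb_or => /andP[eA eF].
move: ec; rewrite inE eg /= => ne.
have h : (rho (A :|: F) < rho (e |: (A :|: F)))%N.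
  by rewrite ltn_neqAle eq_sym ne rank_mono ?subsetUr // subUset sub1set eg AFg.
have h' := rank_setU1 eg AFg.
have [AE _] := andP iA; apply/andP; split; first by rewrite subUset sub1set inE eF eg.
rewrite -setUA cardsU1 eA; move: h h'; rewrite (ind_rank iA); clear; lia.
Qed.

Lemma bas_setU1 K L A e : covers M K L -> bas K A -> e \in gr -> e \notin A ->
  bas L (e |: A) = (e \in L :\: K).
Proof.
move=> c b eg eA; have iA := bas_ind b; apply/idP/idP => [b'|].
  rewrite inE (subsetP (bas_sub b')) ?setU11 // andbT; apply/negP => eK.
  have E : clos M (e |: A :|: F) = K.
    by rewrite -setUA clos_setU1 ?indU // (bas_clos b).
  by have := covers_proper c; rewrite -E (bas_clos b') properxx.
rewrite inE => /andP[eK eL].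
have ie : ind (e |: A) by apply: ind_setU1; rewrite // (bas_clos b).
apply: basP => //; first exact: covers_flatr c.
  by rewrite -setUA subUset sub1set eL (subset_trans (bas_subU b) (covers_sub c)).
by rewrite (covers_rank c) (bas_rank b) cardsU1 eA.
Qed.

Lemma bas_D1 L B e : bas L B -> e \in B ->
  covers M (clos M (B :\ e :|: F)) L /\ bas (clos M (B :\ e :|: F)) (B :\ e).
Proof.
move=> b eB; have iD := indS (bas_ind b) (subsetDl _ [set e]).
have b' := bas_self iD; split=> //; apply/coversP; split; first exact: bas_flat b'.
- exact: bas_flat b.
- apply: clos_sub; first exact: bas_flat b.
  by apply: subset_trans (bas_subU b); rewrite setSU ?subsetDl.
- by rewrite (bas_rank b) (bas_rank b') (cardsD1 e B) eB.
Qed.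

Lemma dep_clos S e : S \subset E0 -> ~~ ind S -> e \in S -> ind (S :\ e) ->
  clos M (S :\ e :|: F) = clos M (S :|: F).
Proof.
move=> SE nS eS iD; have eg : e \in gr by have := subsetP SE e eS; rewrite inE => /andP[].
have ec : e \in clos M (S :\ e :|: F).
  by apply: contraNT nS => ec; rewrite -(setD1K eS) ind_setU1.
by rewrite -[in RHS](setD1K eS) -setUA clos_setU1 ?indU.
Qed.

Definition prj K f : ext := [ffun A : {set T} => if bas K A then f A else 0].

Fact prj_linear K : linear (prj K).
Proof.
move=> c f g; apply/ffunP => A; rewrite !ffunE; case: ifP => //= _.
by rewrite scaler0 addr0.
Qed.

HB.instance Definition _ K := GRing.isLinear.Build k ext ext _ (prj K) (prj_linear K).

Lemma prj_prj K L f : prj K (prj L f) = if K == L then prj K f else 0.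
Proof.
apply/ffunP => A; rewrite ffunE; have [->|KL] := eqVneq K L; first by rewrite /= !ffunE; case: ifP => // ->.
rewrite /= !ffunE; case: ifP => // b; case: ifP => // b'.
by rewrite (bas_uniq b b') eqxx in KL.
Qed.

Lemma prj_sub K f : ~~ (F \subset K) -> prj K f = 0.
Proof.
move=> nFK; apply/ffunP => A; rewrite !ffunE; case: ifP => // b.
by rewrite (bas_subF b) in nFK.
Qed.

Lemma prj_adj K f g : dot (prj K f) g = dot f (prj K g).
Proof. by apply: eq_bigr => A _; rewrite !ffunE; case: ifP; rewrite ?mul0r ?mulr0. Qed.

Definition stdn L K f := prj L (eps E0 (prj K f)).
Definition stup K L f := prj K (iprod E0 (prj L f)).

Lemma stdn_adj L K f g : dot (stdn L K f) g = dot f (stup K L g).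
Proof. by rewrite /stdn prj_adj eps_adj prj_adj. Qed.

Lemma stup_adj L K f g : dot (stup K L f) g = dot f (stdn L K g).
Proof. by rewrite dotC -stdn_adj dotC. Qed.

Lemma stdn_eq0 L K A f : ~~ bas L A -> stdn L K f A = 0.
Proof. by move=> n; rewrite ffunE (negbTE n). Qed.

(** The sum is the component at [K] of [eps E0] applied twice: a basis of [K] minus one element is a
    basis of a flat covered by [K], so the intermediate flats exhaust all terms. *)
Lemma model_fsd L K f : rho K = (rho L).+2 ->
  \sum_(X in flats M | covers M L X && covers M X K) stdn K X (stdn X L f) = 0.
Proof.
move=> r; pose h := eps E0 (prj L f).
transitivity (prj K (eps E0 h)); last by rewrite /h eps_sq raddf0.
transitivity (prj K (eps E0 (\sum_(X in flats M | covers M L X && covers M X K) prj X h))).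
  rewrite !raddf_sum; apply: eq_bigr => X _.
  by rewrite /stdn prj_prj eqxx.
apply/ffunP => B; rewrite !ffunE; case: ifP => // b.
apply: eq_bigr => e /setIP[eB _]; congr (_ * _).
have [c bX] := bas_D1 b eB; set X := clos M _ in c bX.
rewrite sum_ffunE; have [cL|ncL] := boolP (covers M L X).
  rewrite (bigD1 X) /=; last by rewrite cL c (covers_flatr cL).
  rewrite ffunE bX big1 ?addr0 // => Y /andP[_ nY].
  by rewrite ffunE; case: ifP => // bY; rewrite (bas_uniq bX bY) eqxx in nY.
rewrite big1 => [|Y /andP[_ /andP[cY _]]]; last first.
  by rewrite ffunE; case: ifP => // bY; rewrite (bas_uniq bX bY) cY in ncL.
rewrite /h ffunE big1 // => a /setIP[aB _]; rewrite ffunE; case: ifP => [bL|_]; last by rewrite mulr0.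
have [cc bL'] := bas_D1 bX aB; by rewrite (bas_uniq bL' bL) (negbTE ncL) in cc.
Qed.

Lemma model_fsu L K f : rho K = (rho L).+2 ->
  \sum_(X in flats M | covers M L X && covers M X K) stup L X (stup X K f) = 0.
Proof.
move=> r; apply: dot_eq0 => g; rewrite dotC raddf_sum.
transitivity (dot (\sum_(X in flats M | covers M L X && covers M X K) stdn K X (stdn X L g)) f).
  rewrite dotC raddf_sum; apply: eq_bigr => X _.
  by rewrite [LHS]dotC !stup_adj.
by rewrite model_fsd // dotC raddf0.
Qed.

(** Evaluate [car E0 (L :\: K)] at a basis [A] of [K]. The elements of [L :\: K] are those extending
    [A] to a basis of [L], so one term is the left-hand side. If [K = K'], the other term vanishes
    and the scalar remains; otherwise the scalar term vanishes and the other one passes through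
    [K :&: K']. *)
Lemma model_cap K K' L f : covers M K L -> covers M K' L ->
  stup K L (stdn L K' f) = if K == K' then prj K f *+ #|L :\: K|
    else if covers M (K :&: K') K then - stdn K (K :&: K') (stup (K :&: K') K' f) else 0.
Proof.
move=> c c'; have rE : rho K = rho K'.
  by have := covers_rank c; rewrite (covers_rank c') => -[].
apply/ffunP => A; rewrite ffunE; have [b|nb] := boolP (bas K A); last first.
  case: eqP => _; first by rewrite ffunMnE ffunE (negbTE nb) mul0rn.
  by case: ifP => _; rewrite ffunE // stdn_eq0 ?oppr0.
have Lg := flat_ground (covers_flatr c).
have FK := bas_subF b; have AK := bas_sub b; have Ag := ind_sub (bas_ind b).
have LKE : L :\: K \subset E0 by rewrite setDSS.
have step1 : iprod E0 (prj L (stdn L K' f)) A = iprod (L :\: K) (eps E0 (prj K' f)) A.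
  rewrite ffunE [RHS]ffunE; apply/esym.
  rewrite [RHS](bigID (fun e => e \in L :\: K)) /= [X in _ + X]big1 ?addr0 => [|e /andP[eE nL]]; last first.
    move: eE; rewrite inE => /andP[eA eE]; rewrite ffunE.
    rewrite (bas_setU1 c b) ?(negbTE nL) ?mulr0 //.
    by move: eE; rewrite inE => /andP[].
  apply: eq_big => [e|e]; rewrite !inE.
    case: (boolP (e \in A)) => //= eA; case: (boolP (e \in K)) => //= eK; rewrite ?andbF //.
    by case: (boolP (e \in L)) => eL; rewrite ?andbF // (subsetP Lg) // (contraNN (subsetP FK e) eK).
  case/and3P=> eA eK eL; rewrite /stdn prj_prj eqxx [in RHS]ffunE (bas_setU1 c b) ?inE ?eK ?eL //.
  exact: (subsetP Lg).
rewrite step1.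
have := car E0 (L :\: K) (prj K' f) => /ffunP/(_ A); rewrite ffunE ffunMnE.
rewrite (setIidPr LKE) [prj K' f A]ffunE => /eqP; rewrite eq_sym -subr_eq => /eqP <-.
have [EK|nK] := eqVneq K K'.
  rewrite -EK b ffunMnE [prj K f A]ffunE b [eps _ _ _]ffunE big1 ?subr0 // => e /setIP[eA _].
  rewrite ffunE big1 ?mulr0 // => a; rewrite !inE => /and3P[_ aK aL].
  rewrite ffunE; case: ifP => [b'|_]; rewrite ?mulr0 //.
  by have := subsetP (bas_sub b') a (setU11 _ _); rewrite (negbTE aK).
have -> : bas K' A = false by apply: contraNF nK => b'; apply/eqP/(bas_uniq b b').
rewrite mul0rn sub0r.
pose Y := K :&: K'.
(* If exchanging [e] for [a] turns the basis [A] of [K] into one of [K'], the common part is a basis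
   of [Y] and [Y] is covered by [K]; if [Y] is not covered, no term survives. *)
have key e a : e \in A -> a \in E0 -> a \notin A :\ e -> bas K' (a |: (A :\ e)) ->
    [/\ a \in L :\: K, covers M Y K & bas Y (A :\ e)].
  move=> eA aE aA b'.
  have cA : #|a |: (A :\ e)| = #|A| by rewrite cardsU1 aA (cardsD1 e A) eA.
  have AeK : A :\ e \subset K := subset_trans (subsetDl _ _) AK.
  have AeK' : A :\ e \subset K' by apply: subset_trans (bas_sub b'); apply: subsetUr.
  have aK' : a \in K' by apply: (subsetP (bas_sub b')); apply: setU11.
  have aK : a \notin K.
    apply/negP => aK; case/eqP: nK; suff bK : bas K (a |: (A :\ e)) by apply: bas_uniq bK b'.
    apply: basP.
    - exact: bas_ind b'.
    - exact: bas_flat b.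
    - by rewrite !subUset sub1set aK AeK FK.
    - by rewrite cA (bas_rank b).
  have Yf : Y \in flats M by apply: flatI; [apply: bas_flat b|apply: bas_flat b'].
  have iD : ind (A :\ e) := indS (bas_ind b) (subsetDl _ _).
  have FY : F \subset Y by rewrite subsetI FK (bas_subF b').
  have AY : A :\ e :|: F \subset Y by rewrite subUset subsetI AeK AeK'.
  have rY : rho Y = (#|A :\ e| + rho F)%N.
    apply/eqP; rewrite eqn_leq -{2}(ind_rank iD) rank_mono ?flat_ground // andbT.
    rewrite -ltnS -addSn; have <- : #|A| = #|A :\ e|.+1 by rewrite (cardsD1 e A) eA.
    rewrite -(bas_rank b); apply: flat_ltn; rewrite ?flat_ground ?(bas_flat b) //.
    rewrite properE subsetIl subsetI subxx /=; apply: contraNN nK => KK'.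
    by apply/eqP/(flat_sub_eq (bas_flat b) (bas_flat b') KK'); rewrite rE.
  split; first by rewrite inE aK (subsetP (covers_sub c')).
    apply/coversP; split; rewrite ?subsetIl ?(bas_flat b) //.
    by rewrite rY (bas_rank b) (cardsD1 e A) eA.
  exact: basP.
have AE0 : A \subset E0 by have := bas_ind b; case/andP.
rewrite ffunE.
have inner e : e \in A -> iprod (L :\: K) (prj K' f) (A :\ e)
    = if covers M Y K && bas Y (A :\ e) then iprod E0 (prj K' f) (A :\ e) else 0.
  move=> eA; case: ifPn => [/andP[cY bY]|nY].
    rewrite ffunE [RHS]ffunE [RHS](bigID (fun a => a \in L :\: K)) /= [X in _ + X]big1 ?addr0.
      apply: eq_bigl => a; rewrite !inE; case: (boolP (a \in K)) => aK /=; rewrite ?andbF //.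
      case: (boolP (a \in L)) => aL; rewrite ?andbF // (subsetP Lg) //.
      by rewrite (contraNN (subsetP FK a) aK) !andbT.
    move=> a /andP[/setDP[aE aA] nL]; rewrite ffunE; case: ifP => [b'|_]; rewrite ?mulr0 //.
    by have [h _ _] := key e a eA aE aA b'; rewrite h in nL.
  rewrite ffunE big1 // => a /setDP[aLK aA]; rewrite ffunE; case: ifP => [b'|_]; rewrite ?mulr0 //.
  have [_ h1 h2] := key e a eA (subsetP LKE a aLK) aA b'.
  by rewrite h1 h2 in nY.
case: ifPn => cY; last first.
  rewrite ffunE big1 ?oppr0 // => e /setIP[eA _]; rewrite inner //.
  by rewrite -/Y in cY; rewrite (negbTE cY) mulr0.
rewrite ffunE ffunE b ffunE; congr (- _); apply: eq_bigr => e /setIP[eA _]; congr (_ * _).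
rewrite inner // -/Y in cY *; rewrite cY /stup prj_prj eqxx [RHS]ffunE /=.
by case: ifP.
Qed.

(* The annihilator of the Orlik-Solomon ideal of the contraction by [F]. *)
Definition inV f := forall A, ~~ ind A -> f A = 0 /\ eps E0 f A = 0.

Lemma inV_lin c f g : inV f -> inV g -> inV (c *: f + g).
Proof.
move=> fV gV A nA; have [f1 f2] := fV A nA; have [g1 g2] := gV A nA.
have E u v : (c *: u + v : ext) A = c *: u A + v A by rewrite !ffunE.
by rewrite linearP !E f1 f2 g1 g2 scaler0 addr0.
Qed.

Lemma inV0 : inV 0.
Proof. by move=> A _; rewrite raddf0 !ffunE. Qed.

Lemma inV_eps f : inV f -> inV (eps E0 f).
Proof. by move=> fV A nA; have [_ ->] := fV A nA; rewrite eps_sq ffunE. Qed.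

Lemma iprod_supp G f A : (forall B, ~~ ind B -> f B = 0) -> ~~ ind A -> iprod G f A = 0.
Proof.
move=> fI nA; rewrite ffunE big1 // => e _; rewrite fI ?mulr0 //.
by apply: contraNN nA => /indS; apply; apply: subsetUr.
Qed.

(** Contraction keeps supports among the independent sets, and [car] expresses [eps E0] of the
    contraction through [f] and the contraction of [eps E0 f]. *)
Lemma inV_iprod G f : inV f -> inV (iprod G f).
Proof.
move=> fV A nA; have fI B : ~~ ind B -> f B = 0 by move=> /fV[].
have eI B : ~~ ind B -> eps E0 f B = 0 by move=> /fV[].
split; first exact: iprod_supp.
have := car E0 G f => /eqP; rewrite addrC eq_sym -subr_eq => /eqP <-.
have E (u v : ext) : (u - v) A = u A - v A by rewrite !ffunE.
by rewrite E ffunMnE fI // mul0rn iprod_supp // subr0.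
Qed.

(** At a dependent [A], all independent sets [A :\ e] have the closure of [A]. So [prj K] keeps
    either all terms of [eps E0 f A], whose sum is 0, or none. *)
Lemma inV_prj K f : inV f -> inV (prj K f).
Proof.
move=> fV A nA; split.
  by rewrite ffunE; case: ifP => // /bas_ind iA; rewrite iA in nA.
have [AE|nAE] := boolP (A \subset E0); last first.
  rewrite ffunE big1 // => e /setIP[eA eE]; rewrite ffunE; case: ifP => [b|_]; rewrite ?mulr0 //.
  case/negP: nAE; rewrite -(setD1K eA) subUset sub1set eE.
  by have := bas_ind b; case/andP.
have [E|nE] := eqVneq (clos M (A :|: F)) K.
  have [_ <-] := fV A nA; rewrite ffunE [RHS]ffunE; apply: eq_bigr => e /setIP[eA _].
  congr (_ * _); rewrite ffunE; case: ifPn => // nb.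
  have [iD|/fV[->]//] := boolP (ind (A :\ e)).
  by case/negP: nb; rewrite /bas iD dep_clos // E eqxx.
rewrite ffunE big1 // => e /setIP[eA _]; rewrite ffunE; case: ifP => [b|_]; rewrite ?mulr0 //.
case/eqP: nE; rewrite -(dep_clos AE nA eA (bas_ind b)); exact: bas_clos.
Qed.

Lemma inV_stdn K L f : inV f -> inV (stdn K L f).
Proof. by move=> fV; apply/inV_prj/inV_eps/inV_prj. Qed.

Lemma inV_stup K L f : inV f -> inV (stup K L f).
Proof. by move=> fV; apply/inV_prj/inV_iprod/inV_prj. Qed.

Definition ext1 : ext := [ffun A => (A == set0)%:R].

Lemma inV_ext1 : inV ext1.
Proof.
move=> A nA; rewrite !ffunE; split.
  by case: eqP => // E; rewrite E ind0 in nA.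
rewrite big1 // => e /setIP[eA eE]; rewrite ffunE; case: eqP => [E|_]; last by rewrite mulr0.
case/negP: nA; rewrite -(setD1K eA) E ind_setU1 ?ind0 //.
  by move: eE; rewrite inE => /andP[].
by rewrite set0U (closE Ff) //; move: eE; rewrite inE => /andP[].
Qed.

Lemma ext1_neq0 : ext1 != 0.
Proof.
by apply/eqP => /ffunP/(_ set0); rewrite !ffunE eqxx => /eqP; rewrite oner_eq0.
Qed.

Lemma prj_sum f : inV f -> f = \sum_K prj K f.
Proof.
move=> fV; apply/ffunP => A; rewrite sum_ffunE.
have [iA|nA] := boolP (ind A); last first.
  have [-> _] := fV A nA; rewrite big1 // => K _; rewrite ffunE.
  by case: ifP => // /bas_ind iA; rewrite iA in nA.
rewrite (bigD1 (clos M (A :|: F))) //= ffunE bas_self // big1 ?addr0 // => K nK.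
by rewrite ffunE; case: ifP => // /bas_clos E; rewrite E eqxx in nK.
Qed.

(** Contraction with an element of [K] outside [F] is a homotopy that writes the component at [K]
    through components at flats covered by [K]; induction on the rank ends at [ext1]. *)
Lemma inV_generated (U : ext -> Prop) : U 0 -> (forall c, U (c *: ext1)) ->
    (forall f g, U f -> U g -> U (f + g)) ->
    (forall K H f, covers M H K -> U f -> U (stdn K H f)) ->
  forall f, inV f -> U f.
Proof.
move=> U0 U1 UD Us.
have sumU (I : Type) (r : seq I) (P : pred I) (h : I -> ext) :
    (forall i, P i -> U (h i)) -> U (\sum_(i <- r | P i) h i).
  by move=> hU; apply: big_ind.
suff UK K f : inV f -> U (prj K f).
  by move=> f fV; rewrite (prj_sum fV); apply: sumU => K _; apply: UK.
have [n] := ubnP (rho K); elim: n K f => // n IHn K f; rewrite ltnS => le fV.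
have [FK|nFK] := boolP (F \subset K); last by rewrite prj_sub.
have [Kf|nKf] := boolP (K \in flats M); last first.
  suff -> : prj K f = 0 by [].
  by apply/ffunP => A; rewrite !ffunE; case: ifP => // /bas_flat h; rewrite h in nKf.
have [<-|nK] := eqVneq F K.
  suff -> : prj F f = f set0 *: ext1 by [].
  apply/ffunP => A; rewrite !ffunE bas_F; case: eqP => [->|_]; last by rewrite scaler0.
  by rewrite /GRing.scale /= mulr1.
have /properP[_ [e eK eF]] : F \proper K by rewrite properEneq nK.
have Kg := flat_ground Kf; have eg := subsetP Kg e eK.
have eE : e \in E0 by rewrite inE eF.
pose g := iprod [set e] f; have gV : inV g by apply: inV_iprod.
(* The other term of [car] reads [eps E0 f] at [e |: A] for a basis [A] of [K] without [e]. As [e]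
   lies in [K] this set is dependent, and V forces the value 0. *)
have -> : prj K f = prj K (eps E0 g).
  have := car E0 [set e] f; rewrite (setIidPr _) ?sub1set // cards1 mulr1n => {1}<-.
  rewrite linearD /= -[RHS]add0r; congr (_ + _); apply/ffunP => A; rewrite [RHS]ffunE ffunE.
  case: ifP => // b; rewrite ffunE big1 // => a /setDP[/set1P -> eA].
  have [|_ ->] := fV (e |: A); last by rewrite mulr0.
  apply/negP => ie; have := bas_clos b; have iA := bas_ind b.
  have ec : e \in clos M (A :|: F) by rewrite (bas_clos b).
  have := rank_clos (indU ie); rewrite -setUA clos_setU1 ?indU // rank_clos ?indU //.
  rewrite setUA ind_rank // ind_rank // cardsU1 eA; clear; lia.
have -> : prj K (eps E0 g) = \sum_(H | covers M H K) stdn K H (prj H g).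
  rewrite /stdn; under eq_bigr => H _ do rewrite prj_prj eqxx.
  rewrite -!raddf_sum; apply/ffunP => B; rewrite !ffunE; case: ifP => // b.
  apply: eq_bigr => a /setIP[aB _]; congr (_ * _).
  have [c bH] := bas_D1 b aB; rewrite sum_ffunE (bigD1 (clos M (B :\ a :|: F))) //= [prj _ _ _]ffunE bH.
  rewrite big1 ?addr0 // => H /andP[_ nH]; rewrite ffunE; case: ifP => // bH'.
  by rewrite (bas_uniq bH' bH) eqxx in nH.
apply: sumU => H c; apply: Us => //; apply: IHn => //.
by rewrite -(covers_rank c).
Qed.

End Model.

(** * Degeneracy of the form *)

Section Riesz.
Variables (k : fieldType) (X : vectType k) (W : {vspace X}) (B : X -> X -> k).
Hypothesis Bl : forall v c x y, B v (c *: x + y) = c * B v x + B v y.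
Hypothesis Br : forall v c x y, B (c *: x + y) v = c * B x v + B y v.
Hypothesis nondeg : forall x, x \in W -> (forall y, y \in W -> B y x = 0) -> x = 0.

(** Pairing with a basis of [W] embeds [W] into row vectors of length [\dim W], by nondegeneracy;
    equal dimensions make it onto. *)
Lemma riesz (g : X -> k) : (forall c x y, g (c *: x + y) = c * g x + g y) ->
  exists2 z, z \in W & forall v, v \in W -> B v z = g v.
Proof.
move=> gl; pose n := \dim W; pose b := vbasis W.
have lin0 (h : X -> k) : (forall c x y, h (c *: x + y) = c * h x + h y) -> h 0 = 0.
  by move=> hl; have := hl (-1) 0 0; rewrite scaler0 addr0 mulN1r addNr.
have lsum (h : X -> k) : (forall c x y, h (c *: x + y) = c * h x + h y) ->
    forall c : 'I_n -> k, h (\sum_i c i *: b`_i) = \sum_i c i * h b`_i.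
  move=> hl c; apply: (big_ind2 (fun x y => h x = y)) => [|x x' y y' <- <-|i _].
  - exact: lin0.
  - by have := hl 1 x y; rewrite scale1r mul1r.
  - by rewrite -[c i *: _]addr0 hl lin0 ?addr0.
have ext (h1 h2 : X -> k) : (forall c x y, h1 (c *: x + y) = c * h1 x + h1 y) ->
    (forall c x y, h2 (c *: x + y) = c * h2 x + h2 y) ->
    (forall i, h1 b`_i = h2 b`_i) -> forall v, v \in W -> h1 v = h2 v.
  move=> l1 l2 e v vW; rewrite (coord_vbasis vW).
  rewrite !lsum //; apply: eq_bigr => i _; by rewrite e.
pose th (z : X) : 'rV[k]_n := \row_i B b`_i z.
have thl : linear th by move=> c x y; apply/rowP => i; rewrite !mxE Bl.
pose thL := GRing.isLinear.Build k X 'rV[k]_n *:%R th thl.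
pose TH : {linear X -> 'rV[k]_n} := HB.pack th thL.
have inj : (W :&: lker (linfun TH) = 0)%VS.
  apply/eqP; rewrite -subv0; apply/subvP => x; rewrite memv_cap memv_ker lfunE memv0 => /andP[xW /eqP e].
  apply/eqP/nondeg => // y; apply: (ext (fun y => B y x) (fun=> 0)) => [c u v|c u v|i].
  - exact: Br.
  - by rewrite mulr0 addr0.
  have [lt|ge] := ltnP i n.
    by have /rowP/(_ (Ordinal lt)) := e; rewrite !mxE.
  by rewrite nth_default ?size_tuple // (lin0 (fun y => B y x)).
have full : (linfun TH @: W)%VS = fullv.
  apply/eqP; rewrite eqEdim subvf /= limg_dim_eq // dimvf /dim /= mul1n //.
have : \row_i g b`_i \in (linfun TH @: W)%VS by rewrite full memvf.
case/memv_imgP => z zW; rewrite lfunE => e; exists z => // v.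
apply: (ext (fun v => B v z) g) => // i.
have [lt|ge] := ltnP i n; first by have /rowP/(_ (Ordinal lt)) := e; rewrite !mxE.
by rewrite nth_default ?size_tuple // lin0 // (lin0 (fun y => B y z)).
Qed.

End Riesz.

(** * Graded complexes with two anticommuting exact differentials *)

Section Graded.
Variables (k : fieldType) (X : vectType k) (D : 'End(X)) (V : nat -> {vspace X}).
Hypothesis DV : forall j x, x \in V j -> D x \in V j.+1.
Hypothesis DD : forall j x, x \in V j -> D (D x) = 0.
Hypothesis exD : forall j x, x \in V j.+1 -> D x = 0 -> exists2 y, y \in V j & x = D y.
Hypothesis exD0 : forall x, x \in V 0 -> D x = 0 -> x = 0.

Let n j := \dim (D @: V j).

Lemma graded_dim0 : \dim (V 0) = n 0.
Proof.
rewrite -(limg_ker_dim D); suff -> : (V 0 :&: lker D = 0)%VS by rewrite dimv0.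
apply/eqP; rewrite -subv0; apply/subvP => x.
by rewrite memv_cap memv_ker memv0 => /andP[xV /eqP /(exD0 xV) ->].
Qed.

Lemma graded_dimS j : \dim (V j.+1) = (n j + n j.+1)%N.
Proof.
rewrite -(limg_ker_dim D); congr (\dim _ + _)%N; apply/vspaceP => x.
rewrite memv_cap memv_ker; apply/andP/memv_imgP => [[xV /eqP z]|[y yV ->]].
  by have [y yV e] := exD xV z; exists y.
by rewrite (DD yV) DV.
Qed.

Lemma graded_euler m : \sum_(j < m.+1) (-1) ^+ j * (\dim (V j))%:R = (-1) ^+ m * (n m)%:R :> int.
Proof.
elim: m => [|m IHm]; first by rewrite big_ord1 graded_dim0.
by rewrite big_ord_recr /= IHm graded_dimS natrD exprS; ring.
Qed.

Lemma graded_euler0 m : V m.+1 = 0%VS -> \sum_(j < m.+1) (-1) ^+ j * (\dim (V j))%:R = 0 :> int.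
Proof.
move=> V0; rewrite graded_euler; suff -> : n m = 0%N by rewrite mulr0.
have := graded_dimS m; rewrite V0 dimv0; lia.
Qed.

Variable U : 'End(X).
Hypothesis UV : forall j x, x \in V j.+1 -> U x \in V j.
Hypothesis U0 : forall x, x \in V 0 -> U x = 0.
Hypothesis UU : forall j x, x \in V j -> U (U x) = 0.
Hypothesis UD : forall j x, x \in V j -> U (D x) = - D (U x).
Hypothesis exU : forall j x, x \in V j -> U x = 0 -> exists2 y, y \in V j.+1 & x = U y.
Variable r : nat.
Hypothesis Vr : forall j, (r < j)%N -> V j = 0%VS.

(** Downward induction on the degree. Write [x = U y]; then [D y] is again in both kernels, two
    degrees higher, so it is [U (D z)]. Hence [D] kills [y + U z], which is some [D t], and
    [x = U (D t)]. *)
Lemma ker_both j x : x \in V j -> D x = 0 -> U x = 0 -> exists2 t, t \in V j & x = U (D t).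
Proof.
have [m] := ubnP (r.+1 - j); elim: m j x => // m IHm j x le xV Dx Ux.
have [lt|ge] := ltnP r j.
  by exists 0; rewrite ?mem0v // !linear0; apply/eqP; rewrite -memv0 -(Vr lt).
have [y yV xE] := exU xV Ux.
have DyV := DV yV.
have UDy : U (D y) = 0 by rewrite (UD yV) -xE Dx oppr0.
have [|z zV e] := IHm j.+2 (D y) _ DyV (DD yV) UDy; first by lia.
have Dz : D (y + U z) = 0 by rewrite linearD /= e (UD zV) addNr.
have [t tV e'] := exD (rpredD yV (UV zV)) Dz.
by exists t => //; rewrite -e' linearD /= (UU zV) addr0.
Qed.

Let q j := \dim (U @: (D @: V j)).

Lemma graded_q j : n j = (q j + q j.+1)%N.
Proof.
rewrite /n -(limg_ker_dim U) addnC; congr (_ + \dim _)%N; apply/vspaceP => x.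
rewrite memv_cap memv_ker; apply/andP/memv_imgP => [[/memv_imgP[y yV ->] /eqP z]|[y /memv_imgP[t tV ->] ->]].
  have [t tV e] := ker_both (DV yV) (DD yV) z.
  by exists (D t) => //; apply: memv_img.
have Ut := UV tV; rewrite (UU (DV tV)); split=> //.
by rewrite (UD tV) rpredN memv_img.
Qed.

(** In positive degrees the dimensions are q_(j-1) + 2 q_j + q_(j+1), and q_0 = 0: this is
    divisibility of the Poincare polynomial by (1 + t)^2. The sum is minus its derivative at -1; [E]
    is the closed form of the partial sums. *)
Lemma graded_weighted : \sum_(j < r.+1) (-1) ^+ j * (j%:R * (\dim (V j))%:R) = 0 :> int.
Proof.
have q0 : q 0 = 0%N.
  apply/eqP; rewrite dimv_eq0 -subv0; apply/subvP => x /memv_imgP[y /memv_imgP[t tV ->] ->].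
  by rewrite (UD tV) U0 // linear0 oppr0 mem0v.
have E m : \sum_(j < m.+1) (-1) ^+ j * (j%:R * (\dim (V j))%:R)
    = (-1) ^+ m * (m%:R * (n m)%:R + (q m)%:R) :> int.
  elim: m => [|m IHm]; first by rewrite big_ord1 q0 !mul0r addr0.
  rewrite big_ord_recr /= IHm graded_dimS natrD exprS (graded_q m) !natrD.
  by rewrite -[m.+1%:R]/(m.+1%:R) -addn1 !natrD; ring.
rewrite E; have := graded_dimS r; have := graded_q r; rewrite (Vr (ltnSn r)) dimv0.
move=> h1 h2; have -> : n r = 0%N by lia.
have -> : q r = 0%N by lia.
by rewrite mulr0 addr0 mulr0.
Qed.

End Graded.

(** * Dimensions on an interval of flats and the beta invariant *)

Section Degenerate.
Variables (T : finType) (M : matroid T) (k : fieldType) (F : {set T}).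
Hypothesis Ff : F \in flats M.
Implicit Types (A B C G H K L S X Y : {set T}) (a e : T).
Local Notation ext := (ext T k).
Local Notation gr := (ground M).
Local Notation rho := (rank M).
Local Notation E0 := (gr :\: F).
Local Notation ind := (ind M F).
Local Notation bas := (bas M F).
Local Notation inV := (inV M F).
Local Notation prj := (@prj T M k F).
Implicit Types (f g h : ext) (P : pred {set T}).

Let Fg : F \subset gr := flat_ground Ff.

Definition restr P f : ext := [ffun A : {set T} => if P A then f A else 0].

Fact restr_linear P : linear (restr P).
Proof.
move=> c f g; apply/ffunP => A; rewrite !ffunE; case: ifP => //= _.
by rewrite scaler0 addr0.
Qed.

HB.instance Definition _ P := GRing.isLinear.Build k ext ext _ (restr P) (restr_linear P).

Lemma restr_eq0 P f : reflect (forall A, P A -> f A = 0) (restr P f == 0).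
Proof.
apply: (iffP eqP) => [/ffunP e A PA|z]; first by have := e A; rewrite !ffunE PA.
by apply/ffunP => A; rewrite !ffunE; case: ifP => // /z.
Qed.

Lemma restr_id P f : (forall A, ~~ P A -> f A = 0) -> restr P f = f.
Proof. by move=> z; apply/ffunP => A; rewrite ffunE; case: ifPn => // /z. Qed.

Definition subV P : {vspace ext} :=
  (lker (linfun (restr (predC ind))) :&:
   lker (linfun (restr (predC ind) \o eps E0)) :&: lker (linfun (restr (predC P))))%VS.

Lemma subVP P f : reflect (inV f /\ forall A, ~~ P A -> f A = 0) (f \in subV P).
Proof.
rewrite !memv_cap !memv_ker !lfunE /=.
apply: (iffP andP) => [[/andP[/restr_eq0 h1 /restr_eq0 h2] /restr_eq0 h3]|[h1 h2]].
  by split=> // A nA; split; [apply: h1|apply: h2].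
split; last exact/restr_eq0.
by apply/andP; split; apply/restr_eq0 => A /h1[].
Qed.

Lemma inV_sum (I : Type) (r : seq I) (Q : pred I) (h : I -> ext) :
  (forall i, Q i -> inV (h i)) -> inV (\sum_(i <- r | Q i) h i).
Proof.
move=> hV; apply: big_ind => //; first exact: inV0.
by move=> f g fV gV; rewrite -[f]scale1r; apply: inV_lin.
Qed.

(** When [P] depends only on the closure, the restriction is a sum of projections [prj K], each of
    which preserves V. *)
Lemma inV_restr P (Q : pred {set T}) f : (forall A, ind A -> P A = Q (clos M (A :|: F))) ->
  inV f -> inV (restr P f).
Proof.
move=> PQ fV; suff -> : restr P f = \sum_(K | Q K) prj K f.
  by apply: inV_sum => K _; apply: inV_prj.
apply/ffunP => A; rewrite ffunE sum_ffunE.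
have [iA|nA] := boolP (ind A); last first.
  have [-> _] := fV A nA; rewrite if_same big1 // => K _; rewrite ffunE.
  by case: ifP => // /bas_ind iA; rewrite iA in nA.
rewrite PQ //; case: ifPn => [QA|nQ].
  rewrite (bigD1 (clos M (A :|: F))) //= ffunE bas_self // big1 ?addr0 // => K /andP[_ nK].
  by rewrite ffunE; case: ifP => // /bas_clos E; rewrite E eqxx in nK.
rewrite big1 // => K QK; rewrite ffunE; case: ifP => // /bas_clos E.
by rewrite E QK in nQ.
Qed.

Lemma ind_subG G A : G \in flats M -> F \subset G -> ind A -> (A \subset G) = (clos M (A :|: F) \subset G).
Proof.
move=> Gf FG iA; apply/idP/idP => [AG|]; first by rewrite clos_sub // subUset AG.
by apply: subset_trans; apply: subset_trans (sub_clos (indU Ff iA)); apply: subsetUl.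
Qed.

Lemma ind_cardG j A : ind A -> (#|A| == j) = (rho (clos M (A :|: F)) == j + rho F)%N.
Proof. by move=> iA; rewrite rank_clos ?indU // (ind_rank iA) eqn_add2r. Qed.

Section Interval.
Variable G : {set T}.
Hypotheses (Gf : G \in flats M) (FG : F \subset G).
Local Notation E := (G :\: F).

Let Gg : G \subset gr := flat_ground Gf.

(** The degree [j] part of the space V of the minor M^G_F, cut out of the big V by supports. *)
Definition Yg j := subV (fun A => (A \subset G) && (#|A| == j)).

Lemma YgP j f : reflect (inV f /\ forall A, f A != 0 -> A \subset G /\ #|A| = j) (f \in Yg j).
Proof.
apply: (iffP (subVP _ _)) => -[fV h]; split=> // A.
  move=> nz; have : (A \subset G) && (#|A| == j) by apply: contraNT nz => /h ->.
  by case/andP=> ? /eqP.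
by move=> n; apply/eqP; apply: contraNT n => /h[-> ->]; rewrite eqxx.
Qed.

Lemma Yg_G j f A : f \in Yg j -> ~~ (A \subset G) -> f A = 0.
Proof. by case/YgP=> _ h; apply: contraNeq => /h[]. Qed.

Lemma Yg_card j f A : f \in Yg j -> #|A| != j -> f A = 0.
Proof. by case/YgP=> _ h; apply: contraNeq => /h[_ ->]. Qed.

Lemma epsE f : (forall A, ~~ (A \subset G) -> f A = 0) -> eps E f = restr (fun A => A \subset G) (eps E0 f).
Proof.
move=> fG; apply/ffunP => A; rewrite ffunE [RHS]ffunE; case: ifPn => [AG|nAG].
  rewrite ffunE; apply: eq_bigl => e; rewrite !inE; case: (boolP (e \in A)) => //= eA.
  by rewrite (subsetP AG) // (subsetP Gg) // (subsetP AG).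
rewrite big1 // => e /setIP[eA /setDP[eG _]]; rewrite fG ?mulr0 //.
by apply: contraNN nAG => h; rewrite -(setD1K eA) subUset sub1set eG.
Qed.

Lemma Yg_eps j f : f \in Yg j -> eps E f \in Yg j.+1.
Proof.
move=> fY; have /YgP[fV _] := fY; apply/YgP; split.
  rewrite epsE => [|A]; last exact: Yg_G fY.
  apply: (@inV_restr _ (fun K => K \subset G)); last exact: inV_eps.
  by move=> A iA; apply: ind_subG.
move=> A; rewrite ffunE => n; have [e /setIP[eA /setDP[eG _]] nz] : exists2 e, e \in A :&: E & f (A :\ e) != 0.
  apply/exists_inP; apply: contraNT n => /exists_inPn z; rewrite big1 // => e eA.
  by have /negPn/eqP -> := z e eA; rewrite mulr0.
split; first by apply: contraNT nz => nA; apply/eqP/(Yg_G fY); apply: contraNN nA => h; rewrite -(setD1K eA) subUset sub1set eG.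
rewrite (cardsD1 e) eA; congr _.+1; apply/eqP; apply: contraNT nz => c.
by rewrite (Yg_card fY).
Qed.

Lemma Yg_iprod C j f : f \in Yg j.+1 -> iprod C f \in Yg j.
Proof.
move=> fY; have /YgP[fV _] := fY; apply/YgP; split; first exact: inV_iprod.
move=> A; rewrite ffunE => n; have [e /setDP[eC eA] nz] : exists2 e, e \in C :\: A & f (e |: A) != 0.
  apply/exists_inP; apply: contraNT n => /exists_inPn z; rewrite big1 // => e eA.
  by have /negPn/eqP -> := z e eA; rewrite mulr0.
split.
  apply: contraNT nz => nA; apply/eqP/(Yg_G fY); apply: contraNN nA.
  by apply: subset_trans; apply: subsetUr.
apply/eqP; apply: contraNT nz => c; apply/eqP/(Yg_card fY).
by rewrite cardsU1 eA.
Qed.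

Lemma Yg_iprod0 C f : f \in Yg 0%N -> iprod C f = 0.
Proof.
move=> fY; apply/ffunP => A; rewrite !ffunE big1 // => e _; rewrite (Yg_card fY) ?mulr0 //.
by rewrite cards_eq0; apply/set0Pn; exists e; apply: setU11.
Qed.

Lemma Yg_high j : (rho G - rho F < j)%N -> Yg j = 0%VS.
Proof.
move=> lt; apply/eqP; rewrite -subv0; apply/subvP => f fY; rewrite memv0.
apply/eqP/ffunP => A; rewrite ffunE; have /YgP[fV h] := fY.
apply/eqP; apply: contraLR lt => nz; have [AG cA] := h A nz.
have iA : ind A by apply: contraNT nz => /fV[-> _].
have := ind_rank iA; have : (rho (A :|: F) <= rho G)%N by rewrite rank_mono // subUset AG.
by rewrite cA -leqNgt; clear; lia.
Qed.

Definition flG K := [&& K \in flats M, F \subset K & K \subset G].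

Definition Vb K := subV (bas K).

Lemma prj_restr K f : prj K f = restr (bas K) f. Proof. by []. Qed.

Lemma bas_flG K A : bas K A -> A \subset G -> flG K.
Proof.
move=> b AG; rewrite /flG (bas_flat Ff b) (bas_subF Ff b) /=.
by rewrite -(bas_clos b) -(ind_subG Gf FG (bas_ind b)).
Qed.

Lemma Vb_direct (Q : pred {set T}) : directv (\sum_(K | Q K) Vb K).
Proof.
apply/directv_sum_independent => us usV s0 K QK.
have uK : us K = prj K (us K).
  by rewrite prj_restr restr_id //; case/subVP: (usV K QK).
rewrite uK; transitivity (prj K (\sum_(L | Q L) us L)); last by rewrite s0 raddf0.
rewrite raddf_sum (bigD1 K) //= big1 ?addr0 // => L /andP[QL nL].
have -> : us L = prj L (us L) by rewrite prj_restr restr_id //; case/subVP: (usV L QL).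
by rewrite prj_prj eq_sym (negbTE nL).
Qed.

Lemma Yg_dim j : \dim (Yg j) = (\sum_(K | flG K && (rho K == j + rho F)) \dim (Vb K))%N.
Proof.
have := directvP (Vb_direct (fun K => flG K && (rho K == j + rho F)%N)) => /= <-.
congr (\dim _); apply/eqP; rewrite eqEsubv; apply/andP; split; last first.
  apply/subv_sumP => K /andP[/and3P[Kf FK KG] /eqP rK]; apply/subvP => f /subVP[fV h].
  apply/YgP; split=> // A nz; have b : bas K A by apply: contraNT nz => /h ->.
  split; first exact: subset_trans (bas_sub Ff b) KG.
  by apply/eqP; rewrite -(eqn_add2r (rho F)) -(bas_rank Ff b) rK.
apply/subvP => f fY; have /YgP[fV h] := fY.
rewrite (prj_sum fV) (bigID (fun K => flG K && (rho K == j + rho F)%N)) /=.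
rewrite [X in _ + X]big1 ?addr0 => [|K nK]; last first.
  apply/ffunP => A; rewrite !ffunE; case: ifP => // b; apply/eqP; apply: contraNT nK => nz.
  have [AG cA] := h A nz; rewrite (bas_flG b AG) /= (bas_rank Ff b) cA //.
apply: memv_sumr => K _; apply/subVP; split; first exact: inV_prj.
by move=> A nA; rewrite ffunE (negbTE nA).
Qed.

Lemma flG_rank K : flG K -> (rho F <= rho K)%N && (rho K <= rho G)%N.
Proof. by case/and3P=> Kf FK KG; rewrite !rank_mono ?flat_ground. Qed.

Lemma Yg_sum (w : nat -> int) :
  \sum_(j < (rho G - rho F).+1) w j * (\dim (Yg j))%:R
    = \sum_(K | flG K) w (rho K - rho F)%N * (\dim (Vb K))%:R.
Proof.
have lt K : flG K -> (rho K - rho F < (rho G - rho F).+1)%N.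
  by move/flG_rank/andP => [h1 h2]; rewrite ltnS leq_sub2r.
rewrite [RHS](partition_big (fun K => inord (rho K - rho F) : 'I_(rho G - rho F).+1) predT) //=.
apply: eq_bigr => j _; rewrite Yg_dim natr_sum mulr_sumr; apply: eq_big => K.
  case fK: (flG K) => //=; rewrite -val_eqE /= inordK ?lt //.
  by have /andP[h _] := flG_rank fK; apply/eqP/eqP => [->|<-]; rewrite ?addnK ?subnK.
by case/andP=> _ /eqP ->; rewrite addnK.
Qed.

Section Homotopy.
Variable e : T.
Hypothesis eE : e \in E.

Lemma homotopy f : iprod [set e] (eps E f) + eps E (iprod [set e] f) = f.
Proof. by rewrite car (setIidPr _) ?sub1set // cards1. Qed.

Lemma Yg_exact j f : f \in Yg j.+1 -> eps E f = 0 -> exists2 g, g \in Yg j & f = eps E g.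
Proof.
move=> fY z; exists (iprod [set e] f); first exact: Yg_iprod.
by rewrite -{1}[f]homotopy z raddf0 add0r.
Qed.

Lemma Yg_exact0 f : f \in Yg 0%N -> eps E f = 0 -> f = 0.
Proof. by move=> fY z; rewrite -[f]homotopy z (Yg_iprod0 _ fY) !raddf0 addr0. Qed.

Hypothesis nondeg : forall f, inV f -> (forall g, inV g -> dot f g = 0) -> f = 0.

Lemma dot_restr P f g : dot (restr P f) g = dot f (restr P g).
Proof. by apply: eq_bigr => A _; rewrite !ffunE; case: ifP; rewrite ?mul0r ?mulr0. Qed.

Lemma inV_restrG f : inV f -> inV (restr (fun A => A \subset G) f).
Proof. by apply: (@inV_restr _ (fun K => K \subset G)) => A iA; apply: ind_subG. Qed.

Lemma inV_restrj j f : inV f -> inV (restr (fun A => #|A| == j) f).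
Proof.
by apply: (@inV_restr _ (fun K => rho K == j + rho F)%N) => A iA; apply: ind_cardG.
Qed.

(* [iprod E] is adjoint to [eps E], so a contracting homotopy of [eps E] transposes
   to one of [iprod E] as soon as the form is nondegenerate. *)
Lemma Yg_exactU j f : f \in Yg j -> iprod E f = 0 -> exists2 g, g \in Yg j.+1 & f = iprod E g.
Proof.
move=> fY z; pose W := subV (fun A => A \subset G).
have dl (v : ext) (c : k) (x y : ext) : dot v (c *: x + y) = c * dot v x + dot v y by rewrite linearP.
have dr (v : ext) (c : k) (x y : ext) : dot (c *: x + y) v = c * dot x v + dot y v.
  by rewrite !(dotC _ v) linearP.
have nd (x : ext) : x \in W -> (forall y, y \in W -> dot y x = 0) -> x = 0.
  case/subVP=> xV xG h; apply: nondeg => // g gV.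
  rewrite -[x](restr_id xG) dot_restr dotC; apply: h; apply/subVP; split; first exact: inV_restrG.
  by move=> A nA; rewrite ffunE (negbTE nA).
(* This functional is the pairing with e_e /\ f, a vector that may leave V; [riesz] replaces it by a
   vector [w] with the same pairings inside V. *)
have gl (c : k) (x y : ext) : dot (iprod [set e] (c *: x + y)) f
    = c * dot (iprod [set e] x) f + dot (iprod [set e] y) f.
  by rewrite linearP dr.
have [w /subVP[wV wG] wE] := riesz dl dr nd gl.
have YW i (x : ext) : x \in Yg i -> x \in W.
  by move=> xY; apply/subVP; split; [case/YgP: xY|move=> A; apply: Yg_G xY].
have card_restr i (x : ext) : x \in W -> restr (fun A => #|A| == i) x \in Yg i.
  case/subVP=> xV xG; apply/YgP; split; first exact: inV_restrj.
  move=> A; rewrite ffunE; case: ifP => [/eqP -> nz|_]; last by rewrite eqxx.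
  by split=> //; apply: contraNT nz => /xG ->.
have Yid i (x : ext) : x \in Yg i -> restr (fun A => #|A| == i) x = x.
  by move=> xY; apply: restr_id => A; apply: Yg_card xY.
have wW : w \in W by apply/subVP.
pose w' := restr (fun A => #|A| == j.+1) w; have w'Y := card_restr j.+1 w wW.
exists w' => //; apply/eqP; rewrite -subr_eq0; apply/eqP/nd.
  by rewrite rpredB // (@YW j) // Yg_iprod.
move=> v vW; pose v' := restr (fun A => #|A| == j) v; have v'Y := card_restr j v vW.
have dY (x : ext) : x \in Yg j -> dot v x = dot v' x by move=> xY; rewrite dot_restr Yid.
rewrite linearB /= !dY // ?Yg_iprod // -eps_adj.
have Dv' := Yg_eps v'Y.
have -> : dot (eps E v') w' = dot (eps E v') w by rewrite -dot_restr Yid.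
rewrite wE ?(YW _ _ Dv') //.
have := homotopy v' => /eqP; rewrite eq_sym -subr_eq => /eqP <-.
by rewrite !(dotC _ f) linearB /= [X in _ - (_ - X)]dotC eps_adj z linear0 subr0 subrr.
Qed.

Hypothesis card0 : (#|E|%:R : k) = 0.

Lemma Yg_weighted : \sum_(j < (rho G - rho F).+1) (-1) ^+ j * (j%:R * (\dim (Yg j))%:R) = 0 :> int.
Proof.
pose D := linfun (eps (k := k) E); pose U := linfun (iprod (k := k) E).
apply: (@graded_weighted k _ D Yg _ _ _ U) => [j x|j x _|j x|j x|x|j x _|j x _|j x|j];
  rewrite ?lfunE /=.
- exact: Yg_eps.
- exact: eps_sq.
- by move=> xY /(Yg_exact xY)[y yY ->]; exists y; rewrite ?lfunE.
- exact: Yg_iprod.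
- exact: Yg_iprod0.
- exact: iprod_sq.
- apply/eqP; rewrite -addr_eq0 car setIid -scaler_nat.
  by rewrite card0 scale0r.
- by move=> xY /(Yg_exactU xY)[y yY ->]; exists y; rewrite ?lfunE.
- exact: Yg_high.
Qed.

End Homotopy.
End Interval.

Lemma Vb_F : \dim (Vb F) = 1%N.
Proof.
suff -> : Vb F = <[ext1 T k]>%VS by rewrite dim_vline ext1_neq0.
apply/eqP; rewrite eqEsubv; apply/andP; split; last first.
  rewrite -memvE; apply/subVP; split; first exact: inV_ext1.
  by move=> A; rewrite bas_F // ffunE => /negbTE ->.
apply/subvP => f /subVP[fV h]; apply/vlineP; exists (f set0); apply/ffunP => A.
rewrite !ffunE; case: eqP => [->|/eqP nA]; first by rewrite /GRing.scale /= mulr1.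
by rewrite h ?bas_F // scaler0.
Qed.

(** Turns out to be the Moebius function of the interval from [F] to [K]. *)
Let s K : int := (-1) ^+ (rho K - rho F) * (\dim (Vb K))%:R.

Lemma sum_dims G : G \in flats M -> F \subset G -> \sum_(K | flG G K) s K = (G == F)%:R.
Proof.
move=> Gf FG; rewrite /s -(Yg_sum Gf FG (fun j => (-1) ^+ j)).
have [->|nG] := eqVneq G F.
  rewrite subnn big_ord1 expr0 mul1r (Yg_dim Ff (subxx F)) (big_pred1 F) ?Vb_F // => K.
  rewrite /flG; apply/idP/eqP => [|->]; last by rewrite Ff subxx add0n eqxx.
  by case/andP=> /and3P[_ h1 h2] _; apply/eqP; rewrite eqEsubset h1 h2.
have /properP[_ [e eG eF]] : F \proper G by rewrite properEneq eq_sym nG.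
have eE : e \in G :\: F by rewrite inE eF.
apply: (@graded_euler0 k _ (linfun (eps (k := k) (G :\: F))) (Yg G)) => [j x|j x _|j x|x|];
  rewrite ?lfunE /=.
- exact: Yg_eps.
- exact: eps_sq.
- by move=> xY /(Yg_exact eE xY)[y yY ->]; exists y; rewrite ?lfunE.
- by move=> xY xz; apply: (Yg_exact0 eE xY xz).
- exact/Yg_high/ltnSn.
Qed.

(** The alternating sum over spanning subsets, a classical expression of the same Moebius
    function. *)
Let y K : int := \sum_(A in powerset (K :\: F) | clos M (A :|: F) == K) (-1) ^+ #|A|.

Lemma sum_weighted_y G (w : {set T} -> int) : G \in flats M -> F \subset G ->
  \sum_(A in powerset (G :\: F)) (-1) ^+ #|A| * w (clos M (A :|: F)) = \sum_(K | flG G K) y K * w K.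
Proof.
move=> Gf FG; have Gg := flat_ground Gf.
rewrite (partition_big (fun A => clos M (A :|: F)) (flG G)) /= => [|A].
  apply: eq_bigr => K /and3P[Kf FK KG]; rewrite mulr_suml; apply: eq_big => A.
    rewrite !powersetE; case: eqP => E; rewrite ?andbF // !andbT -E.
    apply/idP/idP => [AG|h]; last by apply: subset_trans h _; rewrite setSD // E.
    have Ag : A :|: F \subset gr by rewrite subUset Fg andbT (subset_trans AG) // (subset_trans (subsetDl _ _)).
    rewrite subsetD (subset_trans _ (sub_clos Ag)) ?subsetUl //=.
    by move: AG; rewrite subsetD => /andP[].
  by case/andP=> _ /eqP ->.
rewrite powersetE subsetD => /andP[AG _].
have AFG : A :|: F \subset G by rewrite subUset AG.
have AFg := subset_trans AFG Gg.
by rewrite /flG clos_flat // clos_sub // (subset_trans (subsetUr A F)) // sub_clos.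
Qed.

Lemma sum_y G : G \in flats M -> F \subset G -> \sum_(K | flG G K) y K = (G == F)%:R.
Proof.
move=> Gf FG; have := sum_weighted_y (fun=> 1) Gf FG.
under eq_bigr do rewrite mulr1; under [RHS]eq_bigr do rewrite mulr1; move=> <-.
have [->|nG] := eqVneq G F; first by rewrite setDv powerset0 big_set1 cards0.
rewrite sum_powerset_sign // setD_eq0; apply: contraNN nG => GF.
by rewrite eqEsubset GF.
Qed.

(** Both sum to 1 on the trivial interval and to 0 on all others, which determines them
    recursively. *)
Lemma s_eq_y G : G \in flats M -> F \subset G -> s G = y G.
Proof.
have [n] := ubnP #|G|; elim: n G => // n IHn G; rewrite ltnS => le Gf FG.
have GG : flG G G by rewrite /flG Gf FG subxx.
have h1 := sum_dims Gf FG; have h2 := sum_y Gf FG.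
rewrite (bigD1 G) //= in h1; rewrite (bigD1 G) //= -h1 in h2.
move: h2; suff -> : \sum_(K | flG G K && (K != G)) y K = \sum_(K | flG G K && (K != G)) s K.
  by move/addIr.
apply: eq_bigr => K /andP[/and3P[Kf FK KG] nK]; rewrite IHn //.
by apply: leq_trans le; apply: proper_card; rewrite properEneq nK.
Qed.

Lemma form_degenerate G : G \in flats M -> F \proper G ->
    matroid_connected (minor M F G) -> (#|G :\: F|%:R : k) = 0 ->
  ~ forall f, inV f -> (forall g, inV g -> dot f g = 0) -> f = 0.
Proof.
move=> Gf FpG con c0 nondeg; have FG := proper_sub FpG; have Gg := flat_ground Gf.
have /properP[_ [e eG eF]] := FpG; have eE : e \in G :\: F by rewrite inE eF.
pose N := minor M F G.
have gN : ground N = G :\: F by apply: minor_ground.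
have rN A : rank N A = crank M F A by apply: minor_rank.
have GU : (G :\: F) :|: F = G by rewrite setUC -[RHS](setID G F) (setIidPr FG).
have rpos : (0 < rank N (ground N))%N.
  by rewrite rN gN /crank GU subn_gt0; apply: flat_ltn.
have sf : sepfree N by move=> A; apply: connected_sep.
have := beta_gt0 sf rpos; rewrite lt_neqAle => /andP[/negP b0 _]; apply: b0.
rewrite eq_sym /beta mulf_eq0 signr_eq0 orFb /alt_sum gN.
have -> : \sum_(A in powerset (G :\: F)) (-1) ^+ #|A| * (rank N A)%:R
    = \sum_(A in powerset (G :\: F)) (-1) ^+ #|A| * (rho (clos M (A :|: F)) - rho F)%N%:R :> int.
  apply: eq_bigr => A; rewrite powersetE subsetD rN => /andP[AG _].
  by rewrite rank_clos // subUset Fg (subset_trans AG).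
rewrite (sum_weighted_y (fun K => (rho K - rho F)%N%:R) Gf FG).
have := Yg_weighted Gf FG eE nondeg c0.
under eq_bigr do rewrite mulrA; rewrite (Yg_sum Gf FG (fun j => (-1) ^+ j * j%:R)) => z.
apply/eqP; rewrite -[RHS]z; apply: eq_bigr => K /and3P[Kf FK KG].
by rewrite -s_eq_y // /s mulrAC.
Qed.

End Degenerate.

(** * The representation on the exterior algebra *)

Section Representation.
Variables (T : finType) (M : matroid T) (k : fieldType) (F : {set T}).
Hypothesis Ff : F \in flats M.
Implicit Types (A G H K L X Y : {set T}) (s t : seq {set T}).
Local Notation ext := (ext T k).
Local Notation prj := (@prj T M k F).
Local Notation dnF := (@stdn T M k F).
Local Notation upF := (@stup T M k F).
Local Notation fp := (@Defs.fpath T M).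
Local Notation pi := (rpi (@S_rel T M)).
Implicit Types (f g : ext).

(** The action of the path [(K, L)], from the component at [L] to the one at [K]; the two tests
    exclude each other. *)
Definition astep K L f : ext :=
  if covers M L K then dnF K L f else if covers M K L then upF K L f else 0.

Lemma covers_asym K L : covers M K L -> covers M L K = false.
Proof.
move=> c; apply/negP => /covers_sub LK; have := covers_proper c.
by rewrite properE LK andbF.
Qed.

Lemma astep_dn K L f : covers M L K -> astep K L f = dnF K L f.
Proof. by rewrite /astep => ->. Qed.

Lemma astep_up K L f : covers M K L -> astep K L f = upF K L f.
Proof. by move=> c; rewrite /astep c (covers_asym c). Qed.

Fact astep_linear K L : linear (astep K L).
Proof.
move=> c f g; rewrite /astep /stdn /stup; case: ifP => _; first by rewrite !linearP.
by case: ifP => _; rewrite ?linearP // scaler0 addr0.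
Qed.

HB.instance Definition _ K L := GRing.isLinear.Build k ext ext _ (astep K L) (astep_linear K L).

Lemma prj_astep K L f : prj K (astep K L f) = astep K L f.
Proof.
rewrite /astep /stdn /stup; case: ifP => _; first by rewrite prj_prj eqxx.
by case: ifP => _; rewrite ?prj_prj ?eqxx // raddf0.
Qed.

Lemma astep_prj K L f : astep K L (prj L f) = astep K L f.
Proof. by rewrite /astep /stdn /stup prj_prj eqxx. Qed.

Fixpoint actp K s f : ext := if s is L :: s' then astep K L (actp L s' f) else prj K f.

Fact actp_linear K s : linear (actp K s).
Proof.
move=> c f g; elim: s K => [|L s IHs] K /=; first exact: linearP.
by rewrite IHs linearP.
Qed.

HB.instance Definition _ K s := GRing.isLinear.Build k ext ext _ (actp K s) (actp_linear K s).

Lemma prj_actp K s f : prj K (actp K s f) = actp K s f.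
Proof. by case: s => [|L s] /=; rewrite ?prj_astep ?prj_prj ?eqxx. Qed.

Lemma actp_cat K s L t f :
  actp K s (actp L t f) = if last K s == L then actp K (s ++ t) f else 0.
Proof.
elim: s K => [|H s IHs] K /=; last by rewrite IHs; case: ifP; rewrite ?raddf0.
rewrite -prj_actp prj_prj; case: eqP => [->|_] //; exact: prj_actp.
Qed.

Lemma actp_invalid K s f : ~~ is_flag_path M (K, s) -> actp K s f = 0.
Proof.
elim: s K => [|L s IHs] K.
  rewrite /is_flag_path /= andbT => nK; apply/ffunP => A; rewrite !ffunE.
  by case: ifP => // /(bas_flat Ff) h; rewrite h in nK.
have -> : is_flag_path M (K, L :: s) = is_flag_path M (K, [:: L]) && is_flag_path M (L, s).
  exact: (is_flag_path_cat M K [:: L] s).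
rewrite negb_and => /orP[n|/IHs /= ->]; last by rewrite raddf0.
rewrite /= /astep; case: ifP => [c|_].
  by move: n; rewrite /is_flag_path /= (covers_flatr c) /adj c orbT.
by case: ifP => // c; move: n; rewrite /is_flag_path /= (covers_flatl c) /adj c.
Qed.

Lemma actp_bad K s f H : H \in K :: s -> ~~ (F \subset H) -> actp K s f = 0.
Proof.
move=> Hs nF; elim: s K Hs => [|L s IHs] K; rewrite in_cons.
  by rewrite in_nil orbF => /eqP <- /=; rewrite prj_sub.
case/orP=> [/eqP <- /=|/IHs /= ->]; last by rewrite raddf0.
by rewrite -prj_astep prj_sub.
Qed.

Definition act f (x : path_alg M) : ext :=
  malg_lift (fun p : flag_path M => actp (fhead p) (ftail p) f) x.

Lemma actB f x y : act f (x - y) = act f x - act f y. Proof. exact: malg_liftB. Qed.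

HB.instance Definition _ f := GRing.isZmodMorphism.Build (path_alg M) ext (act f) (actB f).

Lemma act_zero f : act f 0 = 0. Proof. exact: raddf0. Qed.

Lemma act_basis f p : act f (path_basis p) = actp (fhead p) (ftail p) f.
Proof. by rewrite /act path_basis.unlock malg_liftU. Qed.

Lemma act_fpath f K s : act f (fp K s) = actp K s f.
Proof.
have [p|np] := boolP (is_flag_path M (K, s)); last by rewrite fpath_invalid // raddf0 actp_invalid.
by rewrite (fpath_basisE p) act_basis /fhead /ftail SubK.
Qed.

Lemma act_linear x : linear (act^~ x).
Proof.
move=> c f g; elim/path_alg_ind: x => [|p|x y hx hy].
- by rewrite /= !act_zero scaler0 addr0.
- by rewrite /= !act_basis linearP.
- by rewrite /= !actB hx hy /= scalerBr addrACA -opprD.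
Qed.

Lemma act0 x : act 0 x = 0.
Proof. by have := act_linear x (-1) 0 0; rewrite !scaler0 addr0 scaleN1r addNr. Qed.

Lemma actBl f g x : act (f - g) x = act f x - act g x.
Proof. by rewrite addrC -scaleN1r act_linear scaleN1r addrC. Qed.

Lemma actM x y f : act f (x * y) = act (act f y) x.
Proof.
elim/path_alg_ind: x => [|p|x x' hx hx']; first by rewrite mul0r !raddf0.
- elim/path_alg_ind: y => [|q|y y' hy hy']; first by rewrite mulr0 !raddf0 act0.
    rewrite -!fpath_val fpath_mul !act_fpath actp_cat.
    by case: ifP => _; rewrite ?act_fpath ?raddf0.
  by rewrite mulrBr !actB hy hy' actBl.
- by rewrite mulrBl !actB hx hx'.
Qed.

Lemma act_S_rel f x : @S_rel T M x -> act f x = 0.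
Proof.
case=> [L K Lf Kf LK r|L K Lf Kf LK r|K K' L c c'].
- rewrite raddf_sum -[RHS](model_fsu Ff f r); apply: eq_bigr => X /andP[_ /andP[c1 c2]].
  by rewrite [LHS]act_fpath /= astep_prj !astep_up.
- rewrite raddf_sum -[RHS](model_fsd Ff f r); apply: eq_bigr => X /andP[_ /andP[c1 c2]].
  by rewrite [LHS]act_fpath /= astep_prj !astep_dn.
rewrite actB act_fpath /= astep_prj astep_up // astep_dn // model_cap // /cap_value.
case: eqP => _; first by rewrite raddfMn /= act_fpath subrr.
case: ifP => cY; last by rewrite act_zero subrr.
have cY' := cY; rewrite (covers_cap c c') in cY'.
by rewrite raddfN /= act_fpath /= astep_prj astep_dn // astep_up // subrr.
Qed.

Lemma act_rel f x : ideal_gen (@S_rel T M) x -> act f x = 0.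
Proof.
move=> h; elim: h f => [|y|x' y _ hx _ hy|a x' _ hx|a x' _ hx] f.
- exact: act_zero.
- by move=> g; apply: act_S_rel.
- by rewrite actB hx hy subrr.
- by rewrite actM hx act0.
- by rewrite actM hx.
Qed.

Lemma act_rrepr f x : act f (rrepr (pi x)) = act f x.
Proof.
by apply/eqP; rewrite -subr_eq0 -raddfB; apply/eqP/act_rel/rpi_eq; rewrite rreprK.
Qed.

(** Evaluation at [ext1]; by [act_rrepr] the representative does not matter. *)
Definition psi0 (x : S_ideal_type M F) : ext := act (ext1 T k) (rrepr (val x)).

Lemma psi0B x y : psi0 (x - y) = psi0 x - psi0 y.
Proof.
rewrite /psi0 raddfB /= -raddfB /=.
by rewrite -[LHS]act_rrepr -[RHS]act_rrepr rreprK raddfB /= !rreprK.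
Qed.

(** A flat not containing [F] has no basis over [F], so its component is zero and any path through
    it acts by 0. *)
Lemma psi0_bad x : zspan (@bad_path T M F) x -> psi0 x = 0.
Proof.
elim=> [|{}x [p [lp [K Kp FK] xE]]|u v _ hu _ hv].
- by have := psi0B 0 0; rewrite !subrr.
- by rewrite /psi0 xE act_rrepr act_basis (actp_bad _ Kp FK).
- by rewrite psi0B hu hv subrr.
Qed.

Definition psi1 (x : standard M F) : ext := psi0 (lrepr x).

Lemma psi1_pi x : psi1 (lpi _ x) = psi0 x.
Proof.
apply/eqP; rewrite -subr_eq0 -psi0B; apply/eqP/psi0_bad.
have := lreprK (lpi (zspan_pred (@bad_path T M F)) x) => /lpi_eq /asboolP; exact.
Qed.

Lemma psi1B x y : psi1 (x - y) = psi1 x - psi1 y.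
Proof. by rewrite -[x]lreprK -[y]lreprK -raddfB /= !psi1_pi psi0B. Qed.

Lemma psi1_0 : psi1 0 = 0.
Proof. by have := psi1B 0 0; rewrite !subrr. Qed.

Lemma psi1D x y : psi1 (x + y) = psi1 x + psi1 y.
Proof. by rewrite -{1}[y]opprK psi1B -[- y]sub0r psi1B psi1_0 sub0r opprK. Qed.

Lemma psi1Z (y : path_alg M) x : psi1 (pi y *: x) = act (psi1 x) y.
Proof.
rewrite -[x]lreprK -lpi_scalable !psi1_pi /psi0 GRing.valZ.
by rewrite -actM -[RHS]act_rrepr rmorphM /= rreprK.
Qed.

Let fl (x : standard M F) (c : k^o) : ext := c *: psi1 x.

Let flDl x y c : fl (x + y) c = fl x c + fl y c.
Proof. by rewrite /fl psi1D scalerDr. Qed.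

Let flDr x c d : fl x (c + d) = fl x c + fl x d.
Proof. by rewrite /fl scalerDl. Qed.

Definition psi (v : standardk M F k) : ext := tensor_lift fl v.

Lemma psi_tens x (c : k^o) : psi (tens x c) = c *: psi1 x.
Proof. exact: (tensor_liftE flDl flDr). Qed.

Lemma psiB v w : psi (v - w) = psi v - psi w.
Proof. exact: (tensor_liftB flDl flDr). Qed.

Lemma psi_0 : psi 0 = 0.
Proof. exact: (tensor_lift0 flDl flDr). Qed.

Lemma psiD v w : psi (v + w) = psi v + psi w.
Proof. by rewrite -{1}[w]opprK psiB -[- w]sub0r psiB psi_0 sub0r opprK. Qed.

Lemma psiZ (y : path_alg M) (c : k) v : psi ((tens (pi y) c : S_algk M k) *: v) = c *: act (psi v) y.
Proof.
elim/tensor_ind: v => [|x d|v w hv hw].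
- by rewrite scaler0 psi_0 act0 scaler0.
- rewrite SkZ !psi_tens psi1Z -scalerA; congr (_ *: _).
  by have := act_linear y d (psi1 x) 0; rewrite !addr0 act0 addr0.
- rewrite scalerBr !psiB hv hw -scalerBr; congr (_ *: _).
  by rewrite -scaleN1r addrC -act_linear addrC scaleN1r.
Qed.

Lemma psi_stdk_gen : psi (stdk_gen M k F) = ext1 T k.
Proof.
rewrite psi_tens scale1r psi1_pi /psi0 val_ideal_genF act_rrepr act_fpath /=.
apply/ffunP => A; rewrite !ffunE bas_F //; by case: eqP.
Qed.

(** A nonzero module is part of simplicity; nothing in the presentation excludes collapse, so this
    is read off the model. *)
Lemma stdk_gen_neq0 : stdk_gen M k F != 0.
Proof.
apply/eqP => h; have := psi_stdk_gen; rewrite h psi_0 => /eqP.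
by rewrite eq_sym (negbTE (ext1_neq0 T k)).
Qed.

Lemma psi_e K v : psi (Se M k K *: v) = prj K (psi v).
Proof. by rewrite psiZ scale1r act_fpath. Qed.

Lemma psi_g K L v : psi (Sg M k K L *: v) = astep K L (psi v).
Proof. by rewrite psiZ scale1r act_fpath /= astep_prj. Qed.

Lemma psi_kap c v : psi (Skap M c *: v) = c *: psi v.
Proof.
rewrite /Skap; elim/tensor_ind: v => [|x d|v w hv hw].
- by rewrite scaler0 psi_0 scaler0.
- by rewrite SkZ scale1r !psi_tens scalerA.
- by rewrite scalerBr !psiB hv hw scalerBr.
Qed.

Lemma psi_onto f : inV M F f -> exists v, psi v = f.
Proof.
apply: (@inV_generated T M k F Ff (fun f => exists v, psi v = f)) => [|c|g h [v <-] [w <-]|K H g c [v <-]].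
- by exists 0; apply: psi_0.
- by exists (Skap M c *: stdk_gen M k F); rewrite psi_kap psi_stdk_gen.
- by exists (v + w); rewrite psiD.
- by exists (Sg M k K H *: v); rewrite psi_g astep_dn.
Qed.

(** The vectors mapped into the radical of the form are a submodule, by adjointness of the two kinds
    of steps. It misses the generator, since [ext1] pairs with itself to 1, so it is zero;
    [psi_onto] lifts [f]. *)
Lemma simple_nondegenerate : simple_module (standardk M F k) ->
  forall f : ext, inV M F f -> (forall g, inV M F g -> dot f g = 0) -> f = 0.
Proof.
case=> _ _ min f fV fz; have [v vE] := psi_onto fV.
pose orth (v : standardk M F k) := forall g, inV M F g -> dot (psi v) g = 0.
have dotr (c : k) (x y g : ext) : dot (c *: x + y) g = c * dot x g + dot y g.
  by rewrite !(dotC _ g) linearP.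
have orthB x y : orth x -> orth y -> orth (x - y).
  by move=> hx hy g gV; rewrite psiB dotC raddfB /= !(dotC g) hx // hy // subrr.
have orth0 : orth 0 by move=> g _; rewrite psi_0 dotC raddf0.
have orthZ (a : S_algk M k) x : orth x -> orth (a *: x).
  apply: (flag_alg_stable (S := Sk_alg M k)) => // [c u h g gV|K u h g gV|K L u h g gV].
  - by rewrite psi_kap -[_ *: _]addr0 dotr h // mulr0 add0r dotC raddf0.
  - by rewrite psi_e prj_adj h //; apply: inV_prj.
  - rewrite psi_g /astep; case: ifP => _.
      by rewrite stdn_adj h //; apply: inV_stup.
    case: ifP => _; last by rewrite dotC raddf0.
    by rewrite stup_adj h //; apply: inV_stdn.
have [|//|z|z] := min (fun x => `[< orth x >]).
- split=> [|a x y /asboolP hx /asboolP hy]; apply/asboolP => //.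
  have hx' := orthZ (- a) _ hx; rewrite addrC -[a *: x]opprK -scaleNr; exact: orthB.
- have : v \in pred1 0 by rewrite -z; apply/asboolP => g gV; rewrite vE fz.
  by rewrite inE => /eqP v0; rewrite -vE v0 psi_0.
have : stdk_gen M k F \in predT by [].
rewrite -z => /asboolP /(_ (ext1 T k) (inV_ext1 _ Ff)); rewrite psi_stdk_gen.
rewrite /dot (bigD1 set0) //= !ffunE eqxx mulr1 big1 => [|A /negbTE nA].
  by rewrite addr0 => /eqP; rewrite oner_eq0.
by rewrite !ffunE nA mulr0.
Qed.

Lemma simple_condition K : simple_module (standardk M F k) -> K \in flats M -> F \proper K ->
  matroid_connected (minor M F K) -> (#|K :\: F|%:R : k) != 0.
Proof.
move=> sim Kf FK con; apply/negP => /eqP c0.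
exact: (form_degenerate Ff Kf FK con c0 (simple_nondegenerate sim)).
Qed.

End Representation.

Lemma char_dvdn (k : fieldType) ell n : has_characteristic k ell ->
  (ell %| n)%N = ((n%:R : k) == 0).
Proof.
case=> [ch|[-> ch]]; first exact: dvdn_pcharf.
by rewrite dvd0n (proj1 (pcharf0P k) ch).
Qed.

Local Close Scope ring_scope.

Theorem theorem1p3 (T : finType) (M : matroid T) (k : fieldType) (ell : nat)
    (char_k : has_characteristic k ell) :
  (forall F : {set T}, F \in flats M ->
     simple_module (standardk M F k) <->
     (forall K : {set T}, K \in flats M -> F \proper K ->
        matroid_connected (minor M F K) -> ~~ (ell %| #|K :\: F|)%N)) /\
  (semisimple_ring (S_algk M k) <->
   (forall F K : {set T}, F \in flats M -> K \in flats M -> F \proper K ->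
      matroid_connected (minor M F K) -> ~~ (ell %| #|K :\: F|)%N)).
Proof.
split=> [F Ff|]; split.
- move=> sim K Kf FK con; rewrite (char_dvdn _ char_k).
  exact: (simple_condition Ff sim Kf FK con).
- move=> good; apply: (standardk_simple Ff (stdk_gen_neq0 k Ff)) => K Kf FK con.
  by rewrite -(char_dvdn _ char_k) good.
- move=> ss F K Ff Kf FK con; rewrite (char_dvdn _ char_k).
  have sim := semisimple_standardk (stdk_gen_neq0 k Ff) ss.
  exact: (simple_condition Ff sim Kf FK con).
- move=> good; apply: (flag_alg_semisimple (Sk_alg M k)) => F K Ff Kf FK con.
  by rewrite -(char_dvdn _ char_k) good.
Qed.
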